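(* Let $d\ge1$ and $0<\delta,\delta'<d$. Let $X,Y\subset\mathbf{R}^d$ be compact sets such that $X$ is $\delta$-regular and $Y$ is $\delta'$-regular on scales $[0,1]$, and such that $(X,Y)$ is nonorthogonal with respect to the dot product, i.e. $\Phi$-nonorthogonal with some constant $c_N\in(0,1]$ from scales $0$ to $1$, with $\Phi(x,y)=-x\cdot y$ on $\mathbf{R}^d\times\mathbf{R}^d$. Then there exist $\varepsilon_0>0$ and $C>0$ such that for all $h\in(0,1)$, $$\|1_{X_h}\mathscr{F}_h1_{Y_h}\|_{L^2(\mathbf{R}^d)\to L^2(\mathbf{R}^d)}\le C h^{\frac{d-\delta-\delta'}{2}+\varepsilon_0}.$$
   Context: Notation: $\mathscr{F}_hf(\xi)=(2\pi h)^{-d/2}\int_{\mathbf{R}^d}e^{-ix\cdot\xi/h}f(x)\,dx$ is the semiclassical Fourier transform; $X_h=X+B_h$, $Y_h=Y+B_h$ with $B_h=B(0,h)$ the Euclidean ball; $1_A$ denotes multiplication by the indicator function of $A$. Regularity: a compactly supported finite Borel measure $\mu$ on $\mathbf{R}^d$ is Ahlfors–David regular of dimension $\delta\in[0,d]$ on scales $[\alpha,\beta]$ with regularity constant $C_R\ge1$ if for every closed square box $I$ with side length $r\in[\alpha,\beta]$, or closed ball $I$ with radius $r\in[\alpha,\beta]$, $\mu(I)\le C_Rr^\delta$, and if in addition $I$ is centered at a point of $\operatorname{supp}\mu$, then $C_R^{-1}r^\delta\le\mu(I)$. A set $X$ is $\delta$-regular on these scales if $X=\operatorname{supp}\mu$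 for such a measure $\mu$ (for some $C_R$). Nonorthogonality: $(X,Y)$ is $\Phi$-nonorthogonal with constant $0<c_N\le1$ from scales $0$ to $1$ if for any $x_0\in X$, $y_0\in Y$, $r_X\in(0,1)$, $r_Y\in(0,1)$ there exist $x_1,x_2\in X\cap B(x_0,r_X)$ and $y_1,y_2\in Y\cap B(y_0,r_Y)$ such that $$|\Phi(x_1,y_1)-\Phi(x_2,y_1)-\Phi(x_1,y_2)+\Phi(x_2,y_2)|\ge c_Nr_Xr_Y.$$ *)

(* Defs.v *)
From HB Require Import structures.
From mathcomp Require Import all_boot all_order all_algebra.
From mathcomp Require Import complex lra.
From mathcomp Require Import all_classical all_reals all_analysis.
From mathcomp Require Import measurable_realfun.

Set Implicit Arguments.
Unset Strict Implicit.
Unset Printing Implicit Defensive.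

Import Order.TTheory GRing.Theory Num.Theory.
Import numFieldNormedType.Exports.

Local Open Scope classical_set_scope.
Local Open Scope ring_scope.

(* R^n is 'rV[R]_n, with the Borel sigma-algebra of its topology. *)
HB.instance Definition _ (R : realType) (n : nat) :=
  @isMeasurable.Build (sigma_display (@open 'rV[R]_n)) 'rV[R]_n
    <<s @open 'rV[R]_n >> (@sigma_algebra0 _ setT (@open 'rV[R]_n))
    (@sigma_algebraC _ (@open 'rV[R]_n))
    (@sigma_algebra_bigcup _ setT (@open 'rV[R]_n)).

Lemma open_measurable_rV (R : realType) n (U : set 'rV[R]_n) :
  open U -> measurable U.
Proof. exact: sub_sigma_algebra. Qed.

Lemma measurable_fun_rV d (T : measurableType d) (R : realType) n
    (f : T -> 'rV[R]_n) :
  (forall j, measurable_fun setT (fun x => f x ord0 j)) ->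
  measurable_fun setT f.
Proof.
move=> mf; apply: (@measurability _ _ _ _ _ _ (@open 'rV[R]_n)) => //.
move=> _ [U oU <-]; rewrite setTI.
pose B (i : 'rV[rat]_n * nat) : set 'rV[R]_n :=
  [set v | forall j, ball (ratr (i.1 ord0 j) : R) i.2.+1%:R^-1 (v ord0 j)].
have -> : f @^-1` U = \bigcup_i (f @^-1` [set v | B i v /\ B i `<=` U]).
  apply/seteqP; split=> x /=; last by case=> i _ [Bi BU]; exact: BU.
  move=> Ufx.
  have : nbhs (f x) U by exact: open_nbhs_nbhs.
  move=> /nbhs_ballP[e /= e0 eU].
  pose k := Num.truncn (2 / e).
  pose c : R := k.+1%:R^-1.
  have c0 : 0 < c by rewrite invr_gt0 ltr0n.
  have ke : c < e / 2.
    rewrite -[ltRHS]invrK ltf_pV2 ?posrE ?ltr0n ?invr_gt0 ?divr_gt0//.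
    by rewrite invf_div truncnS_gt.
  have q j : {q : rat | ball (ratr q : R) c (f x ord0 j)}.
    apply: cid.
    have : f x ord0 j - c < f x ord0 j + c.
      by rewrite ltrBlDr -addrA ltrDl addr_gt0.
    move=> /rat_in_itvoo[q]; rewrite in_itv/= => /andP[q1 q2].
    exists q; rewrite /ball/= ltr_distlC; move: c q1 q2 {c0 ke} => c q1 q2.
    by apply/andP; split; lra.
  exists (\row_j sval (q j), k) => //=; split.
    by move=> j /=; rewrite mxE; exact: (svalP (q j)).
  move=> v Bv; apply: eU; split => // i j.
  rewrite (ord1 i); have := Bv j; rewrite /= mxE; have := svalP (q j).
  rewrite /ball/= => h1 h2.
  rewrite distrC; apply: le_lt_trans (ler_distD (ratr (sval (q j))) _ _) _.
  by rewrite (splitr e) ltrD// ?(lt_trans _ ke)// distrC.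
apply: countable_bigcupT_measurable => // i.
have [BU|BU] := pselect (B i `<=` U); last first.
  rewrite (_ : _ @^-1` _ = set0)//; apply/seteqP; split => // x /=.
  by case.
rewrite (_ : _ @^-1` _ = \bigcap_(j in [set: 'I_n])
    ((fun x => f x ord0 j) @^-1` ball (ratr (i.1 ord0 j) : R) i.2.+1%:R^-1)); last first.
  apply/seteqP; split=> x /=; first by case=> + _ j _; exact.
  by move=> h; split=> // j; exact: h.
apply: fin_bigcap_measurable => // j _.
rewrite -[X in measurable X]setTI; apply: mf => //.
exact: measurable_ball.
Qed.


Lemma coord_measurable_rV (R : realType) n (j : 'I_n) :
  measurable_fun setT (fun v : 'rV[R]_n => v ord0 j).
Proof.
apply: (measurability _ (RGenOpens.measurableE R)).
move=> _ [_ [a [b ->] <-]]; rewrite setTI; apply: open_measurable_rV.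
apply: (@open_comp _ _ (fun v : 'rV[R]_n => v ord0 j)); last exact: interval_open.
by move=> + _; exact: coord_continuous.
Qed.

Section lebesgue_rV.
Context (R : realType).

(* `lebesgue_rV n` is the n-fold product of the one-dimensional Lebesgue
   measure, transported along R * R^n -> R^(n+1). *)
Definition cons_rV n (p : R * 'rV[R]_n) : 'rV[R]_n.+1 :=
  \row_j oapp (p.2 ord0) p.1 (unlift ord0 j).

Definition uncons_rV n (v : 'rV[R]_n.+1) : R * 'rV[R]_n :=
  (v ord0 ord0, \row_j v ord0 (lift ord0 j)).

Lemma cons_rVK n : cancel (@cons_rV n) (@uncons_rV n).
Proof.
move=> [a v]; rewrite /uncons_rV /cons_rV !mxE unlift_none; congr pair.
by apply/rowP => j; rewrite !mxE liftK.
Qed.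

Lemma measurable_cons_rV n : measurable_fun setT (@cons_rV n).
Proof.
apply: measurable_fun_rV => j.
rewrite (_ : (fun _ => _) =
    fun p : R * 'rV[R]_n => oapp (p.2 ord0) p.1 (unlift ord0 j)); last first.
  by apply/funext => p; rewrite mxE.
case: unliftP => [k _|_] /=; last exact: measurable_fst.
apply: (measurableT_comp (coord_measurable_rV k)); exact: measurable_snd.
Qed.

Lemma measurable_uncons_rV n : measurable_fun setT (@uncons_rV n).
Proof.
apply: measurable_fun_pair; first exact: coord_measurable_rV.
apply: measurable_fun_rV => j; under eq_fun do rewrite mxE.
exact: coord_measurable_rV.
Qed.

Section step.
Variables (n : nat) (m : {sigma_finite_measure set 'rV[R]_n -> \bar R}).

Definition lebesgue_rV_step : set 'rV[R]_n.+1 -> \bar R :=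
  pushforward (@lebesgue_measure R \x m)%E (@cons_rV n).

Let step0 : lebesgue_rV_step set0 = 0%E.
Proof. by rewrite /lebesgue_rV_step /pushforward preimage_set0 measure0. Qed.

Let step_ge0 A : (0 <= lebesgue_rV_step A)%E.
Proof. by rewrite /lebesgue_rV_step /pushforward; exact: measure_ge0. Qed.

Let step_sigma_additive : semi_sigma_additive lebesgue_rV_step.
Proof.
have mc A : measurable A -> measurable (@cons_rV n @^-1` A).
  by move=> mA; rewrite -[X in measurable X]setTI; exact: measurable_cons_rV.
move=> F mF tF mUF; rewrite /lebesgue_rV_step /pushforward preimage_bigcup.
apply: measure_semi_sigma_additive; first by move=> k; exact: mc.
- apply/trivIsetP => i j _ _ ij; rewrite -preimage_setI.
  by move/trivIsetP : tF => /(_ _ _ _ _ ij) ->//; rewrite preimage_set0.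
- by rewrite -preimage_bigcup; exact: mc.
Qed.

HB.instance Definition _ := isMeasure.Build _ _ _ lebesgue_rV_step
  step0 step_ge0 step_sigma_additive.

Lemma sigma_finite_lebesgue_rV_step : sigma_finite setT lebesgue_rV_step.
Proof.
have /sigma_finiteP[F [FT ndF Foo]] := sigma_finiteT (@lebesgue_measure R).
have /sigma_finiteP[G [GT ndG Goo]] := sigma_finiteT m.
exists (fun k => @uncons_rV n @^-1` (F k `*` G k)).
  apply/esym; rewrite -subTset => v _.
  have [i _ Fi] : (\bigcup_i F i) (uncons_rV v).1 by rewrite -FT.
  have [j _ Gj] : (\bigcup_j G j) (uncons_rV v).2 by rewrite -GT.
  exists (maxn i j) => //; split.
    by move: Fi; exact/subsetPset/ndF/leq_maxl.
  by move: Gj; exact/subsetPset/ndG/leq_maxr.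
move=> k; have [mF Fk] := Foo k; have [mG Gk] := Goo k; split.
  rewrite -[X in measurable X]setTI; apply: measurable_uncons_rV => //.
  exact: measurableX.
rewrite /lebesgue_rV_step /pushforward.
rewrite (_ : _ @^-1` (_ @^-1` _) = F k `*` G k); last first.
  by apply/funext => p; rewrite /preimage /mkset cons_rVK.
by rewrite product_measure1E// lte_mul_pinfty// ge0_fin_numE.
Qed.

HB.instance Definition _ := Measure_isSigmaFinite.Build _ _ _
  lebesgue_rV_step sigma_finite_lebesgue_rV_step.

End step.

Fixpoint lebesgue_rV n : {sigma_finite_measure set 'rV[R]_n -> \bar R} :=
  match n with
  | 0 => dirac (0 : 'rV[R]_0)
  | n'.+1 => lebesgue_rV_step (lebesgue_rV n')
  end.

Lemma lebesgue_rV_box n (A : 'I_n -> set R) :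
  (forall j, measurable (A j)) ->
  lebesgue_rV n [set v | forall j, A j (v ord0 j)] =
  (\prod_j @lebesgue_measure R (A j))%E.
Proof.
elim: n A => [|n IH] A mA.
  rewrite big_ord0 /= diracE mem_set// => -[].
  by [].
pose B := [set v : 'rV[R]_n | forall j, A (lift ord0 j) (v ord0 j)].
have mB : measurable B.
  rewrite (_ : B = \bigcap_(j in [set: 'I_n])
      ((fun v : 'rV[R]_n => v ord0 j) @^-1` A (lift ord0 j))); last first.
    by apply/seteqP; split=> v /= h j; [move=> _|]; exact: h.
  apply: fin_bigcap_measurable => // j _.
  by rewrite -[X in measurable X]setTI; exact: coord_measurable_rV.
rewrite big_ord_recl -(IH (fun j => A (lift ord0 j)))// -/B.
rewrite /= /lebesgue_rV_step /pushforward.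
transitivity ((@lebesgue_measure R \x lebesgue_rV n)%E (A ord0 `*` B)); last first.
  apply: product_measure1E => //; exact: mA.
congr ((_ \x _)%E _); apply/seteqP; split=> -[a v] /=.
  move=> h; split=> [|j]; first by have := h ord0; rewrite mxE unlift_none.
  by have := h (lift ord0 j); rewrite mxE liftK.
by move=> [h0 h] j; rewrite mxE; case: unliftP => [k ->|->] /=.
Qed.

End lebesgue_rV.

Section euclidean.
Context (R : realType) (d : nat).
Implicit Types (x y c : 'rV[R]_d) (r : R) (X : set 'rV[R]_d).

Definition dot x y : R := \sum_i x ord0 i * y ord0 i.

(* The library norm on 'rV[R]_d is the max norm, and its `ball` and
   `closed_ball` are cubes; `eball` and `eclosed_ball` below are Euclidean. *)
Definition enorm x : R := Num.sqrt (dot x x).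

Definition eball c r : set 'rV[R]_d := [set x | enorm (x - c) < r].

Definition eclosed_ball c r : set 'rV[R]_d := [set x | enorm (x - c) <= r].

Definition closed_box c r : set 'rV[R]_d :=
  [set x | forall i, `|x ord0 i - c ord0 i| <= r / 2].

Definition thicken X r : set 'rV[R]_d :=
  [set x + b | x in X & b in eball 0 r].

Definition msupport (mu : set 'rV[R]_d -> \bar R) : set 'rV[R]_d :=
  [set x | forall U, open U -> U x -> (0 < mu U)%E].

(* Scales are allowed to be 0, where 0 `^ delta is (delta == 0)%:R. *)
Definition AD_regular_measure (mu : {finite_measure set 'rV[R]_d -> \bar R})
    (delta alpha beta C_R : R) : Prop :=
  [/\ compact (msupport mu), 0 <= delta <= d%:R, 1 <= C_R
    & forall c r, alpha <= r <= beta ->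
        forall I, I = closed_box c r \/ I = eclosed_ball c r ->
        (mu I <= (C_R * r `^ delta)%:E)%E /\
        (msupport mu c -> ((C_R^-1 * r `^ delta)%:E <= mu I)%E)].

Definition AD_regular_set X (delta alpha beta : R) : Prop :=
  exists (mu : {finite_measure set 'rV[R]_d -> \bar R}) (C_R : R),
    AD_regular_measure mu delta alpha beta C_R /\ X = msupport mu.

Definition nonorthogonal (Phi : 'rV[R]_d -> 'rV[R]_d -> R) X
    (Y : set 'rV[R]_d) (c_N : R) : Prop :=
  forall x0 y0 (r_X r_Y : R), X x0 -> Y y0 -> 0 < r_X < 1 -> 0 < r_Y < 1 ->
  exists x1 x2 y1 y2,
    [/\ (X `&` eball x0 r_X) x1, (X `&` eball x0 r_X) x2,
        (Y `&` eball y0 r_Y) y1, (Y `&` eball y0 r_Y) y2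
      & c_N * r_X * r_Y <=
        `|Phi x1 y1 - Phi x2 y1 - Phi x1 y2 + Phi x2 y2|].

End euclidean.

Section operators.
Context (R : realType) (d : nat).
Implicit Types (f g : 'rV[R]_d -> R[i]) (A : set 'rV[R]_d) (h : R).

Definition expi (t : R) : R[i] := (cos t +i* sin t)%C.

Definition cintegral f : R[i] :=
  (Rintegral (lebesgue_rV R d) setT (fun x => complex.Re (f x)) +i*
   Rintegral (lebesgue_rV R d) setT (fun x => complex.Im (f x)))%C.

(* The integral is meaningful for integrable f; here it is only applied to
   square-integrable functions vanishing off a bounded set. *)
Definition sc_fourier h f : 'rV[R]_d -> R[i] := fun xi =>
  ((2 * pi * h) `^ (- (d%:R / 2)))%:C%C *
  cintegral (fun x => expi (- (dot x xi / h)) * f x).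

Definition mul_indic A f : 'rV[R]_d -> R[i] := fun x => (\1_A x)%:C%C * f x.

Definition L2norm f : \bar R :=
  Lnorm (lebesgue_rV R d) 2%:E (fun x => (ComplexField.Normc.normc (f x))%:E).

Definition L2 : set ('rV[R]_d -> R[i]) :=
  [set f | [/\ measurable_fun setT (fun x => complex.Re (f x)),
               measurable_fun setT (fun x => complex.Im (f x))
             & (L2norm f < +oo)%E]].

Definition L2opnorm (T : ('rV[R]_d -> R[i]) -> 'rV[R]_d -> R[i]) : \bar R :=
  ereal_sup [set L2norm (T f) | f in [set f | L2 f /\ (L2norm f <= 1)%E]].

End operators.

(* Main.v *)
Require Import Defs.
From mathcomp Require Import all_boot all_order all_algebra finmap.
From mathcomp Require Import complex ring lra.
From mathcomp Require Import all_classical all_reals all_analysis.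
From mathcomp Require Import measurable_realfun.

(** The obstacle is that the partial sum of a cluster can be tiny or vanish, so its phase cannot be
    followed from one point to another. Its variation is therefore measured relative to the majorant
    only. The phase becomes meaningful exactly when it is needed: if |g_1 + g_2| almost equals M_1 +
    M_2, then each |g_i| almost equals M_i.

    The gain so obtained is e^2 min(M_1, M_2), which may be negligible next to the sum of all the
    majorants of the new cluster. Normalising by masses is what makes it count: in the weighted
    Cauchy-Schwarz inequality a factor 1 - e^2 on a single child lowers the constant by e^2 times
    the share of the mass held by that child, however small its majorant is, and regularity bounds
    this share from below.

    The power gain is halved twice on the way to the operator norm: when the square sums become sums
    of moduli, as Schur's test requires, and when T*T is replaced by T. *)

(* Dolgopyat's method, run on finite sets.  Replace X and Y by maximal
   h-separated nets x_i, y_j.  A T*T argument, Schur's test and averaging over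
   translates of the nets by vectors of length O(h) reduce the operator bound to
   a power gain, uniform in |c_i| <= h^delta, in
     sum_j h^delta' |sum_i c_i exp(i x_i . y_j / h)|^2.
   Group the points x_i into clusters of radius r = A h L^k and bound the partial
   sum over each cluster by a positive function M of j which is nearly constant
   at the dual scale h / r and also controls the variation of the partial sum.
   When r is multiplied by L, nonorthogonality provides in each new cluster two
   old ones whose relative phase changes by a definite amount between two nearby
   points of Y; hence near one of these two points the triangle inequality
   |g_1 + g_2| <= M_1 + M_2 is not sharp.  As this happens on a definite
   proportion of Y at every scale, the energy sum_j h^delta' M_j^2, normalised by
   the masses of the clusters, decreases by a fixed factor at each of the
   log(1/h) steps. *)

Set Implicit Arguments.
Unset Strict Implicit.
Unset Printing Implicit Defensive.

Import Order.TTheory GRing.Theory Num.Theory.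
Import numFieldNormedType.Exports.

Local Open Scope classical_set_scope.
Local Open Scope ring_scope.

(** * Euclidean and complex preliminaries *)

Notation normc := ComplexField.Normc.normc.

Section finite_sums.
Context (R : realType) (I : finType).
Implicit Types (P : pred I) (u v : I -> R).

Lemma cauchy_schwarz_sum P u v :
  (\sum_(i | P i) u i * v i) ^+ 2 <=
  (\sum_(i | P i) u i ^+ 2) * (\sum_(i | P i) v i ^+ 2).
Proof.
(* Discriminant of a nonnegative quadratic. As nothing is known about the sign of [p], the case p <
   0 is refuted at a large [t], and p = 0 forces s = 0. *)
have ge0 (p q s : R) : 0 <= q -> (forall t, 0 <= p * t ^+ 2 - 2 * s * t + q) ->
    s ^+ 2 <= p * q.
  move=> q0 h; have [p0|p0|p0] := ltgtP p 0.
  - have := h ((2 * `|s| + q + 1) / - p + 1).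
    have ap : 0 < - p by lra.
    set t := _ + 1; have t1 : 1 <= t.
      by rewrite lerDr divr_ge0 ?(ltW ap)//; have := normr_ge0 s; lra.
    have pt : - p * t = 2 * `|s| + q + 1 - p.
      by rewrite /t mulrDr mulr1 mulrC divfK ?gt_eqF.
    have sn : - `|s| <= s by rewrite lerNl -normrN ler_norm.
    have le1 : p * t - 2 * s <= - (q + 1) by move: pt sn; lra.
    clearbody t.
    have : t * (p * t - 2 * s) <= t * - (q + 1) by rewrite ler_pM2l; lra.
    have : 0 <= (t - 1) * (q + 1) by rewrite mulr_ge0//; lra.
    by lra.
  - have := h (s / p); have -> : p * (s / p) ^+ 2 - 2 * s * (s / p) + q
        = (p * q - s ^+ 2) / p by field; rewrite gt_eqF.
    by rewrite pmulr_lge0 ?invr_gt0// subr_ge0.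
  - have [->|s0] := eqVneq s 0; first by rewrite p0 mul0r expr0n.
    by have := h ((q + 1) / s); rewrite p0 mul0r add0r -mulrA [s * _]mulrC divfK//; lra.
apply: ge0; first by apply: sumr_ge0 => i _; exact: sqr_ge0.
move=> t; suff -> : (\sum_(i | P i) u i ^+ 2) * t ^+ 2
    - 2 * (\sum_(i | P i) u i * v i) * t + \sum_(i | P i) v i ^+ 2
    = \sum_(i | P i) (u i * t - v i) ^+ 2.
  by apply: sumr_ge0 => i _; exact: sqr_ge0.
rewrite mulr_suml -mulrA mulr_suml mulr_sumr -sumrB -big_split /=.
by apply: eq_bigr => i _; ring.
Qed.

(** The weights will be masses of clusters. The coefficients [a] leave room for a factor below 1 on
    a single term, which is how one improved child lowers the total. *)
Lemma weighted_cauchy_schwarz P (w a M : I -> R) :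
  (forall i, P i -> 0 < w i) ->
  (\sum_(i | P i) a i * M i) ^+ 2 <=
  (\sum_(i | P i) a i ^+ 2 * w i) * (\sum_(i | P i) M i ^+ 2 / w i).
Proof.
move=> w0.
have -> : \sum_(i | P i) a i * M i =
    \sum_(i | P i) (a i * Num.sqrt (w i)) * (M i / Num.sqrt (w i)).
  apply: eq_bigr => i Pi; rewrite mulrACA mulfV ?mulr1//.
  by rewrite sqrtr_eq0 -ltNge w0.
apply: (le_trans (cauchy_schwarz_sum _ _ _)).
by rewrite le_eqVlt; apply/orP; left; apply/eqP; congr (_ * _); apply: eq_bigr => i Pi;
  rewrite exprMn ?exprVn sqr_sqrtr// ltW// w0.
Qed.

Lemma sqr_sum_le_weighted P (w M : I -> R) : (forall i, P i -> 0 < w i) ->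
  (\sum_(i | P i) M i) ^+ 2 <=
  (\sum_(i | P i) w i) * (\sum_(i | P i) M i ^+ 2 / w i).
Proof.
move=> /(weighted_cauchy_schwarz (fun=> 1) M).
under eq_bigr do rewrite mul1r.
by under [X in _ <= X * _ -> _]eq_bigr do rewrite expr1n mul1r.
Qed.

End finite_sums.

Section euclidean_geometry.
Context (R : realType) (d : nat).
Implicit Types (x y z : 'rV[R]_d).

Lemma dotC x y : dot x y = dot y x.
Proof. by apply: eq_bigr => i _; rewrite mulrC. Qed.

Lemma dotDl x y z : dot (x + y) z = dot x z + dot y z.
Proof. by rewrite -big_split /=; apply: eq_bigr => i _; rewrite !mxE mulrDl. Qed.

Lemma dotNl x y : dot (- x) y = - dot x y.
Proof. by rewrite -sumrN; apply: eq_bigr => i _; rewrite !mxE mulNr. Qed.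

Lemma dotBl x y z : dot (x - y) z = dot x z - dot y z.
Proof. by rewrite dotDl dotNl. Qed.

Lemma dotDr x y z : dot x (y + z) = dot x y + dot x z.
Proof. by rewrite dotC dotDl !(dotC x). Qed.

Lemma dotNr x y : dot x (- y) = - dot x y.
Proof. by rewrite dotC dotNl dotC. Qed.

Lemma dotBr x y z : dot x (y - z) = dot x y - dot x z.
Proof. by rewrite dotDr dotNr. Qed.

Lemma dot_ge0 x : 0 <= dot x x.
Proof. by apply: sumr_ge0 => i _; rewrite -expr2 sqr_ge0. Qed.

Lemma enorm_ge0 x : 0 <= enorm x.
Proof. exact: sqrtr_ge0. Qed.

Lemma enorm_sqr x : enorm x ^+ 2 = dot x x.
Proof. by rewrite sqr_sqrtr// dot_ge0. Qed.

Lemma enormN x : enorm (- x) = enorm x.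
Proof. by rewrite /enorm dotNl dotNr opprK. Qed.

Lemma enorm0 : enorm (0 : 'rV[R]_d) = 0.
Proof. by rewrite /enorm /dot big1 ?sqrtr0// => i _; rewrite mxE mul0r. Qed.

Lemma enormB x y : enorm (x - y) = enorm (y - x).
Proof. by rewrite -enormN opprB. Qed.

Lemma dot_le x y : `|dot x y| <= enorm x * enorm y.
Proof.
rewrite -(@ler_pXn2r _ 2) ?nnegrE ?mulr_ge0 ?enorm_ge0//.
rewrite exprMn !enorm_sqr real_normK ?num_real//.
have dotE z : dot z z = \sum_i z ord0 i ^+ 2.
  by apply: eq_bigr => i _; rewrite expr2.
rewrite !dotE.
exact: (cauchy_schwarz_sum predT (fun i => x ord0 i) (fun i => y ord0 i)).
Qed.

Lemma ler_enormD x y : enorm (x + y) <= enorm x + enorm y.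
Proof.
rewrite -(@ler_pXn2r _ 2) ?nnegrE ?addr_ge0 ?enorm_ge0// sqrrD !enorm_sqr.
rewrite dotDl !dotDr (dotC y x).
by have := le_trans (ler_norm _) (dot_le x y); lra.
Qed.

Lemma enorm_triangle y x z : enorm (x - z) <= enorm (x - y) + enorm (y - z).
Proof. by have := ler_enormD (x - y) (y - z); rewrite addrA subrK. Qed.

Lemma coord_le_enorm x i : `|x ord0 i| <= enorm x.
Proof.
rewrite -sqrtr_sqr ler_wsqrtr// /dot (bigD1 i)//= -expr2 lerDl.
by apply: sumr_ge0 => j _; rewrite -expr2 sqr_ge0.
Qed.

End euclidean_geometry.

Section complex_modulus.
Context (R : realType).
Implicit Types (z w : R[i]) (t : R).

Lemma normc_ge0 z : 0 <= normc z.
Proof. by case: z => a b; exact: sqrtr_ge0. Qed.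

Lemma sqr_normcE z : normc z ^+ 2 = complex.Re z ^+ 2 + complex.Im z ^+ 2.
Proof. by case: z => a b; rewrite sqr_sqrtr// addr_ge0 ?sqr_ge0. Qed.

Lemma normc_real t : normc t%:C%C = `|t|.
Proof. by rewrite /normc /= expr0n addr0 sqrtr_sqr. Qed.

Lemma ler_normcD z w : normc (z + w) <= normc z + normc w.
Proof. exact: le_normcD. Qed.

Lemma normcBC z w : normc (z - w) = normc (w - z).
Proof. by rewrite -normcN opprB. Qed.

Lemma ler_normc_sum (I : finType) (P : pred I) (F : I -> R[i]) :
  normc (\sum_(i | P i) F i) <= \sum_(i | P i) normc (F i).
Proof.
elim/big_rec2 : _ => [|i x y _ h]; first by rewrite ComplexField.Normc.normc0.
by rewrite (le_trans (ler_normcD _ _))// lerD2l.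
Qed.

Lemma normc_parallelogram z w :
  normc (z + w) ^+ 2 + normc (z - w) ^+ 2 = 2 * normc z ^+ 2 + 2 * normc w ^+ 2.
Proof. by case: z w => [a b] [a' b']; rewrite !sqr_normcE /=; ring. Qed.

Lemma expi0 : expi (0 : R) = 1.
Proof. by rewrite /expi cos0 sin0. Qed.

Lemma expiD s t : expi (s + t) = expi s * expi t.
Proof. by rewrite /expi cosD sinD; apply/eqP; rewrite eq_complex /= eqxx addrC [cos s * _]mulrC mulrC eqxx. Qed.

Lemma normc_expi t : normc (expi t) = 1.
Proof. by rewrite /normc /= cos2Dsin2 sqrtr1. Qed.

Lemma normc_expiM t z : normc (expi t * z) = normc z.
Proof. by rewrite ComplexField.Normc.normcM normc_expi mul1r. Qed.

Lemma sqr_normc_expiB s t :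
  normc (expi s - expi t) ^+ 2 = (2 * sin ((s - t) / 2)) ^+ 2.
Proof.
have -> : (2 * sin ((s - t) / 2)) ^+ 2 = 2 - 2 * cos (s - t).
  rewrite [in RHS](splitr (s - t)) cosD -!expr2.
  by have := cos2Dsin2 ((s - t) / 2); lra.
rewrite sqr_normcE /= cosB; have := cos2Dsin2 s; have := cos2Dsin2 t; lra.
Qed.

Lemma sin_le_id t : 0 <= t -> sin t <= t.
Proof.
move=> t0; have [->|t00] := eqVneq t 0; first by rewrite sin0.
have tp : 0 < t by rewrite lt_neqAle eq_sym t00.
pose f x : R := x - sin x; pose df x : R := 1 - cos x.
have fdf x : x \in `]0, t[%R -> is_derive x 1 f (df x).
  by move=> _; apply: is_deriveB.
have cf : {within `[0, t], continuous f}.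
  apply: continuous_subspaceT => x.
  by apply: cvgB; [exact: cvg_id|exact: continuous_sin].
have [c _] := MVT tp fdf cf.
rewrite /f /df sin0 !subr0 => ft.
by rewrite -subr_ge0 ft mulr_ge0// subr_ge0 cos_le1.
Qed.

Lemma norm_sin_le t : `|sin t| <= `|t|.
Proof.
wlog t0 : t / 0 <= t => [h|].
  have [|/ltW t0] := leP 0 t; first exact: h.
  by rewrite -normrN -sinN -(normrN t) h// oppr_ge0.
rewrite (ger0_norm t0) ler_norml sin_le_id// andbT.
have [t1|t1] := leP t 1; last by have := sin_geN1 t; lra.
suff : 0 <= sin t by lra.
apply: sin_ge0_pi; rewrite t0 (le_trans t1)//.
by have := pi_ge2 R; lra.
Qed.

Lemma normc_expiB_le s t : normc (expi s - expi t) <= `|s - t|.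
Proof.
rewrite -(@ler_pXn2r _ 2) ?nnegrE ?normc_ge0// sqr_normc_expiB.
rewrite -[leLHS]real_normK ?num_real// ler_sqr ?nnegrE//.
rewrite normrM (ger0_norm (ler0n _ 2)).
by have := norm_sin_le ((s - t) / 2); rewrite normrM (@ger0_norm _ 2^-1)//; lra.
Qed.

End complex_modulus.

(** * Near-equality in the triangle inequality *)

Section phases.
Context (R : realType).
Implicit Types (z w f g : R[i]) (t M e : R).

Lemma cos_ge_half t : `|t| <= 1 -> 2^-1 <= cos t.
Proof.
move=> t1; rewrite (splitr t) cosD -!expr2.
have := cos2Dsin2 (t / 2); have : sin (t / 2) ^+ 2 <= 4^-1.
  rewrite -real_normK ?num_real//; have := norm_sin_le (t / 2).
  rewrite normrM (@ger0_norm _ 2^-1)// => h.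
  have : `|sin (t / 2)| <= 2^-1 by lra.
  by have := normr_ge0 (sin (t / 2)); nra.
lra.
Qed.

Lemma norm_sin_ge t : `|t| <= 1 -> `|t| / 2 <= `|sin t|.
Proof.
wlog t0 : t / 0 <= t => [h|].
  have [|/ltW t0] := leP 0 t; first exact: h.
  by rewrite -(normrN t) -(normrN (sin t)) -sinN; apply: h; rewrite oppr_ge0.
rewrite (ger0_norm t0) => t1; apply: le_trans (ler_norm _).
have [->|t00] := eqVneq t 0; first by rewrite sin0 mul0r.
have tp : 0 < t by rewrite lt_neqAle eq_sym t00.
have fdf x : x \in `]0, t[%R -> is_derive x 1 (@sin R) (cos x).
  by move=> _; exact: is_derive_sin.
have cf : {within `[0, t], continuous (@sin R)}.
  by apply: continuous_subspaceT => x; exact: continuous_sin.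
have [c c0t] := MVT tp fdf cf.
rewrite sin0 !subr0 => ->.
have : 2^-1 <= cos c.
  by apply: cos_ge_half; move: c0t; rewrite in_itv/= => /andP[c0 ct];
    rewrite gtr0_norm// (le_trans (ltW ct)).
by move=> hc; rewrite mulrC ler_wpM2r.
Qed.

Lemma normc_expiB_ge s t : `|s - t| <= 2 ->
  `|s - t| / 2 <= normc (expi s - expi t).
Proof.
move=> st; rewrite -(@ler_pXn2r _ 2) ?nnegrE ?normc_ge0//.
rewrite sqr_normc_expiB -[leRHS]real_normK ?num_real// ler_sqr ?nnegrE//.
rewrite normrM (ger0_norm (ler0n _ 2)).
have := @norm_sin_ge ((s - t) / 2); rewrite normrM (@ger0_norm _ 2^-1)//.
by move=> h; have := h ltac:(lra); lra.
Qed.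

(* Almost no cancellation in [z + w] forces [z] and [w], normalised, to be
   close: parallelogram identity. *)
Lemma aligned_of_large_sum e M N z w : 0 <= e -> e <= 1 ->
  normc z <= M -> normc w <= N ->
  M + N - e ^+ 2 * Num.min M N < normc (z + w) ->
  [/\ 0 < M, 0 < N, (1 - e ^+ 2) * M <= normc z, (1 - e ^+ 2) * N <= normc w &
    normc ((M^-1)%:C%C * z - (N^-1)%:C%C * w) <= 2 * e].
Proof.
wlog MN : M N z w / M <= N => [wlg|] e0 e1 zM wN h.
  have [MN|/ltW NM] := leP M N; first exact: wlg.
  have [] := wlg N M w z NM e0 e1 wN zM.
    by rewrite (addrC N) minC (addrC w).
  by move=> ? ? ? ?; rewrite normcBC.
move: h; rewrite (min_idPl MN) => h.
have zw := ler_normcD z w.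
have z0 := normc_ge0 z; have w0 := normc_ge0 w.
have e2 : 0 <= e ^+ 2 <= 1 by rewrite sqr_ge0 exprn_ile1.
have M0 : 0 < M.
  rewrite lt_neqAle (le_trans z0 zM) andbT eq_sym; apply/eqP => M0.
  by move: h; rewrite M0 mulr0; lra.
have N0 : 0 < N by exact: lt_le_trans MN.
have eMN : e ^+ 2 * M <= e ^+ 2 * N by rewrite ler_wpM2l//; case/andP: e2.
split => //; try by lra.
set p := (M^-1)%:C%C * z; set q := (N^-1)%:C%C * w.
have zE : z = M%:C%C * p.
  by rewrite mulrA -rmorphM /= mulfV ?gt_eqF// mul1r.
have wE : w = N%:C%C * q.
  by rewrite mulrA -rmorphM /= mulfV ?gt_eqF// mul1r.
have np : normc p <= 1.
  rewrite ComplexField.Normc.normcM normc_real gtr0_norm ?invr_gt0//.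
  by rewrite ler_pdivrMl// mulr1.
have nq : normc q <= 1.
  rewrite ComplexField.Normc.normcM normc_real gtr0_norm ?invr_gt0//.
  by rewrite ler_pdivrMl// mulr1.
clearbody p q.
(* Splitting off the excess N - M of the larger bound leaves two vectors of norm at most 1. The
   parallelogram identity then gives |p - q|^2 <= 4 - (2 - e^2)^2 <= 4 e^2. *)
have pq : 2 - e ^+ 2 <= normc (p + q).
  have : normc (z + w) <= M * normc (p + q) + (N - M).
    have -> : z + w = M%:C%C * (p + q) + (N - M)%:C%C * q.
      by rewrite zE wE rmorphB /=; ring.
    rewrite (le_trans (ler_normcD _ _))// !ComplexField.Normc.normcM !normc_real.
    have NM : 0 <= N - M by rewrite subr_ge0.
    rewrite (gtr0_norm M0) lerD2l (ger0_norm NM).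
    by rewrite ler_piMr.
  move=> h'; rewrite -(ler_pM2l M0); lra.
rewrite -(@ler_pXn2r _ 2) ?nnegrE ?normc_ge0//; last by lra.
have := normc_parallelogram p q.
have := normc_ge0 p; have := normc_ge0 q; have := normc_ge0 (p + q).
have : normc p ^+ 2 <= 1 by rewrite exprn_ile1// normc_ge0.
have : normc q ^+ 2 <= 1 by rewrite exprn_ile1// normc_ge0.
move: (normc (p + q)) pq => r pq; rewrite exprMn; nra.
Qed.

(** No relation between [M] and [M'] is assumed: as both bounds are nearly attained and f is close
    to f', both |f| / M and |f| / M' are close to 1. *)
Lemma normalized_close e M M' eta f f' : 0 < M -> 0 < M' ->
  normc f <= M -> normc f' <= M' ->
  (1 - e) * M <= normc f -> (1 - e) * M' <= normc f' ->
  normc (f - f') <= eta * M' ->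
  normc ((M^-1)%:C%C * f - (M'^-1)%:C%C * f') <= e + 2 * eta.
Proof.
move=> M0 M'0 fM fM' eM eM' ff'.
have -> : (M^-1)%:C%C * f - (M'^-1)%:C%C * f' =
    (M^-1 - M'^-1)%:C%C * f + (M'^-1)%:C%C * (f - f').
  by rewrite rmorphB /=; ring.
rewrite (le_trans (ler_normcD _ _))// !ComplexField.Normc.normcM !normc_real.
have f1 := ler_normcD (f - f') f'; rewrite subrK in f1.
have f2 := ler_normcD (f' - f) f; rewrite subrK normcBC in f2.
have eta1 : `|M'^-1| * normc (f - f') <= eta.
  by rewrite gtr0_norm ?invr_gt0// ler_pdivrMl// mulrC.
suff : `|M^-1 - M'^-1| * normc f <= e + eta by lra.
rewrite -[X in _ * X]ger0_norm ?normc_ge0// -normrM mulrBl.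
rewrite ler_norml.
have h1 : 1 - e <= M^-1 * normc f by rewrite ler_pdivlMl// mulrC.
have h2 : M^-1 * normc f <= 1 by rewrite ler_pdivrMl// mulr1.
have h3 : 1 - e - eta <= M'^-1 * normc f by rewrite ler_pdivlMl//; lra.
have h4 : M'^-1 * normc f <= 1 + eta by rewrite ler_pdivrMl//; lra.
by apply/andP; split; lra.
Qed.

(** Primes denote a second place. Alignment at both places makes exp(i t1) p1 close to exp(i t2) p2
    and likewise with primes, while each normalised p changes little in between; so t1 - t2 and t1'
    - t2' nearly agree modulo 2 pi. The error is 2e for each alignment and e^2 + 2 eta for each
    change of place; the factor 1 - e^2 is the lower bound on |p1'|. *)
Lemma no_double_alignment e eta (t1 t2 t1' t2' M1 M2 M1' M2' : R)
    (f1 f2 f1' f2' : R[i]) : 0 <= e -> e <= 1 ->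
  normc f1 <= M1 -> normc f2 <= M2 -> normc f1' <= M1' -> normc f2' <= M2' ->
  normc (f1 - f1') <= eta * M1' -> normc (f2 - f2') <= eta * M2' ->
  M1 + M2 - e ^+ 2 * Num.min M1 M2 < normc (expi t1 * f1 + expi t2 * f2) ->
  M1' + M2' - e ^+ 2 * Num.min M1' M2' <
    normc (expi t1' * f1' + expi t2' * f2') ->
  (1 - e ^+ 2) * normc (expi t1 - expi (t2 - t2' + t1')) <=
    4 * e + 2 * e ^+ 2 + 4 * eta.
Proof.
move=> e0 e1 fM1 fM2 fM1' fM2' ff1 ff2 h h'.
have [||M10 M20] := aligned_of_large_sum e0 e1 _ _ h; rewrite ?normc_expiM//.
move=> L1 L2 D.
have [||M10' M20'] := aligned_of_large_sum e0 e1 _ _ h'; rewrite ?normc_expiM//.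
move=> L1' L2' D'.
have C1 := normalized_close M10 M10' fM1 fM1' L1 L1' ff1.
have C2 := normalized_close M20 M20' fM2 fM2' L2 L2' ff2.
move: C1 C2 D D'.
have l1' : 1 - e ^+ 2 <= normc ((M1'^-1)%:C%C * f1').
  rewrite ComplexField.Normc.normcM normc_real gtr0_norm ?invr_gt0//.
  by rewrite ler_pdivlMl// mulrC.
move: l1'; rewrite [_ * (expi t1 * _)]mulrCA [_ * (expi t2 * _)]mulrCA.
rewrite [_ * (expi t1' * _)]mulrCA [_ * (expi t2' * _)]mulrCA.
set p1 := _ * f1; set p2 := _ * f2; set p1' := _ * f1'; set p2' := _ * f2'.
move=> l1' C1 C2 D D'.
rewrite mulrC; apply: (@le_trans _ _ (normc (expi t1 - expi (t2 - t2' + t1')) * normc p1')).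
  by rewrite ler_wpM2l ?normc_ge0.
rewrite -ComplexField.Normc.normcM.
have -> : (expi t1 - expi (t2 - t2' + t1')) * p1' =
    - (expi t1 * (p1 - p1')) + ((expi t1 * p1 - expi t2 * p2)
    + (expi t2 * (p2 - p2') + - (expi (t2 - t2') * (expi t1' * p1' - expi t2' * p2')))).
  have E2 : expi t2 = expi (t2 - t2') * expi t2' by rewrite -expiD subrK.
  by rewrite expiD E2; ring.
apply: le_trans (ler_normcD _ _) _; rewrite normcN normc_expiM.
apply: le_trans (lerD (lexx _) (ler_normcD _ _)) _.
apply: le_trans (lerD (lexx _) (lerD (lexx _) (ler_normcD _ _))) _.
rewrite normcN !normc_expiM; lra.
Qed.

End phases.

(** * Clusters and averaging *)

Section separated.
Context (R : realType) (I : finType) (D : I -> I -> R).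
Hypotheses (D0 : forall i, D i i = 0) (DC : forall i j, D i j = D j i).
Hypothesis DT : forall i j k, D i k <= D i j + D j k.

Lemma maximal_separated (B : {set I}) (r : R) : 0 < r ->
  exists2 A : {set I}, A \subset B &
    {in A &, forall a b, a != b -> r <= D a b} /\
    {in B, forall b, exists2 a, a \in A & D b a < r}.
Proof.
move=> r0.
pose P (A : {set I}) := (A \subset B) &&
  [forall a in A, forall b in A, (a != b) ==> (r <= D a b)].
have P0 : P finset.set0.
  by rewrite /P finset.sub0set; apply/forallP => a; rewrite inE.
have [A /maxsetP[/andP[AB /forall_inP sep] maxA] _] := maxset_exists P0.
exists A => //; split=> [a b aA bA ab|b bB].
  by have /forall_inP/(_ b bA)/implyP := sep a aA; apply.
apply: contrapT => nb.
have far a : a \in A -> r <= D b a.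
  by move=> aA; rewrite leNgt; apply/negP => h; apply: nb; exists a.
have bA : b \notin A.
  by apply/negP => bA; have := far b bA; rewrite D0 leNgt r0.
suff E : b |: A = A by move: bA; rewrite -E !inE eqxx.
apply: maxA; last exact: finset.subsetUr.
rewrite /P finset.subUset finset.sub1set bB AB /=.
apply/forall_inP => a /finset.setU1P[->|aA]; apply/forall_inP => a' /finset.setU1P[->|a'A];
  apply/implyP => aa'.
- by rewrite eqxx in aa'.
- exact: far.
- by rewrite DC; exact: far.
- by have /forall_inP/(_ a' a'A)/implyP := sep a aA; apply.
Qed.

(** Balls of radius r / 2 about r-separated centres are disjoint, so a point in one of them can be
    sent to its centre without conflict. Each cell thus contains a whole ball, which later bounds
    its mass from below. *)
Lemma grouping (B : {set I}) (r : R) : 0 < r ->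
  exists (A : {set I}) (q : I -> I), A \subset B /\
    {in B, forall b, [/\ q b \in A, D b (q b) < r &
      forall a, a \in A -> D b a < r / 2 -> q b = a]}.
Proof.
move=> r0; have [A AB [sep cov]] := maximal_separated B r0.
have /choice[q qP] : forall b, exists a, b \in B ->
    [/\ a \in A, D b a < r & forall a', a' \in A -> D b a' < r / 2 -> a = a'].
  move=> b; have [bB|bB] := boolP (b \in B); last by exists b.
  have [a aA ba] := cov _ bB.
  have [[a' [a'A ba']]|na'] := pselect (exists a', a' \in A /\ D b a' < r / 2).
    exists a' => _; split => // [|a'' a''A ba''].
      by rewrite (lt_trans ba')//; move: r0; lra.
    apply/eqP; apply/negPn/negP => ne.
    have := sep _ _ a'A a''A ne; rewrite leNgt => /negP; apply.
    by rewrite (le_lt_trans (DT a' b a''))// (splitr r) ltrD// DC.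
  exists a => _; split=> // a' a'A ba'; exfalso.
  by apply: na'; exists a'.
by exists A, q; split=> // b /qP.
Qed.

End separated.

Section averaging.
Context (R : realType) (J : finType) (D : J -> J -> R).
Hypothesis DC : forall i j, D i j = D j i.

(* Double counting of the pairs (any point, improved point near it). *)
Lemma gain_average (n V W : J -> R) (e s rho n0 n1 : R) :
  0 <= e -> 0 < n0 -> 0 < n1 -> s <= rho ->
  (forall i j k, D i k <= D i j + D j k) ->
  (forall j, 0 <= n j) -> (forall j, 0 <= W j) -> (forall j, V j <= W j) ->
  (forall j j', D j j' <= 2 * rho -> W j <= 2 * W j') ->
  (forall j, exists2 a, D a j <= rho &
     forall j', D j' a <= s -> V j' <= (1 - e) * W j') ->
  (forall j, n0 <= \sum_(j' | D j' j <= s) n j') ->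
  (forall j, \sum_(j' | D j' j <= 2 * rho) n j' <= n1) ->
  \sum_j n j * V j <= (1 - e * (n0 / (2 * n1))) * \sum_j n j * W j.
Proof.
move=> e0 n00 n10 srho DT nn W0 VW Wlip gain lown upn.
pose G j := V j <= (1 - e) * W j.
have VG : \sum_j n j * V j <= \sum_j n j * W j - e * \sum_(j | G j) n j * W j.
  rewrite [X in _ <= _ - e * X]big_mkcond mulr_sumr -sumrB /=.
  apply: ler_sum => j _; rewrite /G; case: ifPn => Gj.
    rewrite mulrCA -mulrBr ler_wpM2l//; move: Gj; lra.
  by rewrite mulr0 subr0 ler_wpM2l.
(* Each [j] has improved points of total mass at least [n0] within 2 rho, while an improved point is
   counted from a mass at most [n1], on which [W] is at most twice its value there; hence the ratio
   n0 / (2 n1). *)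
suff : n0 * \sum_j n j * W j <= 2 * n1 * \sum_(j | G j) n j * W j.
  rewrite -ler_pdivrMl ?mulr_gt0// => h.
  apply: (le_trans VG); rewrite mulrBl mul1r lerD2l lerNl opprK -mulrA ler_wpM2l//.
  by apply: le_trans h; rewrite [n0 / _]mulrC mulrA.
pose pr j j' := (D j' j <= 2 * rho) && G j'.
apply: (@le_trans _ _ (\sum_j \sum_(j' | pr j j') n j * W j * n j')).
  rewrite mulr_sumr; apply: ler_sum => j _.
  rewrite -mulr_sumr mulrC ler_wpM2l ?mulr_ge0//.
  have [a aj ga] := gain j.
  apply: (le_trans (lown a)); rewrite big_mkcond [leRHS]big_mkcond /=.
  apply: ler_sum => j' _; case: ifPn => [j'a|_]; last by case: ifP.
  rewrite ifT// /pr /G ga// andbT.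
  by apply: (le_trans (DT _ a _)); move: aj j'a; lra.
rewrite (exchange_big_dep G) /=; last by move=> i j _ /andP[].
rewrite mulr_sumr; apply: ler_sum => j' Gj'.
apply: (@le_trans _ _ (\sum_(j | D j j' <= 2 * rho) n j * (2 * W j' * n j'))).
  rewrite (eq_bigl (fun j => D j j' <= 2 * rho)); last first.
    by move=> j; rewrite /pr Gj' andbT DC.
  by apply: ler_sum => j jj'; rewrite -mulrA ler_wpM2l// ler_wpM2r// Wlip.
rewrite -mulr_suml; have := upn j' => h.
have -> : 2 * n1 * (n j' * W j') = n1 * (2 * W j' * n j') by ring.
by rewrite ler_wpM2r// !mulr_ge0.
Qed.

End averaging.

(** * Waves of clusters and their majorants *)

Section real_lemmas.
Context (R : realType).

Lemma expR_half_le2 (t : R) : t <= 2^-1 -> expR t <= 2.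
Proof.
move=> t1; apply: (@le_trans _ _ (expR 2^-1)); first by rewrite ler_expR.
have := expR_ge1Dx (- 2^-1 : R); rewrite expRN => h.
have e0 : 0 < expR 2^-1 :> R by exact: expR_gt0.
have : 2^-1 * expR 2^-1 <= (expR 2^-1)^-1 * expR 2^-1 :> R.
  by rewrite ler_pM2r//; lra.
by rewrite mulVf ?gt_eqF//; lra.
Qed.

Lemma expRN_half (t : R) : 2^-1 <= t -> expR (- t) <= 3 / 4.
Proof.
move=> t1; apply: (@le_trans _ _ (expR (- 2^-1))).
  by rewrite ler_expR; lra.
have := expR_ge1Dx (2^-1 : R); rewrite expRN => h.
have e0 : 0 < expR 2^-1 :> R by exact: expR_gt0.
by rewrite -[leLHS]mul1r ler_pdivrMr//; lra.
Qed.

(** For 0 <= e <= 1 the expression M + N - e min(M, N) equals max + (1 - e) min, so it is monotone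
    in both arguments, and it is homogeneous. *)
Lemma ler_sub_min (e E M N M' N' : R) : 0 <= e -> e <= 1 -> 0 <= E ->
  M' <= E * M -> N' <= E * N ->
  M' + N' - e * Num.min M' N' <= E * (M + N - e * Num.min M N).
Proof.
move=> e0 e1 E0 hM hN.
have h1 : (1 - e) * M' <= (1 - e) * (E * M) by rewrite ler_wpM2l//; lra.
have h2 : (1 - e) * N' <= (1 - e) * (E * N) by rewrite ler_wpM2l//; lra.
have l1 : e * E * Num.min M N <= e * E * M by rewrite ler_wpM2l ?ge_min ?lexx ?mulr_ge0.
have l2 : e * E * Num.min M N <= e * E * N by rewrite ler_wpM2l ?ge_min ?lexx ?orbT ?mulr_ge0.
by rewrite {1}/Num.min; case: ifPn => _; lra.
Qed.

End real_lemmas.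

Section pairwise_distance.
Context (R : realType) (d : nat) (I : finType) (x : I -> 'rV[R]_d).

Definition pdist i j : R := enorm (x i - x j).

Lemma pdistC i j : pdist i j = pdist j i. Proof. exact: enormB. Qed.

Lemma pdist_ge0 i j : 0 <= pdist i j. Proof. exact: enorm_ge0. Qed.

Lemma pdist_triangle i j k : pdist i k <= pdist i j + pdist j k.
Proof. exact: enorm_triangle. Qed.

Lemma pdistii i : pdist i i = 0. Proof. by rewrite /pdist subrr enorm0. Qed.

End pairwise_distance.

Section scales.
Context (R : realType) (d : nat) (I J : finType).
Variables (x : I -> 'rV[R]_d) (y : J -> 'rV[R]_d) (c : I -> R[i]) (m : I -> R).
Variable h : R.
Hypothesis h0 : 0 < h.

Implicit Types (p : I -> I) (M : J -> R) (A : {set I}).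

Local Notation dX := (pdist x).
Local Notation dY := (pdist y).

Definition wave i j : R[i] := c i * expi (dot (x i) (y j) / h).

Definition group_wave p a j : R[i] := \sum_(i | p i == a) wave i j.

Definition group_mass p a : R := \sum_(i | p i == a) m i.

(* The wave of a group, with the oscillation of its centre removed. *)
Definition envelope p a j : R[i] :=
  expi (- (dot (x a) (y j) / h)) * group_wave p a j.

(* Groups of radius about [r] are paired with the dual scale [kappa h / r] on
   the [y] side: [M] varies slowly (in logarithm) at that scale, and dominates
   both the waves and the variation of their envelopes. *)
Definition majorizes (kappa r : R) p a (M : J -> R) : Prop :=
  [/\ forall j, 0 <= M j,
      forall j j', M j <= expR (r / (kappa * h) * dY j j') * M j',
      forall j, normc (group_wave p a j) <= M j &
      forall j j', normc (envelope p a j - envelope p a j') <=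
        4 * (r / h) * dY j j' * expR (r / (kappa * h) * dY j j') * M j'].

Lemma group_waveE p a j :
  group_wave p a j = expi (dot (x a) (y j) / h) * envelope p a j.
Proof. by rewrite mulrA -expiD subrr expi0 mul1r. Qed.

Lemma normc_envelope p a j : normc (envelope p a j) = normc (group_wave p a j).
Proof. exact: normc_expiM. Qed.

(* A large sum near both [y j1] and [y j2] would force the relative phase of
   the two groups to be nearly the same at both places, whereas it changes by
   an amount between [cN / 32] and [2]. *)
Lemma gain_alternative (cN r kappa e L : R) p b1 b2 M1 M2 j1 j2 :
  0 < cN -> cN <= 1 -> 0 < r ->
  kappa = cN / 64 -> e = kappa / 32 -> L = 24 / e ->
  majorizes kappa (r / L) p b1 M1 -> majorizes kappa (r / L) p b2 M2 ->
  dX b1 b2 <= r / 2 -> dY j1 j2 <= 2 * (h / r) ->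
  cN / 16 * h <= `|dot (x b1 - x b2) (y j1 - y j2)| ->
  exists2 a, a \in [:: j1; j2] & forall j, dY j a <= 2 * kappa * (h / r) ->
    normc (group_wave p b1 j + group_wave p b2 j) <=
      M1 j + M2 j - e ^+ 2 * Num.min (M1 j) (M2 j).
Proof.
move=> cN0 cN1 r0 kappaE eE LE [M10 M1l gM1 fM1] [M20 M2l gM2 fM2] b12 j12 hD.
apply: contrapT => nex.
have hp := h0.
have ex a : a \in [:: j1; j2] -> exists z, dY z a <= 2 * kappa * (h / r) /\
    M1 z + M2 z - e ^+ 2 * Num.min (M1 z) (M2 z) <
      normc (group_wave p b1 z + group_wave p b2 z).
  move=> aj; apply: contrapT => nz; apply: nex; exists a => // j ja.
  by rewrite leNgt; apply/negP => ?; apply: nz; exists j.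
have [z1 [zj1 h1]] := ex j1 (mem_head _ _).
have [|z2 [zj2 h2]] := ex j2; first by rewrite !inE eqxx orbT.
rewrite !group_waveE in h1 h2.
have k0 : 0 < kappa by rewrite kappaE; lra.
have k1 : kappa <= 64^-1 by rewrite kappaE; lra.
have ep : 0 < e by rewrite eE kappaE; lra.
have L0 : 0 < L by rewrite LE divr_gt0.
have rh0 : 0 < h / r by rewrite divr_gt0.
have Z : dY z1 z2 <= (2 + 4 * kappa) * (h / r).
  have := pdist_triangle y z1 j1 z2; have := pdist_triangle y j1 j2 z2; rewrite (pdistC y j2 z2); lra.
have rZ : r / L / h * dY z1 z2 <= 3 / L.
  have -> : r / L / h * dY z1 z2 = (dY z1 z2 * (r / h)) / L.
    by field; rewrite !gt_eqF.
  rewrite ler_pM2r ?invr_gt0//.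
  have : dY z1 z2 * (r / h) <= (2 + 4 * kappa) * (h / r) * (r / h).
    by rewrite ler_pM2r ?divr_gt0.
  have -> : (2 + 4 * kappa) * (h / r) * (r / h) = 2 + 4 * kappa.
    by field; rewrite !gt_eqF.
  lra.
have rkZ : r / L / (kappa * h) * dY z1 z2 <= 2^-1.
  have -> : r / L / (kappa * h) * dY z1 z2 = r / L / h * dY z1 z2 / kappa.
    by field; rewrite !gt_eqF.
  rewrite ler_pdivrMr//; apply: (le_trans rZ).
  by rewrite LE invf_div mulrCA eE kappaE; lra.
(* Origin of [L = 24 / e]: the distance is at most 3 h / r and the exponential at most 2, so an
   envelope varies by at most 4 (3 / L) 2 = e times its majorant. *)
have eta (M : J -> R) (f : I -> J -> R[i]) b : (forall j, 0 <= M j) ->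
   normc (f b z1 - f b z2) <= 4 * (r / L / h) * dY z1 z2 *
     expR (r / L / (kappa * h) * dY z1 z2) * M z2 ->
   normc (f b z1 - f b z2) <= e * M z2.
  move=> M0 /le_trans; apply; rewrite ler_wpM2r//.
  apply: (@le_trans _ _ (4 * (3 / L) * 2)); last first.
    by rewrite LE invf_div; lra.
  have rLh : 0 <= r / L / h by rewrite ltW// !divr_gt0.
  have lhs0 : 0 <= 4 * (r / L / h) * dY z1 z2.
    by apply: mulr_ge0; [exact: mulr_ge0|exact: pdist_ge0].
  apply: (ler_pM lhs0 (expR_ge0 _)); last exact: expR_half_le2.
  by rewrite -mulrA ler_pM2l.
have e0 : 0 <= e by exact: ltW.
have e1 : e <= 1 by rewrite eE kappaE; lra.
have := no_double_alignment e0 e1 _ _ _ _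
  (eta _ (envelope p) b1 M10 (fM1 z1 z2)) (eta _ (envelope p) b2 M20 (fM2 z1 z2)) h1 h2.
rewrite !normc_envelope => /(_ (gM1 _) (gM2 _) (gM1 _) (gM2 _)).
set t1 := dot (x b1) (y z1) / h.
set s := dot (x b2) (y z1) / h - _ + _ => main.
have st : t1 - s = dot (x b1 - x b2) (y z1 - y z2) / h.
  by rewrite /s /t1 dotBl !dotBr; field; rewrite gt_eqF.
(* Origin of [kappa = cN / 64]: moving from j1, j2 to z1, z2 changes the relative phase by at most 2
   kappa = cN / 32, half of the available cN / 16. *)
have near1 : `|dot (x b1 - x b2) (y z1 - y z2) - dot (x b1 - x b2) (y j1 - y j2)|
    <= 2 * kappa * h.
  rewrite -dotBr.
  have -> : y z1 - y z2 - (y j1 - y j2) = (y z1 - y j1) - (y z2 - y j2).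
    by rewrite !opprB addrACA [RHS]addrACA (addrC (- y z2)).
  apply: (le_trans (dot_le _ _)).
  apply: (@le_trans _ _ (r / 2 * (4 * kappa * (h / r)))).
    rewrite ler_pM ?enorm_ge0//.
    have := ler_enormD (y z1 - y j1) (- (y z2 - y j2)); rewrite enormN.
    by move: zj1 zj2; rewrite /pdist; lra.
  have -> : r / 2 * (4 * kappa * (h / r)) = 2 * kappa * h.
    by field; rewrite gt_eqF.
  by [].
have hup : `|dot (x b1 - x b2) (y j1 - y j2)| <= h.
  apply: (le_trans (dot_le _ _)).
  apply: (@le_trans _ _ (r / 2 * (2 * (h / r)))); first by rewrite ler_pM ?enorm_ge0.
  by have -> : r / 2 * (2 * (h / r)) = h by field; rewrite gt_eqF.
have kh : kappa * h <= 64^-1 * h by rewrite ler_pM2r.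
have n1 := ler_normD (dot (x b1 - x b2) (y z1 - y z2) -
  dot (x b1 - x b2) (y j1 - y j2)) (dot (x b1 - x b2) (y j1 - y j2)).
rewrite subrK in n1.
have n2 := ler_normB (dot (x b1 - x b2) (y z1 - y z2)) (dot (x b1 - x b2) (y z1 - y z2) -
  dot (x b1 - x b2) (y j1 - y j2)).
rewrite opprB addrC subrK in n2.
have s2 : `|t1 - s| <= 2.
  rewrite st normrM normfV (gtr0_norm h0) ler_pdivrMr//; lra.
have s3 : cN / 32 <= `|t1 - s|.
  rewrite st normrM normfV (gtr0_norm h0) ler_pdivlMr//.
  by move: hD near1 n2; rewrite kappaE; lra.
(* Origin of [e = kappa / 32]: the chord is at least cN / 64 = 32 e, whereas [main] bounds 1 - e^2
   times the chord by 8 e + 2 e^2. *)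
have := normc_expiB_ge s2.
have : (1 - e ^+ 2) * (cN / 64) <= (1 - e ^+ 2) * normc (expi t1 - expi s).
  rewrite ler_wpM2l ?subr_ge0 ?exprn_ile1//.
  by have := normc_expiB_ge s2; lra.
have e32 : e <= 32^-1 by rewrite eE kappaE; lra.
have e22 : e ^+ 2 <= e / 32 by rewrite expr2 ler_wpM2l.
have e3 : e ^+ 2 * (cN / 64) <= e ^+ 2 by rewrite ler_piMr ?sqr_ge0//; lra.
have e64 : cN / 64 = 32 * e by rewrite eE kappaE; lra.
move: main; lra.
Qed.

End scales.

(** * Merging clusters and their majorants *)

Section merging.
Context (R : realType) (d : nat) (I J : finType).
Variables (x : I -> 'rV[R]_d) (y : J -> 'rV[R]_d) (c : I -> R[i]) (m : I -> R).
Variable h : R.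
Hypothesis h0 : 0 < h.
Variables (A : {set I}) (p q : I -> I).
Hypothesis pA : forall i, p i \in A.

Local Notation group_wave := (group_wave x y c h).
Local Notation envelope := (envelope x y c h).
Local Notation majorizes := (majorizes x y c h).
Local Notation dX := (pdist x).
Local Notation dY := (pdist y).

Lemma group_wave_comp a j : group_wave (q \o p) a j =
  \sum_(b | (b \in A) && (q b == a)) group_wave p b j.
Proof.
rewrite /group_wave (partition_big p (fun b => (b \in A) && (q b == a))) /=.
  apply: eq_bigr => b /andP[_ /eqP qb]; apply: eq_bigl => i /=.
  by case: (p i =P b) => [->|]; rewrite ?andbF// qb eqxx.
by move=> i ->; rewrite pA.
Qed.

Lemma group_mass_comp a : group_mass m (q \o p) a =
  \sum_(b | (b \in A) && (q b == a)) group_mass m p b.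
Proof.
rewrite /group_mass (partition_big p (fun b => (b \in A) && (q b == a))) /=.
  apply: eq_bigr => b /andP[_ /eqP qb]; apply: eq_bigl => i /=.
  by case: (p i =P b) => [->|]; rewrite ?andbF// qb eqxx.
by move=> i ->; rewrite pA.
Qed.

Variables (M : I -> J -> R) (kappa r L : R) (a : I).
Hypotheses (kappa0 : 0 < kappa) (r0 : 0 < r) (L4 : 4 <= L).
Hypothesis majM : forall b, b \in A -> q b == a -> majorizes kappa (r / L) p b (M b).
Hypothesis near_a : forall b, b \in A -> q b == a -> dX b a <= r.

Let child b := (b \in A) && (q b == a).
Let k := r / (kappa * h).
Let U j := \sum_(b | child b) M b j.

Let k0 : 0 < k. Proof. by rewrite divr_gt0 ?mulr_gt0. Qed.

Let kLE : r / L / (kappa * h) = k / L.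
Proof. by rewrite /k mulrAC. Qed.

Let kL : k / L <= k / 2.
Proof.
rewrite ler_pM2l// lef_pV2 ?posrE//; last by move: L4; lra.
by move: L4; lra.
Qed.

Let U_ge0 j : 0 <= U j.
Proof. by apply: sumr_ge0 => b /andP[bA qb]; case: (majM bA qb). Qed.

Let U_slow j j' : U j <= expR (k / L * dY j j') * U j'.
Proof.
rewrite mulr_sumr; apply: ler_sum => b /andP[bA qb].
by case: (majM bA qb) => _ /(_ j j'); rewrite kLE.
Qed.

Let wave_le_U j : normc (group_wave (q \o p) a j) <= U j.
Proof.
rewrite group_wave_comp; apply: (le_trans (ler_normc_sum _ _)).
by apply: ler_sum => b /andP[bA qb]; case: (majM bA qb).
Qed.

(** The iterated maximum is the least majorant of the new wave with logarithmic Lipschitz constant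
    [k]. The floor U / 2 is there for the envelope condition: variations are estimated through [U],
    and the floor converts [U] into the majorant at the cost of a factor 2. *)
Definition merged_majorant j : R :=
  Num.max (U j / 2) (\big[Num.max/0]_j'
     (normc (group_wave (q \o p) a j') * expR (- (k * dY j j')))).

Lemma merged_majorant_le j B : U j / 2 <= B ->
  (forall j', normc (group_wave (q \o p) a j') * expR (- (k * dY j j')) <= B) ->
  merged_majorant j <= B.
Proof.
move=> UB gB; rewrite ge_max UB /=; apply: bigmax_le => [|j' _]; last exact: gB.
by apply: le_trans UB; rewrite divr_ge0.
Qed.

Lemma half_le_merged j : U j / 2 <= merged_majorant j.
Proof. by rewrite le_max lexx. Qed.

Let wave_le_merged j j' :
  normc (group_wave (q \o p) a j') * expR (- (k * dY j j')) <= merged_majorant j.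
Proof. by rewrite le_max; apply/orP; right; exact: le_bigmax. Qed.

Lemma merged_le j : merged_majorant j <= U j.
Proof.
apply: merged_majorant_le => [|j'].
  by have := U_ge0 j; lra.
apply: (le_trans (ler_wpM2r (expR_ge0 _) (wave_le_U j'))).
rewrite expRN ler_pdivrMr ?expR_gt0// mulrC.
apply: (le_trans (U_slow j' j)); rewrite ler_wpM2r// ler_expR pdistC.
by rewrite ler_wpM2r ?pdist_ge0//; move: kL k0; lra.
Qed.

Lemma merged_majorizes : majorizes kappa r (q \o p) a merged_majorant.
Proof.
split.
- by move=> j; apply: le_trans (half_le_merged j); rewrite divr_ge0.
- move=> j j'; rewrite -/k; apply: merged_majorant_le => [|l].
    apply: (@le_trans _ _ (expR (k * dY j j') * (U j' / 2))); last first.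
      by rewrite ler_wpM2l ?expR_ge0// half_le_merged.
    rewrite mulrA ler_pM2r//; apply: (le_trans (U_slow j j')).
    rewrite ler_wpM2r// ler_expR ler_wpM2r ?pdist_ge0//.
    by move: kL k0; lra.
  apply: (@le_trans _ _ (expR (k * dY j j') *
     (normc (group_wave (q \o p) a l) * expR (- (k * dY j' l))))); last first.
    by rewrite ler_wpM2l ?expR_ge0.
  rewrite mulrCA ler_wpM2l ?normc_ge0// -expRD ler_expR.
  have : k * dY j' l <= k * (dY j' j + dY j l) by rewrite ler_pM2l// pdist_triangle.
  by rewrite (pdistC y j' j); lra.
- move=> j; have := wave_le_merged j j.
  by rewrite pdistii mulr0 oppr0 expR0 mulr1.
- move=> j j'; rewrite -/k.
  (* The constant 4 of [majorizes] reproduces itself: rotation about the new centre costs r / h, the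
     envelopes of the children cost 4 r / (L h) <= r / h as L >= 4, and U is at most twice the
     merged majorant. *)
  apply: (@le_trans _ _ (2 * (r / h) * dY j j' * expR (k * dY j j') * U j')); last first.
    have -> : 2 * (r / h) * dY j j' * expR (k * dY j j') * U j' =
      4 * (r / h) * dY j j' * expR (k * dY j j') * (U j' / 2) by lra.
    rewrite ler_wpM2l ?half_le_merged// mulr_ge0 ?expR_ge0//.
    by rewrite mulr_ge0 ?pdist_ge0// mulr_ge0// divr_ge0 ?(ltW r0) ?(ltW h0).
  pose w b j := dot (x b - x a) (y j) / h.
  have envE l : envelope (q \o p) a l =
      \sum_(b | child b) expi (w b l) * envelope p b l.
    rewrite /envelope group_wave_comp mulr_sumr; apply: eq_bigr => b _.
    rewrite mulrA -expiD; congr (expi _ * _).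
    by rewrite /w dotBl; ring.
  rewrite !envE -sumrB; apply: (le_trans (ler_normc_sum _ _)).
  rewrite mulr_sumr; apply: ler_sum => b /andP[bA qb].
  have [M0 Ml gM fM] := majM bA qb.
  have -> : expi (w b j) * envelope p b j - expi (w b j') * envelope p b j' =
      expi (w b j) * (envelope p b j - envelope p b j') +
      (expi (w b j) - expi (w b j')) * envelope p b j' by ring.
  apply: (le_trans (ler_normcD _ _)); rewrite normc_expiM.
  rewrite ComplexField.Normc.normcM normc_envelope.
  have h1 : normc (expi (w b j) - expi (w b j')) <= r / h * dY j j'.
    apply: (le_trans (normc_expiB_le _ _)).
    rewrite /w -mulrBl -dotBr normrM (gtr0_norm (_ : 0 < h^-1)) ?invr_gt0//.
    rewrite mulrAC ler_pM2r ?invr_gt0//; apply: (le_trans (dot_le _ _)).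
    by rewrite ler_wpM2r ?enorm_ge0// near_a.
  have E1 : 1 <= expR (k * dY j j').
    rewrite -expR0 ler_expR mulr_ge0 ?pdist_ge0//; exact: ltW.
  have rhd : 0 <= r / h * dY j j' by rewrite mulr_ge0 ?pdist_ge0// divr_ge0 ?ltW.
  have h2 : normc (expi (w b j) - expi (w b j')) * normc (group_wave p b j') <=
      r / h * dY j j' * expR (k * dY j j') * M b j'.
    rewrite ler_pM ?normc_ge0// (le_trans h1)//.
    by rewrite ler_peMr.
  have h3 : normc (envelope p b j - envelope p b j') <=
      r / h * dY j j' * expR (k * dY j j') * M b j'.
    have rL0 : 0 <= 4 * (r / L / h).
      by rewrite mulr_ge0// !divr_ge0 ?ltW//; move: L4; lra.
    apply: (le_trans (fM j j')); rewrite ler_wpM2r// kLE.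
    apply: (ler_pM (mulr_ge0 rL0 (pdist_ge0 _ _ _)) (expR_ge0 _)).
      rewrite ler_wpM2r ?pdist_ge0//.
      have -> : 4 * (r / L / h) = (r / h) * (4 / L) by ring.
      rewrite ler_piMr ?divr_ge0 ?(ltW r0) ?(ltW h0)//.
      by rewrite ler_pdivrMr ?mul1r//; move: L4; lra.
    rewrite ler_expR ler_wpM2r ?pdist_ge0//.
    by move: kL k0; lra.
  by lra.
Qed.

(** A gain for the wave near [l] must survive the maximum defining the majorant. Beyond distance 1 /
    k = kappa h / r from [j] the exponential weight costs a factor 3/4, which is enough since e <=
    1/4. Within that distance the improved wave bound applies, and its slow growth, at rate k / L,
    is beaten by the decay at rate [k]. *)
Lemma merged_gain (e : R) (l j : J) b1 b2 : 0 <= e -> e <= 4^-1 ->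
  child b1 -> child b2 -> b1 != b2 ->
  (forall j', dY j' l <= 2 * kappa * (h / r) ->
    normc (group_wave p b1 j' + group_wave p b2 j') <=
    M b1 j' + M b2 j' - e * Num.min (M b1 j') (M b2 j')) ->
  dY j l <= kappa * (h / r) ->
  merged_majorant j <= U j - e * Num.min (M b1 j) (M b2 j).
Proof.
move=> e0 e4 cb1 cb2 b12 alt jl.
have split2 (V : nmodType) (F : I -> V) : \sum_(b | child b) F b =
    \sum_(b | child b && (b != b1) && (b != b2)) F b + (F b1 + F b2).
  rewrite (bigD1 b1)//= (bigD1 b2)/=; last by rewrite cb2 eq_sym.
  by rewrite addrA addrC.
have M0 b j' : child b -> 0 <= M b j'.
  by move=> /andP[bA qb]; case: (majM bA qb).
have slow b j' : child b -> M b j' <= expR (k / L * dY j' j) * M b j.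
  by move=> /andP[bA qb]; case: (majM bA qb) => _ /(_ j' j); rewrite kLE.
have UE j' : U j' = \sum_(b | child b && (b != b1) && (b != b2)) M b j' +
    (M b1 j' + M b2 j') by exact: (split2 _ (M ^~ j')).
have min0 : 0 <= Num.min (M b1 j) (M b2 j) by rewrite le_min !M0.
have minU : Num.min (M b1 j) (M b2 j) <= U j.
  apply: (@le_trans _ _ (M b1 j)); first by rewrite ge_min lexx.
  rewrite UE.
  have : 0 <= \sum_(b | child b && (b != b1) && (b != b2)) M b j.
    by apply: sumr_ge0 => b /andP[/andP[cb _] _]; exact: M0.
  by have := M0 b2 j cb2; lra.
have emin : e * Num.min (M b1 j) (M b2 j) <= 4^-1 * U j by exact: ler_pM.
have := U_ge0 j => Uj0.
apply: merged_majorant_le => [|j']; first by lra.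
have d0 := pdist_ge0 y j j'.
have [jj'|jj'] := leP (dY j j') (kappa * (h / r)); last first.
  apply: (@le_trans _ _ (3 / 4 * U j)); last by lra.
  apply: (le_trans (ler_wpM2r (expR_ge0 _) (wave_le_U j'))).
  apply: (le_trans (ler_wpM2r (expR_ge0 _) (U_slow j' j))).
  rewrite mulrAC ler_wpM2r// -expRD pdistC.
  have -> : k / L * dY j j' - k * dY j j' = - ((k - k / L) * dY j j') by ring.
  apply: expRN_half; apply: (@le_trans _ _ (k / 2 * dY j j')).
    have : k * (kappa * (h / r)) <= k * dY j j' by rewrite ler_pM2l// ltW.
    have -> : k * (kappa * (h / r)) = 1.
      by rewrite /k; field; rewrite !gt_eqF.
    by lra.
  by rewrite ler_wpM2r//; move: kL; lra.
have near_l : dY j' l <= 2 * kappa * (h / r).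
  by apply: (le_trans (pdist_triangle y j' j l)); rewrite (pdistC y j' j); move: jl jj'; lra.
set E := expR (k / L * dY j' j).
have E0 : 0 <= E by exact: expR_ge0.
have : normc (group_wave (q \o p) a j') <=
    E * (U j - e * Num.min (M b1 j) (M b2 j)).
  rewrite group_wave_comp (split2 _ (fun b => group_wave p b j')).
  apply: (le_trans (ler_normcD _ _)); rewrite UE -addrA mulrDr lerD//.
    apply: (le_trans (ler_normc_sum _ _)); rewrite mulr_sumr.
    apply: ler_sum => b /andP[/andP[cb _] _]; apply: le_trans (slow b j' cb).
    by move: cb => /andP[bA qb]; case: (majM bA qb).
  apply: (le_trans (alt _ near_l)).
  by apply: ler_sub_min => //; [lra|exact: slow|exact: slow].
move=> gE; apply: (le_trans (ler_wpM2r (expR_ge0 _) gE)).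
rewrite mulrAC -expRD ler_piMl//; first by lra.
rewrite -[leRHS]expR0 ler_expR pdistC.
have -> : k / L * dY j j' - k * dY j j' = - ((k - k / L) * dY j j') by ring.
rewrite oppr_le0 mulr_ge0//; move: kL k0; lra.
Qed.

Lemma merged_energy j (w : I -> R) : (forall b, child b -> 0 < w b) ->
  merged_majorant j ^+ 2 <=
  (\sum_(b | child b) w b) * \sum_(b | child b) M b j ^+ 2 / w b.
Proof.
move=> w0; apply: le_trans (sqr_sum_le_weighted (M ^~ j) w0).
rewrite ler_sqr ?nnegrE ?merged_le ?U_ge0//.
by apply: le_trans (half_le_merged j); rewrite divr_ge0.
Qed.

(** The gain falls on whichever of [b1], [b2] has the smaller majorant at [j]. It becomes a
    coefficient 1 - e on that child, hence a saving of at least e times its weight, which is at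
    least [theta] times the total. *)
Lemma merged_energy_gain j (w : I -> R) (e theta : R) b1 b2 :
  (forall b, child b -> 0 < w b) -> 0 <= e -> e <= 1 -> 
  child b1 -> child b2 ->
  (forall b, child b -> theta * (\sum_(b | child b) w b) <= w b) ->
  merged_majorant j <= U j - e * Num.min (M b1 j) (M b2 j) ->
  merged_majorant j ^+ 2 <=
  (1 - e * theta) * ((\sum_(b | child b) w b) *
     \sum_(b | child b) M b j ^+ 2 / w b).
Proof.
move=> w0 e0 e1 cb1 cb2 wth mj.
have [b cb {}mj] : exists2 b, child b & merged_majorant j <= U j - e * M b j.
  move: mj; rewrite /Num.min; case: ifPn => _ mj; first by exists b1.
  by exists b2.
pose al b' : R := if b' == b then 1 - e else 1.
have UE : U j - e * M b j = \sum_(b' | child b') al b' * M b' j.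
  rewrite /U (bigD1 b)//= [RHS](bigD1 b)//= /al eqxx.
  rewrite [in RHS](eq_bigr (M ^~ j)); last first.
    by move=> b' /andP[_ /negbTE ->]; rewrite mul1r.
  by rewrite mulrBl mul1r addrAC.
apply: (@le_trans _ _ ((\sum_(b' | child b') al b' * M b' j) ^+ 2)).
  rewrite -UE ler_sqr ?nnegrE//.
    by apply: le_trans (half_le_merged j); rewrite divr_ge0.
  apply: le_trans mj.
  by apply: le_trans (half_le_merged j); rewrite divr_ge0.
apply: (le_trans (weighted_cauchy_schwarz _ _ w0)).
rewrite mulrA ler_wpM2r//.
  by apply: sumr_ge0 => b' cb'; rewrite divr_ge0 ?sqr_ge0// ltW// w0.
have wsum : \sum_(b' | child b') al b' ^+ 2 * w b' <=
    (\sum_(b' | child b') w b') - e * w b.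
  rewrite (bigD1 b)//= [in leRHS](bigD1 b)//= /al eqxx.
  rewrite [in leLHS](eq_bigr w); last first.
    by move=> b' /andP[_ /negbTE ->]; rewrite expr1n mul1r.
  have : (1 - e) ^+ 2 * w b <= (1 - e) * w b.
    rewrite ler_wpM2r ?(ltW (w0 b cb))// expr2 ler_piMr; lra.
  lra.
apply: (le_trans wsum); rewrite mulrBl mul1r lerD2l lerNl opprK -mulrA.
by rewrite ler_wpM2l// wth.
Qed.

End merging.

(** * Induction on scales *)

Section induction_on_scales.
Context (R : realType) (d : nat) (I J : finType).
Variables (x : I -> 'rV[R]_d) (y : J -> 'rV[R]_d) (c : I -> R[i]).
Variables (m : I -> R) (n : J -> R) (h : R).

Local Notation dX := (pdist x).
Local Notation dY := (pdist y).

(* [p] sends a point to the centre of its group, and [A] is the set of the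
   centres. *)
Definition scale_state (kappa r E : R) : Prop :=
  exists (A : {set I}) (p : I -> I) (M : I -> J -> R),
  [/\ forall i, p i \in A,
      forall i, dX i (p i) <= 2 * r,
      forall a i, a \in A -> dX i a <= r / 4 -> p i = a,
      forall a, a \in A -> majorizes x y c h kappa r p a (M a) &
      \sum_(a in A) \sum_j n j * (M a j ^+ 2 / group_mass m p a) <= E].

(** The factor multiplies three independent losses: e^2 from the failure of alignment, theta from
    the share of mass of one child, and n0 / (2 n1) from the proportion of points of [y] where the
    failure is seen. *)
Lemma scale_state_step (cN r kappa e L theta n0 n1 E : R) :
  0 < h -> 0 < cN -> cN <= 1 -> 0 < r ->
  kappa = cN / 64 -> e = kappa / 32 -> L = 24 / e ->
  0 <= theta -> 0 < n0 -> 0 < n1 ->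
  (forall i, 0 < m i) -> (forall j, 0 <= n j) ->
  (forall a i, theta * (\sum_(i' | dX i' a <= 2 * r) m i') <=
     \sum_(i' | dX i' i <= r / L / 4) m i') ->
  (forall j, n0 <= \sum_(j' | dY j' j <= kappa * (h / r)) n j') ->
  (forall j, \sum_(j' | dY j' j <= 2 * (h / r)) n j' <= n1) ->
  (forall i j, exists i1 i2 j1 j2,
     [/\ dX i1 i <= r / 8, dX i2 i <= r / 8, dY j1 j <= h / r, dY j2 j <= h / r
       & cN / 8 * h <= `|dot (x i1 - x i2) (y j1 - y j2)|]) ->
  e ^+ 2 * theta * (n0 / (2 * n1)) <= 1 ->
  scale_state kappa (r / L) E ->
  scale_state kappa r ((1 - e ^+ 2 * theta * (n0 / (2 * n1))) * E).
Proof.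
move=> h0 cN0 cN1 r0 kappaE eE LE th0 n00 n10 m0 nn hx hy0 hy1 hnon le1.
move=> [A [p [M [pA pr pin majM energy]]]].
have k0 : 0 < kappa by rewrite kappaE; lra.
have k1 : kappa <= 64^-1 by rewrite kappaE; lra.
have e0 : 0 < e by rewrite eE; lra.
have e1 : e <= 64^-1 by rewrite eE; lra.
have Linv : L^-1 = e / 24 by rewrite LE invf_div.
have L0 : 0 < L by rewrite LE divr_gt0.
have L64 : 4 <= L by rewrite LE ler_pdivlMr//; lra.
have rL : r / L <= r / 64.
  by rewrite Linv ler_pM2l//; lra.
have rL0 : 0 < r / L by exact: divr_gt0.
have hr0 : 0 < h / r by exact: divr_gt0.
have [A2 [q [A2A qP]]] := grouping (pdistii x) (pdistC x) (@pdist_triangle _ _ _ x) A r0.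
(* The constants 2 and 1/4 of [scale_state] are stable under composition: r + 2 r / L <= 2 r for the
   outer radius, and r / 4 + 2 r / L < r / 2, inside the disjoint balls of [grouping], for the inner
   one. *)
have inA2 a i : a \in A2 -> dX i a <= r / 4 -> q (p i) = a.
  move=> aA ia; have [_ _] := qP _ (pA i); apply => //.
  apply: (le_lt_trans (pdist_triangle x (p i) i a)).
  by rewrite pdistC; have := pr i; lra.
pose M2 a := merged_majorant x y c h A p q M kappa r a.
have gm0 b : b \in A -> 0 < group_mass m p b.
  move=> bA; rewrite /group_mass (bigD1 b)/=.
    rewrite ltr_pwDl// ; apply: sumr_ge0 => i _; exact: ltW.
  by apply/eqP; apply: pin => //; rewrite pdistii divr_ge0 ?ltW.
have hmaj a b : b \in A -> q b == a -> majorizes x y c h kappa (r / L) p b (M b).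
  by move=> bA _; exact: majM.
have hnear a b : b \in A -> q b == a -> dX b a <= r.
  by move=> bA /eqP <-; have [_ /ltW] := qP b bA.
exists A2, (q \o p), M2; split.
- by move=> i; have [] := qP _ (pA i).
- move=> i; apply: (le_trans (pdist_triangle x i (p i) _)).
  by have [_ h1 _] := qP _ (pA i); have := pr i; rewrite /=; lra.
- by move=> a i; exact: inA2.
- by move=> a aA; apply: (merged_majorizes h0 pA k0 r0 L64 (hmaj a) (hnear a)).
pose W a j := \sum_(b | (b \in A) && (q b == a)) M b j ^+ 2 / group_mass m p b.
have W0 a j : 0 <= W a j.
  by apply: sumr_ge0 => b /andP[bA _]; rewrite divr_ge0 ?sqr_ge0// ltW// gm0.
apply: (@le_trans _ _ (\sum_(a in A2) (1 - e ^+ 2 * theta * (n0 / (2 * n1))) *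
    \sum_j n j * W a j)); last first.
  rewrite -mulr_sumr ler_wpM2l//; first by lra.
  apply: le_trans energy; rewrite [leRHS](partition_big q (mem A2)) /=; last first.
    by move=> b bA; have [] := qP b bA.
  apply: ler_sum => a _; rewrite exchange_big /=.
  by apply: ler_sum => j _; rewrite mulr_sumr.
apply: ler_sum => a aA.
have gm2 : 0 < group_mass m (q \o p) a.
  rewrite /group_mass (bigD1 a)/=.
    rewrite ltr_pwDl// ; apply: sumr_ge0 => i _; exact: ltW.
  by apply/eqP; apply: inA2 => //; rewrite pdistii divr_ge0 ?ltW.
have gmE := group_mass_comp m q pA a.
have wpos b : (b \in A) && (q b == a) -> 0 < group_mass m p b.
  by move=> /andP[bA _]; exact: gm0.
(* One cluster [a] at a time: the left side is the energy of its merged majorant, and [W a] is what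
   Cauchy-Schwarz gives with no gain. Over a distance 2 h / r the squares in [W a] vary by a factor
   exp(4 / (L kappa)) <= 2. *)
apply: (@gain_average _ _ dY (pdistC y) n _ (W a) (e ^+ 2 * theta)
  (kappa * (h / r)) (h / r) n0 n1) => //.
- by rewrite mulr_ge0 ?sqr_ge0.
- by rewrite ler_piMl ?(ltW hr0)//; lra.
- exact: pdist_triangle.
- move=> j; rewrite ler_pdivrMr// mulrC gmE.
  exact: (merged_energy h0 pA k0 r0 L64 (hmaj a) j wpos).
- move=> j j' jj'; rewrite mulr_sumr; apply: ler_sum => b /andP[bA qb].
  rewrite mulrA ler_pM2r ?invr_gt0 ?gm0//.
  have [M0 Ml _ _] := majM b bA.
  set E1 := expR (r / L / (kappa * h) * dY j j').
  apply: (@le_trans _ _ ((E1 * M b j') ^+ 2)).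
    by rewrite ler_sqr ?nnegrE ?mulr_ge0 ?expR_ge0//; exact: Ml.
  rewrite exprMn ler_wpM2r ?sqr_ge0// /E1 -expRM_natl.
  apply: expR_half_le2.
  apply: (@le_trans _ _ (2%:R * (r / L / (kappa * h) * (2 * (h / r))))).
    rewrite ler_wpM2l// ler_wpM2l// divr_ge0 ?(ltW rL0)//.
    by rewrite mulr_ge0 ?ltW.
  have -> : 2%:R * (r / L / (kappa * h) * (2 * (h / r))) = 4 / L / kappa.
    by field; rewrite !gt_eqF.
  by rewrite ler_pdivrMr// Linv eE; lra.
- move=> j; have [i1 [i2 [j1 [j2 [hi1 hi2 hj1 hj2 hD]]]]] := hnon a j.
  have r84 : r / 8 <= r / 4 by lra.
  have c1 : (p i1 \in A) && (q (p i1) == a).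
    by rewrite pA; apply/eqP/inA2 => //; exact: le_trans r84.
  have c2 : (p i2 \in A) && (q (p i2) == a).
    by rewrite pA; apply/eqP/inA2 => //; exact: le_trans r84.
  have p1 := pr i1; have p2 := pr i2.
  have b12 : dX (p i1) (p i2) <= r / 2.
    have t1 := pdist_triangle x (p i1) i1 (p i2); have t2 := pdist_triangle x i1 a (p i2).
    have t3 := pdist_triangle x a i2 (p i2); rewrite (pdistC x (p i1) i1) (pdistC x a i2) in t1 t3.
    by clear - x y c m n h t1 t2 t3 hi1 hi2 p1 p2 rL r0; lra.
  have j12 : dY j1 j2 <= 2 * (h / r).
    by have := pdist_triangle y j1 j j2; rewrite (pdistC y j j2); clear - x y c m n h hj1 hj2; lra.
  (* Nonorthogonality speaks of points, the alternative of old centres. The two replacements cost at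
     most cN / 32 each, half of cN / 8 in all. *)
  have hD' : cN / 16 * h <= `|dot (x (p i1) - x (p i2)) (y j1 - y j2)|.
    have E1 : dot (x i1 - x i2) (y j1 - y j2) =
        dot (x (p i1) - x (p i2)) (y j1 - y j2) +
        (dot (x i1 - x (p i1)) (y j1 - y j2) - dot (x i2 - x (p i2)) (y j1 - y j2)).
      by rewrite !dotBl; ring.
    have small i : dX i (p i) <= 2 * (r / L) ->
        `|dot (x i - x (p i)) (y j1 - y j2)| <= cN / 32 * h.
      move=> hi; apply: (le_trans (dot_le _ _)).
      apply: (@le_trans _ _ (2 * (r / L) * (2 * (h / r)))).
        by apply: ler_pM => //; exact: enorm_ge0.
      have -> : 2 * (r / L) * (2 * (h / r)) = 4 / L * h.
        by field; rewrite !gt_eqF.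
      by rewrite ler_pM2r// Linv eE kappaE; lra.
    have s1 := small _ p1; have s2 := small _ p2.
    move: hD; rewrite E1 => hD.
    have n1' := ler_normD (dot (x (p i1) - x (p i2)) (y j1 - y j2))
      (dot (x i1 - x (p i1)) (y j1 - y j2) - dot (x i2 - x (p i2)) (y j1 - y j2)).
    have n2' := ler_normB (dot (x i1 - x (p i1)) (y j1 - y j2))
      (dot (x i2 - x (p i2)) (y j1 - y j2)).
    have -> : cN / 16 * h = cN / 8 * h - (cN / 32 * h + cN / 32 * h) by clear - x y c m n h; lra.
    by clear - x y c m n h hD n1' n2' s1 s2; lra.
  have b12ne : p i1 != p i2.
    apply/eqP => pp; move: hD'; rewrite pp subrr.
    have -> : dot 0 (y j1 - y j2) = 0.
      by rewrite /dot big1// => i _; rewrite mxE mul0r.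
    by rewrite normr0 leNgt mulr_gt0// divr_gt0.
  have := andP c1 => -[b1A _]; have := andP c2 => -[b2A _].
  have [l lj12 alt] := gain_alternative h0 cN0 cN1 r0 kappaE eE LE
    (majM _ b1A) (majM _ b2A) b12 j12 hD'.
  exists l.
    by move: lj12; rewrite !inE => /orP[/eqP ->|/eqP ->].
  move=> j' j'l.
  rewrite ler_pdivrMr// gmE -mulrA [W _ _ * _]mulrC.
  have es : e ^+ 2 <= 4^-1.
    by rewrite expr2; apply: (@le_trans _ _ (64^-1 * 64^-1));
      [apply: ler_pM => //; exact: ltW|clear - x y c m n h; lra].
  have mg := merged_gain h0 pA k0 r0 L64 (hmaj a) (sqr_ge0 e) es c1 c2 b12ne
    alt j'l.
  apply: (merged_energy_gain (hmaj a) wpos (sqr_ge0 e) _ c1 c2 _ mg).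
    by clear - x y c m n h es; lra.
  move=> b /andP[bA qb]; rewrite -gmE.
  (* The new cluster lies in the ball of radius 2 r about [a], and the child contains the ball of
     radius r / L / 4 about [b]; [hx] compares these two balls. *)
  apply: (le_trans _ (le_trans (hx a b) _)).
    rewrite ler_wpM2l// /group_mass big_mkcond [leRHS]big_mkcond /=.
    apply: ler_sum => i _; case: ifPn => [/eqP qpi|_]; last first.
      by case: ifP => // _; exact: ltW.
    rewrite ifT// -qpi; apply: (le_trans (pdist_triangle x i (p i) _)).
    by have [_ h1 _] := qP _ (pA i); have := pr i; rewrite /=; clear - x y c m n h h1 rL r0; lra.
  rewrite /group_mass big_mkcond [leRHS]big_mkcond /=.
  apply: ler_sum => i _; case: ifPn => [ib|_]; last first.
    by case: ifP => // _; exact: ltW.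
  by rewrite ifT//; apply/eqP/pin.
Qed.

End induction_on_scales.

Section extremal_scales.
Context (R : realType) (d : nat) (I J : finType).
Variables (x : I -> 'rV[R]_d) (y : J -> 'rV[R]_d) (c : I -> R[i]).
Variables (m : I -> R) (n : J -> R) (h : R).

(** The mass of a group, constant in [j], is a majorant at every scale, since the phases relative to
    the centre turn at rate at most r / h. *)
Lemma scale_state_init (kappa r : R) : 0 < h -> 0 < kappa -> 0 < r ->
  (forall i, 0 < m i) -> (forall i, normc (c i) <= m i) ->
  scale_state x y c m n h kappa r ((\sum_j n j) * \sum_i m i).
Proof.
move=> h0 k0 r0 m0 cm.
have [A [p [_ pP]]] := grouping (pdistii x) (pdistC x) (@pdist_triangle _ _ _ x) [set: I]%SET r0.
have pA i : p i \in A by have [] := pP i (finset.in_setT i).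
have pd i : pdist x i (p i) < r by have [] := pP i (finset.in_setT i).
have gm0 a : 0 <= group_mass m p a by apply: sumr_ge0 => i _; exact: ltW.
have E1 a : 0 <= a -> 1 <= expR (r / (kappa * h) * a) :> R.
  by move=> a0; rewrite -expR0 ler_expR mulr_ge0// divr_ge0 ?mulr_ge0 ?ltW.
exists A, p, (fun a _ => group_mass m p a); split => //.
- by move=> i; have := pd i; lra.
- move=> a i aA ia; have [_ _] := pP i (finset.in_setT i); apply => //.
  by lra.
- move=> a aA; split => //.
  + by move=> j j'; rewrite ler_peMl// E1// pdist_ge0.
  + move=> j; apply: (le_trans (ler_normc_sum _ _)); apply: ler_sum => i _.
    by rewrite /wave mulrC normc_expiM.
  + move=> j j'.
    apply: (@le_trans _ _ (r / h * pdist y j j' * group_mass m p a)); last first.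
      rewrite ler_wpM2r//.
      have rd : 0 <= r / h * pdist y j j'.
        by rewrite mulr_ge0 ?pdist_ge0// divr_ge0 ?ltW.
      have := E1 _ (pdist_ge0 y j j'); set E := expR _ => E1'.
      have : r / h * pdist y j j' <= r / h * pdist y j j' * E by rewrite ler_peMr.
      have : 0 <= r / h * pdist y j j' * E by rewrite mulr_ge0// expR_ge0.
      by lra.
    rewrite /envelope /group_wave !mulr_sumr -sumrB.
    apply: (le_trans (ler_normc_sum _ _)).
    apply: ler_sum => i /eqP pi.
    pose w l := dot (x i - x a) (y l) / h.
    have wE l : expi (- (dot (x a) (y l) / h)) * wave x y c h i l = expi (w l) * c i.
      rewrite /wave mulrCA mulrC -expiD; congr (expi _ * _).
      by rewrite /w dotBl; ring.
    rewrite !wE -mulrBl ComplexField.Normc.normcM.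
    apply: ler_pM; rewrite ?normc_ge0//.
    apply: (le_trans (normc_expiB_le _ _)).
    rewrite /w -mulrBl -dotBr normrM (gtr0_norm (_ : 0 < h^-1)) ?invr_gt0//.
    rewrite mulrAC ler_pM2r ?invr_gt0//; apply: (le_trans (dot_le _ _)).
    by rewrite ler_wpM2r ?enorm_ge0// -pi ltW// pd.
- rewrite [X in _ <= _ * X](partition_big p (mem A)) //=.
  rewrite [leRHS]mulr_sumr; apply: ler_sum => a aA.
  rewrite [leRHS]mulr_suml; apply: ler_sum => j _.
  rewrite -/(group_mass m p a).
  have [->|g0] := eqVneq (group_mass m p a) 0; first by rewrite invr0 !mulr0.
  by rewrite expr2 mulfK.
Qed.

(** Cauchy-Schwarz over all remaining clusters at once, weighted by their masses, ends the induction
    at any scale. *)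
Lemma scale_state_bound (kappa r E : R) :
  (forall i, 0 < m i) -> (forall j, 0 <= n j) -> 0 < r ->
  scale_state x y c m n h kappa r E ->
  \sum_j n j * normc (\sum_i wave x y c h i j) ^+ 2 <= (\sum_i m i) * E.
Proof.
move=> m0 nn r0 [A [p [M [pA _ pin majM energy]]]].
have gm0 b : b \in A -> 0 < group_mass m p b.
  move=> bA; rewrite /group_mass (bigD1 b)/=.
    rewrite ltr_pwDl// ; apply: sumr_ge0 => i _; exact: ltW.
  by apply/eqP; apply: pin => //; rewrite pdistii divr_ge0 ?ltW.
have sm0 : 0 <= \sum_i m i by apply: sumr_ge0 => i _; exact: ltW.
apply: (@le_trans _ _ ((\sum_i m i) *
    \sum_(a in A) \sum_j n j * (M a j ^+ 2 / group_mass m p a))); last first.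
  by rewrite ler_wpM2l.
rewrite exchange_big /= mulr_sumr; apply: ler_sum => j _.
rewrite -[X in _ <= _ * X]mulr_sumr [leRHS]mulrCA ler_wpM2l//.
have -> : \sum_i m i = \sum_(a in A) group_mass m p a.
  rewrite [LHS](partition_big p (mem A)) //=.
apply: le_trans (sqr_sum_le_weighted (M ^~ j) gm0).
rewrite ler_sqr ?nnegrE ?normc_ge0//; last first.
  by apply: sumr_ge0 => a aA; case: (majM a aA).
rewrite [X in normc X](partition_big p (mem A)) //=.
apply: (le_trans (ler_normc_sum _ _)).
by apply: ler_sum => a aA; have [_ _ gM _] := majM a aA; exact: gM.
Qed.

End extremal_scales.

(** * The power gain for finite sets *)

Section discrete_uncertainty.
Context (R : realType).

(** A net of spacing [h] reflects the regular measure only at scales well above [h], and the measure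
    is regular only up to scale 1; hence the window from A0 h to 1 / A0. *)
Definition discrete_regular (d : nat) (I : finType) (x : I -> 'rV[R]_d)
    (m : I -> R) (delta K A0 h : R) : Prop :=
  [/\ forall i, 0 < m i, \sum_i m i <= K &
    forall i t, A0 * h <= t -> t <= A0^-1 ->
      K^-1 * t `^ delta <= \sum_(i' | pdist x i' i <= t) m i' <= K * t `^ delta].

Definition discrete_nonorthogonal (d : nat) (I J : finType)
    (x : I -> 'rV[R]_d) (y : J -> 'rV[R]_d) (cN A0 h : R) : Prop :=
  forall i j rX rY, A0 * h <= rX -> rX <= A0^-1 -> A0 * h <= rY -> rY <= A0^-1 ->
  exists i1 i2 j1 j2, [/\ pdist x i1 i <= rX, pdist x i2 i <= rX,
    pdist y j1 j <= rY, pdist y j2 j <= rY &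
    cN * rX * rY <= `|dot (x i1 - x i2) (y j1 - y j2)|].

(* The scales visited by the induction step stay between [A0 h] and [A0^-1]. *)
Lemma scale_window (A0 L kappa r h : R) : 0 < h -> 0 < r -> 1 <= A0 ->
  0 < kappa -> kappa <= 64^-1 -> 32 * (A0 * h) <= r / L -> r / L <= r ->
  r <= kappa / A0 -> r <= (2 * A0)^-1 ->
  [/\ A0 * h <= 2 * r /\ 2 * r <= A0^-1,
      A0 * h <= r / L / 4 /\ r / L / 4 <= A0^-1,
      A0 * h <= kappa * (h / r) /\ kappa * (h / r) <= A0^-1,
      A0 * h <= 2 * (h / r) /\ 2 * (h / r) <= A0^-1 &
      (A0 * h <= r / 8 /\ r / 8 <= A0^-1) /\ (A0 * h <= h / r /\ h / r <= A0^-1)].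
Proof.
move=> h0 r0 A01 k0 k1 rlow rL rk r2.
have A00 : 0 < A0 by lra.
have A0h : 0 < A0 * h by rewrite mulr_gt0.
have hr0 : 0 < h / r by rewrite divr_gt0.
have A0i : A0^-1 = 2 * (2 * A0)^-1 by rewrite invfM mulrA mulfV ?mul1r.
have A0i0 : 0 < A0^-1 by rewrite invr_gt0.
have s1 : A0 * h <= kappa * (h / r).
  rewrite mulrA ler_pdivlMr//; have -> : A0 * h * r = r * A0 * h by ring.
  by rewrite ler_pM2r// -ler_pdivlMr.
have s2 : 2 * (h / r) <= A0^-1.
  rewrite mulrA ler_pdivrMr// [leRHS]mulrC ler_pdivlMr//; lra.
have s3 : kappa * (h / r) <= h / r by rewrite ler_piMl ?(ltW hr0)//; lra.
by split; [split|split|split|split|split; split]; lra.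
Qed.

Lemma discrete_uncertainty (cN delta delta' K A0 : R) :
  0 < cN -> cN <= 1 -> 1 <= K -> 1 <= A0 ->
  exists gamma C : R, 0 < gamma /\ 0 < C /\
  forall (d : nat) (I J : finType) (x : I -> 'rV[R]_d) (y : J -> 'rV[R]_d)
    (c : I -> R[i]) (m : I -> R) (n : J -> R) (h : R), 0 < h ->
    discrete_regular x m delta K A0 h -> discrete_regular y n delta' K A0 h ->
    discrete_nonorthogonal x y cN A0 h ->
    (forall i, normc (c i) <= m i) ->
    \sum_j n j * normc (\sum_i wave x y c h i j) ^+ 2 <= C * h `^ gamma.
Proof.
move=> cN0 cN1 K1 A01.
pose kappa := cN / 64; pose e := kappa / 32; pose L := 24 / e.
have kappaE : kappa = cN / 64 by []. have eE : e = kappa / 32 by [].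
have LE : L = 24 / e by [].
clearbody L; clearbody e; clearbody kappa.
have K0 : 0 < K by lra.
have A00 : 0 < A0 by lra.
have k0 : 0 < kappa by rewrite kappaE; lra.
have k1 : kappa <= 64^-1 by rewrite kappaE; lra.
have e0 : 0 < e by rewrite eE; lra.
have e1 : e <= 64^-1 by rewrite eE; lra.
have L0 : 0 < L by rewrite LE divr_gt0.
have L4 : 4 <= L by rewrite LE ler_pdivlMr//; lra.
(* [th] compares the lower bound of regularity at radius r / L / 4 with the upper one at 2 r; [nu]
   is n0 / (2 n1) for the radii kappa h / r and 2 h / r. The scale r cancels in both, so every step
   gains the same [eta]. *)
pose th := K^-1 ^+ 2 * (8 * L)^-1 `^ delta.
pose nu := K^-1 ^+ 2 / 2 * (kappa / 2) `^ delta'.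
have th0 : 0 < th by rewrite mulr_gt0 ?exprn_gt0 ?invr_gt0// powR_gt0 ?invr_gt0 ?mulr_gt0.
have nu0 : 0 < nu by rewrite mulr_gt0 ?divr_gt0 ?exprn_gt0 ?invr_gt0// powR_gt0 ?divr_gt0.
(* The minimum makes [eta <= 1 / 2] immediate. *)
pose th' := Num.min th (2 * nu)^-1.
have th'0 : 0 < th' by rewrite lt_min th0 invr_gt0 mulr_gt0.
pose eta := e ^+ 2 * th' * nu.
have eta_gt0 : 0 < eta.
  exact: (mulr_gt0 (mulr_gt0 (exprn_gt0 _ e0) th'0) nu0).
have eta_lt1 : eta <= 2^-1.
  rewrite /eta -mulrA; apply: (@le_trans _ _ (e ^+ 2 * 2^-1)).
    rewrite ler_wpM2l ?sqr_ge0//; apply: (@le_trans _ _ ((2 * nu)^-1 * nu)).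
      by rewrite ler_wpM2r ?(ltW nu0)// ge_min lexx orbT.
    by rewrite invfM -mulrA mulVf ?gt_eqF// mulr1.
  by rewrite ler_piMl// exprn_ile1// ?(ltW e0)//; lra.
have eta1 : 0 < 1 - eta by lra.
(* Radii will run from B h to 1 / B. At the bottom B >= 8 L A0 >= 32 A0 keeps the small balls above
   A0 h; at the top B >= A0 / kappa keeps the dual radius kappa h / r above A0 h. *)
have [B BE] : exists B, B = 8 * L * A0 / kappa by eexists.
have B0 : 0 < B by rewrite BE divr_gt0// !mulr_gt0.
have LA : L <= L * A0 by rewrite ler_peMr// ltW.
have B4 : 8 * L * A0 <= B.
  by rewrite BE ler_pdivlMr// ler_piMr//; [rewrite !mulr_ge0// ltW|lra].
have Bi : B^-1 <= kappa / A0 /\ B^-1 <= (2 * A0)^-1.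
  split.
    rewrite -[kappa / A0]invrK lef_pV2 ?posrE// ?invr_gt0 ?divr_gt0//.
    rewrite invf_div BE ler_pM2r ?invr_gt0// ler_peMl ?(ltW A00)//; lra.
  rewrite lef_pV2 ?posrE ?mulr_gt0//; apply: (le_trans _ B4).
  by rewrite ler_pM2r//; lra.
(* The exponent is fixed by L^(-gamma) = 1 - eta: one step multiplies the radius by [L] and the
   energy by 1 - eta. *)
pose lam := - ln (1 - eta).
have lam0 : 0 < lam by rewrite oppr_gt0 ln_lt0//; lra.
have lnL : 0 < ln L by rewrite ln_gt0//; lra.
pose gamma := lam / ln L.
have gamma0 : 0 < gamma by rewrite divr_gt0.
exists gamma, (K ^+ 3 * expR lam * (B ^+ 2) `^ gamma); split => //; split.
  by rewrite !mulr_gt0 ?exprn_gt0 ?expR_gt0// powR_gt0// exprn_gt0.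
move=> d I J x y c m n h h0 [m0 mK regX] [n0 nK regY] non cm.
have nn j : 0 <= n j by exact: ltW.
have st0 r : 0 < r -> scale_state x y c m n h kappa r (K ^+ 2).
  move=> r0; have [A [p [M [H1 H2 H3 H4 H5]]]] :=
    @scale_state_init R d I J x y c m n h kappa r h0 k0 r0 m0 cm.
  exists A, p, M; split => //; apply: (le_trans H5); rewrite expr2 ler_pM//;
    by apply: sumr_ge0 => ? _; rewrite ?nn// ltW.
have B2h : 0 < B ^+ 2 * h by rewrite mulr_gt0 ?exprn_gt0.
rewrite -mulrA -powRM ?exprn_ge0 ?(ltW B0) ?(ltW h0)//.
have smK E : 0 <= E -> (\sum_i m i) * E <= K * E by move=> E0; rewrite ler_wpM2r.
(* If B^2 h >= 1 there is no room for a step, but then (B^2 h)^gamma >= 1 and the trivial bound K^3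
   suffices. *)
have [big|small] := leP 1 (B ^+ 2 * h).
  apply: (le_trans (scale_state_bound m0 nn ltr01 (st0 _ ltr01))).
  apply: (le_trans (smK _ (exprn_ge0 _ (ltW K0)))).
  rewrite -exprS -mulrA ler_peMr ?exprn_ge0 ?(ltW K0)//.
  rewrite -[leLHS]mulr1 ler_pM//.
    by rewrite -expR0 ler_expR ltW.
  by rewrite /powR gt_eqF// -expR0 ler_expR mulr_ge0 ?ln_ge0// ltW.
have step k : B * h * L ^+ k <= B^-1 ->
    scale_state x y c m n h kappa (B * h * L ^+ k) ((1 - eta) ^+ k * K ^+ 2).
  elim: k => [|k IHk] hk; first by rewrite expr0 mulr1 mul1r; apply: st0; rewrite mulr_gt0.
  set r := B * h * L ^+ k.+1 in hk *.
  have Lk : 1 <= L ^+ k by rewrite exprn_ege1//; lra.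
  have r0 : 0 < r by rewrite !mulr_gt0// exprn_gt0.
  have rLE : r / L = B * h * L ^+ k.
    by rewrite /r exprSr !mulrA mulfK// gt_eqF.
  have rlow : B * h <= r / L.
    by rewrite rLE ler_peMr// mulr_ge0 ?ltW.
  have rL : r / L <= r.
    by rewrite ler_pdivrMr// ler_peMr ?(ltW r0)//; lra.
  have Bh : 8 * L * A0 * h <= B * h by rewrite ler_pM2r.
  have LAh : A0 * h * 32 <= 8 * L * A0 * h.
    have -> : 8 * L * A0 * h = A0 * h * (8 * L) by ring.
    by rewrite ler_pM2l ?mulr_gt0//; lra.
  have [rk r2] : r <= kappa / A0 /\ r <= (2 * A0)^-1.
    by case: Bi => b1 b2; split; apply: (le_trans hk).
  have A0h : 0 < A0 * h by rewrite mulr_gt0.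
  have hr0 : 0 < h / r by rewrite divr_gt0.
  have rlow' : 32 * (A0 * h) <= r / L.
    by rewrite mulrC; apply: (le_trans LAh); exact: (le_trans Bh).
  have [[u1 u2] [u3 u4] [s1 s2] [s3 s4] [[v1 v2] [v3 v4]]] :=
    scale_window h0 r0 A01 k0 k1 rlow' rL rk r2.
  have step1 := @scale_state_step R d I J x y c m n h cN r kappa e L th'
    (K^-1 * (kappa * (h / r)) `^ delta') (K * (2 * (h / r)) `^ delta')
    ((1 - eta) ^+ k * K ^+ 2) h0 cN0 cN1 r0 kappaE eE LE (ltW th'0).
  have nuE : K^-1 * (kappa * (h / r)) `^ delta' /
     (2 * (K * (2 * (h / r)) `^ delta')) = nu.
    have -> : kappa * (h / r) = (kappa / 2) * (2 * (h / r)) by field; rewrite gt_eqF.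
    have k20 : 0 <= kappa / 2 by rewrite divr_ge0// ltW.
    have hr20 : 0 <= 2 * (h / r) by rewrite mulr_ge0// ltW.
    rewrite (powRM _ k20 hr20) /nu.
    have P0 : (2 * (h / r)) `^ delta' != 0 by rewrite gt_eqF// powR_gt0// mulr_gt0.
    by move: P0; set P := _ `^ _; set Q := _ `^ _ => P0; field; rewrite P0 gt_eqF.
  have etaE : eta = e ^+ 2 * th' * (K^-1 * (kappa * (h / r)) `^ delta' /
     (2 * (K * (2 * (h / r)) `^ delta'))) by rewrite nuE.
  rewrite exprS -mulrA {1}etaE.
  apply: step1.
  - by rewrite mulr_gt0 ?invr_gt0// powR_gt0// mulr_gt0.
  - by rewrite mulr_gt0// powR_gt0// mulr_gt0.
  - by [].
  - by [].
  - move=> a i.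
    have /andP[_ up] := regX a _ u1 u2; have /andP[low _] := regX i _ u3 u4.
    apply: (le_trans _ low); apply: (@le_trans _ _ (th * (K * (2 * r) `^ delta))).
      apply: ler_pM; rewrite ?(ltW th'0)// ?ge_min ?lexx//.
      by apply: sumr_ge0 => ? _; exact: ltW.
    have -> : r / L / 4 = (8 * L)^-1 * (2 * r) by field; rewrite gt_eqF.
    have L80 : 0 <= (8 * L)^-1 by rewrite invr_ge0 mulr_ge0// ltW.
    have r20 : 0 <= 2 * r by rewrite mulr_ge0// ltW.
    rewrite (powRM _ L80 r20) /th.
    set P := _ `^ _; set Q := _ `^ _.
    by rewrite le_eqVlt; apply/orP; left; apply/eqP; field; rewrite gt_eqF.
  - by move=> j; have /andP[] := regY j _ s1 s2.
  - by move=> j; have /andP[] := regY j _ s3 s4.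
  - move=> i j; have [i1 [i2 [j1 [j2 [? ? ? ? hD]]]]] := non i j _ _ v1 v2 v3 v4.
    exists i1, i2, j1, j2; split => //; apply: le_trans hD.
    by rewrite le_eqVlt; apply/orP; left; apply/eqP; field; rewrite gt_eqF.
  - by rewrite nuE -/eta; clear - eta_lt1; lra.
  - by rewrite rLE; apply: IHk; rewrite -rLE; exact: le_trans hk.
(* The real solution of B h L^t = 1 / B. Rounding it down loses less than one step, which the factor
   [expR lam] in the constant pays for. *)
pose t := - ln (B ^+ 2 * h) / ln L.
have t0 : 0 <= t by rewrite divr_ge0 ?(ltW lnL)// oppr_ge0 ln_le0// ltW.
pose k := Num.truncn t.
have [kt tk] : k%:R <= t /\ t < k.+1%:R.
  by rewrite truncn_le// truncnS_gt.
have eLk : L ^+ k = expR (k%:R * ln L) by rewrite expRM_natl lnK ?posrE.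
have hk : B * h * L ^+ k <= B^-1.
  have : L ^+ k <= (B ^+ 2 * h)^-1.
    rewrite eLk -[leRHS]lnK ?posrE ?invr_gt0// ler_expR lnV ?posrE//.
    by rewrite -ler_pdivlMr.
  rewrite -(@ler_pM2l _ (B * h)) ?mulr_gt0// => /le_trans; apply.
  by rewrite le_eqVlt; apply/orP; left; apply/eqP; field; rewrite !gt_eqF.
have rk0 : 0 < B * h * L ^+ k by rewrite !mulr_gt0// exprn_gt0.
apply: (le_trans (scale_state_bound m0 nn rk0 (step k hk))).
apply: (le_trans (smK _ _)); first by rewrite mulr_ge0 ?exprn_ge0 ?ltW.
rewrite mulrCA -exprS mulrC -mulrA ler_wpM2l ?exprn_ge0 ?(ltW K0)//.
rewrite /powR gt_eqF// -expRD.
have -> : (1 - eta) ^+ k = expR (k%:R * ln (1 - eta)).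
  by rewrite expRM_natl lnK ?posrE.
rewrite ler_expR.
have -> : gamma * ln (B ^+ 2 * h) = - (t * lam).
  by rewrite /gamma /t; field; rewrite gt_eqF.
have -> : ln (1 - eta) = - lam by rewrite /lam opprK.
rewrite mulrN; have : t * lam <= k.+1%:R * lam by rewrite ler_pM2r// ltW.
by rewrite -natr1 mulrDl mul1r -lerBlDr => h1; rewrite lerNl opprB.
Qed.

End discrete_uncertainty.

(** * Nets of regular sets *)

Section euclidean_topology.
Context (R : realType) (d : nat).
Implicit Types (c x : 'rV[R]_d) (r : R).

Lemma continuous_enormB c : continuous (fun x => enorm (x - c)).
Proof.
have cdot : continuous (fun x => dot (x - c) (x - c)).
  apply: (continuous_big (op := +%R)); first exact: add_continuous.
  move=> i _; have cc : continuous (fun x => (x - c) ord0 i).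
    rewrite (_ : (fun _ => _) = fun x => x ord0 i - c ord0 i).
      move=> x; apply: (@continuousB _ _ _ (fun x : 'rV[R]_d => x ord0 i) (cst (c ord0 i))).
        exact: coord_continuous.
      exact: cst_continuous.
    by apply/funext => x; rewrite !mxE.
  by move=> x; apply: (continuousM (cc x) (cc x)).
move=> x; apply: (@continuous_comp _ _ _ (fun x => dot (x - c) (x - c)) Num.sqrt).
  exact: cdot.
exact: sqrt_continuous.
Qed.

Lemma open_eball c r : open (eball c r).
Proof.
rewrite (_ : eball c r = (fun x => enorm (x - c)) @^-1` [set t | t < r])//.
by apply: open_comp; [move=> x _; exact: continuous_enormB|exact: open_lt].
Qed.

Lemma closed_eclosed_ball c r : closed (eclosed_ball c r).
Proof.
rewrite (_ : eclosed_ball c r = (fun x => enorm (x - c)) @^-1` [set t | t <= r])//.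
apply: (preimage_closed _ (@closed_le _ _)) => x _.
exact: continuous_enormB.
Qed.

Lemma measurable_eball c r : measurable (eball c r).
Proof. by apply: open_measurable_rV; exact: open_eball. Qed.

Lemma measurable_closed_rV (A : set 'rV[R]_d) : closed A -> measurable A.
Proof.
move=> cA; rewrite -(setCK A); apply: measurableC; apply: open_measurable_rV.
exact: closed_openC.
Qed.

Lemma measurable_eclosed_ball c r : measurable (eclosed_ball c r).
Proof. by apply: measurable_closed_rV; exact: closed_eclosed_ball. Qed.

Lemma compact_eclosed_ball c r : compact (eclosed_ball c r).
Proof.
apply: (@subclosed_compact _ _
  [set v : 'rV[R]_d | forall i, `[c ord0 i - r, c ord0 i + r]%classic (v ord0 i)]).
- exact: closed_eclosed_ball.
- apply: (@rV_compact _ _ (fun i => `[c ord0 i - r, c ord0 i + r]%classic)) => i.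
  exact: segment_compact.
- move=> x cx i /=; rewrite in_itv /= -ler_distlC.
  have := coord_le_enorm (x - c) i; rewrite !mxE distrC => /le_trans; exact.
Qed.

Lemma bounded_of_compact (X : set 'rV[R]_d) : compact X ->
  exists2 b : R, 0 < b & forall x, X x -> enorm x < b.
Proof.
move=> cX; move: (cX); rewrite compact_cover => /(_ nat setT (fun k => eball 0 k.+1%:R)).
case; first by move=> k _; exact: open_eball.
  move=> x _; exists (Num.truncn (enorm x)) => //.
  by rewrite /eball /= subr0 truncnS_gt.
move=> D _ XD; exists (\sum_(k <- D) k.+1%:R + 1).
  by rewrite ltr_pwDr// sumr_ge0.
move=> x /XD[k /= kD]; rewrite /eball /= subr0 => /lt_le_trans; apply.
rewrite (big_rem k)//= -addrA lerDl addr_ge0// sumr_ge0//.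
Qed.

(** A finite cover by balls of radius r centred in [X] comes from compactness. A maximal separated
    subset of the centres is within r of every centre, hence within 2 r of [X]. *)
Lemma net_exists (X : set 'rV[R]_d) r : compact X -> 0 < r ->
  exists (I : finType) (x : I -> 'rV[R]_d),
    [/\ forall i, X (x i), forall i j, i != j -> r <= pdist x i j &
      forall z, X z -> exists i, enorm (z - x i) < 2 * r].
Proof.
move=> cX r0; move: (cX); rewrite compact_cover.
move=> /(_ 'rV[R]_d X (fun z => eball z r)).
case; first by move=> z _; exact: open_eball.
  by move=> z Xz; exists z => //; rewrite /eball /= subrr enorm0.
move=> D DX XD; pose y (i : D) := val i.
have [A _ [sep cov]] := maximal_separated (pdistii y) (pdistC y)
  [set: D]%SET r0.
exists {a | a \in A}, (fun a => y (val a)); split.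
- by move=> a; apply/set_mem/DX/valP.
- by move=> i j ij; apply: sep; rewrite ?(valP i) ?(valP j).
move=> z /XD[w /= wD zw].
have [a aA wa] := cov (FSetSub wD) (finset.in_setT _).
exists (exist _ a aA) => /=; apply: (le_lt_trans (enorm_triangle w _ _)).
by move: zw wa; rewrite /pdist /y /eball /=; lra.
Qed.

End euclidean_topology.

Section measure_of_finite_unions.
Context (dp : measure_display) (T : measurableType dp) (R : realType).
Variables (mu : {measure set T -> \bar R}) (I : finType) (F : I -> set T).
Hypothesis mF : forall i, measurable (F i).
Local Open Scope ereal_scope.

Lemma measure_bigsetU_le (P : pred I) :
  mu (\big[setU/set0]_(i | P i) F i) <= \sum_(i | P i) mu (F i).
Proof.
suff [] : measurable (\big[setU/set0]_(i | P i) F i) /\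
  mu (\big[setU/set0]_(i | P i) F i) <= \sum_(i | P i) mu (F i) by [].
elim/big_rec2 : _ => [|i x A _ [mA h]]; first by rewrite measure0.
split; first exact: measurableU.
apply: (@le_trans _ _ (mu (F i) + mu A)); last by rewrite leeD2l.
by apply: measureU2 => //; exact: mF.
Qed.

Lemma sum_measure_disjoint (P : pred I) (B : set T) : measurable B ->
  (forall i j, i != j -> F i `&` F j = set0) ->
  (forall i, P i -> F i `<=` B) ->
  \sum_(i | P i) mu (F i) <= mu B.
Proof.
move=> mB disj FB.
have mU (s : seq I) : measurable (\big[setU/set0]_(i <- s | P i) F i).
  by apply: bigsetU_measurable.
suff -> : \sum_(i | P i) mu (F i) = mu (\big[setU/set0]_(i | P i) F i).
  apply: le_measure; rewrite ?inE// => x.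
  by rewrite -bigcup_seq_cond => -[i /andP[_ Pi]]; exact: FB.
have : uniq (index_enum I) by exact: index_enum_uniq.
elim: (index_enum I) => [|i s IHs] /=; first by rewrite !big_nil measure0.
move=> /andP[si us]; rewrite !big_cons; case: ifPn => [Pi|_]; last exact: IHs.
rewrite IHs// measureU//.
apply/seteqP; split => // x [Fx]; rewrite -bigcup_seq_cond => -[j /= /andP[js _] Fjx].
have : (F i `&` F j) x by [].
by rewrite disj//; apply: contraNneq si => ->.
Qed.

End measure_of_finite_unions.

Definition is_net (R : realType) (d : nat) (X : set 'rV[R]_d) (h : R)
    (I : finType) (x : I -> 'rV[R]_d) : Prop :=
  [/\ forall i, X (x i), forall i j, i != j -> h <= pdist x i j &
      forall z, X z -> exists i, enorm (z - x i) < 2 * h].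

Section nets_of_regular_sets.
Context (R : realType) (d : nat).

Lemma null_off_support (mu : {finite_measure set 'rV[R]_d -> \bar R})
    (K : set 'rV[R]_d) : compact K -> measurable K ->
  K `&` msupport mu = set0 -> mu K = 0%E.
Proof.
move=> cK mK Kmu.
have /choice[U UP] : forall z, exists U : set 'rV[R]_d,
    K z -> [/\ open U, U z & mu U = 0%E].
  move=> z; have [Kz|] := pselect (K z); last by exists set0.
  have nz : ~ msupport mu z.
    by move=> sz; have : (K `&` msupport mu) z by []; rewrite Kmu.
  have [U nU] : exists U, ~ (open U -> U z -> (0 < mu U)%E).
    by apply: contrapT => nex; apply: nz => U; apply: contrapT => h; apply: nex; exists U.
  exists U => _; apply: contrapT => h; apply: nU => oU Uz.
  rewrite lt_neqAle measure_ge0 andbT eq_sym; apply/eqP => mU0.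
  by apply: h.
move: cK; rewrite compact_cover => /(_ 'rV[R]_d K U).
case; first by move=> z /UP[].
  by move=> z Kz; exists z => //; have [] := UP z Kz.
move=> D DK KD; apply/eqP; rewrite -measure_le0.
have DP z : z \in D -> [/\ open (U z), U z z & mu (U z) = 0%E].
  by move=> /DK /set_mem /UP.
have mU (z : D) : measurable (U (val z)).
  by apply: open_measurable_rV; have [] := DP _ (valP z).
apply: (@le_trans _ _ (mu (\big[setU/set0]_(z : D | true) U (val z)))).
  apply: le_measure; rewrite ?inE//.
    by apply: bigsetU_measurable => z _; exact: mU.
  move=> z /KD[w /= wD Uwz]; rewrite -bigcup_seq_cond.
  by exists (FSetSub wD) => //=; rewrite mem_index_enum.
apply: (le_trans (measure_bigsetU_le _ mU _)).
by rewrite big1// => z _; have [] := DP _ (valP z).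
Qed.

Lemma discrete_regularW (I : finType) (x : I -> 'rV[R]_d) m delta K K' A0 h :
  0 < K -> K <= K' -> 0 < h -> 0 < A0 ->
  discrete_regular x m delta K A0 h -> discrete_regular x m delta K' A0 h.
Proof.
move=> K0 KK' h0 A00 [m0 mK reg]; split => //; first exact: le_trans KK'.
move=> i t A0t tA0; have /andP[lo up] := reg i t A0t tA0; apply/andP; split.
  apply: le_trans lo; rewrite ler_wpM2r ?powR_ge0// lef_pV2 ?posrE//.
  exact: lt_le_trans KK'.
by apply: (le_trans up); rewrite ler_wpM2r ?powR_ge0.
Qed.

(** Each net point receives mass h^delta. Upper bounds come from packing the disjoint balls of
    radius h / 3, lower bounds from covering the support by balls of radius 2 h. From A0 >= 4 one
    gets 4 h <= t <= 1/4, so t / 2 + 2 h <= t and all radii used stay below 1. *)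
Lemma regular_net (mu : {finite_measure set 'rV[R]_d -> \bar R}) delta C :
  0 < delta -> AD_regular_measure mu delta 0 1 C ->
  exists2 K : R, 1 <= K & forall (h A0 : R) (I : finType) (x : I -> 'rV[R]_d),
    0 < h -> h < 1 -> 4 <= A0 -> is_net (msupport mu) h x ->
    discrete_regular x (fun=> h `^ delta) delta K A0 h.
Proof.
move=> d0 [_ _ C1 reg]; pose M := fine (mu setT).
have M0 : 0 <= M by rewrite fine_ge0.
have MT : mu setT = M%:E by rewrite fineK// fin_num_measure.
have C0 : 0 < C by lra.
have P6 : 1 <= 6 `^ delta :> R.
  have h6 : 1 <= 6 :> R by rewrite ler1n.
  by rewrite /powR gt_eqF// -[leLHS]expR0 ler_expR mulr_ge0 ?ln_ge0 ?(ltW d0).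
have P3 : 0 <= 3 `^ delta :> R by exact: powR_ge0.
have P46 : 4 `^ delta <= 6 `^ delta :> R.
  by apply: ge0_ler_powR; rewrite ?nnegrE ?(ltW d0)//; lra.
have C2 : 1 <= C ^+ 2 by rewrite exprn_ege1.
have K1 : C ^+ 2 * 6 `^ delta <= C ^+ 2 * 6 `^ delta + 3 `^ delta * C * M.
  by rewrite lerDl !mulr_ge0// ltW.
have C6 : 1 <= C ^+ 2 * 6 `^ delta by rewrite mulr_ege1.
(* The first summand serves the local bounds: 6 = 3 * 2 from packing in radius t + h / 3 <= 2 t, and
   it exceeds the 4 = 2 * 2 from the radii t / 2 and 2 h. The second bounds the total mass. *)
exists (C ^+ 2 * 6 `^ delta + 3 `^ delta * C * M); first exact: le_trans K1.
move=> h A0 I x h0 h1 A04 [xX sep cov].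
have hd0 : 0 < h `^ delta by exact: powR_gt0.
set K := _ + _ in K1 *.
have K0 : 0 < K by lra.
have A0i : A0^-1 <= 4^-1 by rewrite lef_pV2 ?posrE//; lra.
have h30 : 0 <= h / 3 by lra.
have h31 : h / 3 <= 1 by lra.
have ballup c r : 0 <= r -> r <= 1 -> (mu (eclosed_ball c r) <= (C * r `^ delta)%:E)%E.
  move=> r0 r1; have [||] // := reg c r _ (eclosed_ball c r); first by rewrite r0.
  by right.
have balllow i r : 0 <= r -> r <= 1 ->
    ((C^-1 * r `^ delta)%:E <= mu (eclosed_ball (x i) r))%E.
  move=> r0 r1; have [||_] // := reg (x i) r _ (eclosed_ball (x i) r); first by rewrite r0.
    by right.
  by apply; exact: xX.
have mB (c : 'rV[R]_d) (r : R) : measurable (eclosed_ball c r) by exact: measurable_eclosed_ball.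
have disj i j : i != j -> eclosed_ball (x i) (h / 3) `&` eclosed_ball (x j) (h / 3) = set0.
  move=> ij; apply/seteqP; split => // z [zi zj].
  have := sep i j ij; rewrite /pdist => sij.
  have := enorm_triangle z (x i) (x j); rewrite (enormB (x i) z).
  by move: zi zj; rewrite /eclosed_ball /=; lra.
have pack (P : pred I) (B : set 'rV[R]_d) (b : R) : measurable B ->
    (forall i, P i -> eclosed_ball (x i) (h / 3) `<=` B) -> (mu B <= b%:E)%E ->
    \sum_(i | P i) h `^ delta <= 3 `^ delta * C * b.
  move=> mBB PB Bb.
  have := sum_measure_disjoint (P := P) mu (fun i => mB (x i) (h / 3)) mBB disj PB.
  move=> /le_trans/(_ Bb).
  have : (\sum_(i | P i) (C^-1 * (h / 3) `^ delta)%:E <=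
      \sum_(i | P i) mu (eclosed_ball (x i) (h / 3)))%E.
    by apply: lee_sum => i _; exact: balllow.
  move=> /le_trans h2 /h2; rewrite sumEFin lee_fin -mulr_sumr => h3.
  have hE : h `^ delta = 3 `^ delta * (h / 3) `^ delta.
    rewrite -powRM//.
    by congr (_ `^ _); rewrite mulrC divfK.
  rewrite hE -mulr_sumr -mulrA ler_wpM2l// -ler_pdivrMl//.
have K2 : C ^+ 2 * 4 `^ delta <= K.
  by apply: le_trans K1; rewrite ler_wpM2l// sqr_ge0.
split => //.
  have := @pack predT setT M measurableT (fun i _ => @subsetT _ _); rewrite MT.
  move=> /(_ (lexx _)) /le_trans; apply.
  by rewrite /K lerDr mulr_ge0 ?sqr_ge0// powR_ge0.
move=> i t A0t tA0.
have h4 : 4 * h <= t by apply: le_trans A0t; rewrite ler_pM2r.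
have t0 : 0 < t by lra.
have t4 : t <= 4^-1 by exact: le_trans A0i.
apply/andP; split; last first.
  have sub i' : pdist x i' i <= t -> eclosed_ball (x i') (h / 3) `<=` eclosed_ball (x i) (t + h / 3).
    move=> ii' z; rewrite /eclosed_ball /= => zi'.
    by have := enorm_triangle (x i') z (x i); move: ii'; rewrite /pdist; lra.
  have th0 : 0 <= t + h / 3 by clear - d t0 h30; lra.
  have th1 : t + h / 3 <= 1 by clear - d t4 h1; lra.
  have th2 : 3 * (t + h / 3) <= 6 * t by clear - d h4 t0; lra.
  apply: (le_trans (pack _ _ _ (mB _ _) sub (ballup _ _ th0 th1))).
  have -> : 3 `^ delta * C * (C * (t + h / 3) `^ delta) =
     C ^+ 2 * (3 `^ delta * (t + h / 3) `^ delta) by ring.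
  apply: (@le_trans _ _ (C ^+ 2 * 6 `^ delta * t `^ delta)); last first.
    by rewrite ler_wpM2r// powR_ge0.
  rewrite -mulrA ler_wpM2l ?sqr_ge0// -!powRM ?(ltW t0)//.
  by apply: ge0_ler_powR; rewrite ?nnegrE ?(ltW d0) ?mulr_ge0 ?(ltW t0).
pose P i' := pdist x i' i <= t.
(* The balls about the net cover the support but perhaps not the whole ball; what they miss is
   compact and disjoint from the support, hence null. *)
have sum2 : (mu (eclosed_ball (x i) (t / 2)) <=
    \sum_(i' | P i') mu (eclosed_ball (x i') (2 * h)))%E.
  pose U := \big[setU/set0]_(i' | P i') eball (x i') (2 * h).
  have oU : open U.
    by rewrite /U -bigcup_seq_cond; apply: bigcup_open => i' _; exact: open_eball.
  have mU : measurable U by exact: open_measurable_rV.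
  have cN : closed (eclosed_ball (x i) (t / 2) `&` ~` U).
    by apply: closedI; [exact: closed_eclosed_ball|exact: open_closedC].
  have mN : measurable (eclosed_ball (x i) (t / 2) `&` ~` U).
    exact: measurable_closed_rV.
  have N0 : mu (eclosed_ball (x i) (t / 2) `&` ~` U) = 0%E.
    have cK : compact (eclosed_ball (x i) (t / 2) `&` ~` U).
      have cB := @compact_eclosed_ball R d (x i) (t / 2).
      exact: (subclosed_compact cN cB (@subIsetl _ _ _)).
    apply: (null_off_support cK mN).
    apply/seteqP; split => // z [[zi nU] zX].
    apply: nU; have [i' zi'] := cov z zX.
    rewrite /U -bigcup_seq_cond; exists i' => //=.
    rewrite mem_index_enum /= /P /pdist.
    have := enorm_triangle z (x i') (x i); rewrite (enormB (x i') z).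
    by move: zi; rewrite /eclosed_ball /=; lra.
  apply: (@le_trans _ _ (mu (U `|` (eclosed_ball (x i) (t / 2) `&` ~` U)))).
    apply: le_measure; rewrite ?inE//; first exact: measurableU.
    by move=> z zi; have [|] := pselect (U z); [left|right].
  apply: (@le_trans _ _ (mu U + mu (eclosed_ball (x i) (t / 2) `&` ~` U))%E).
    exact: measureU2.
  rewrite N0 adde0; apply: (le_trans (measure_bigsetU_le _ _ _)).
    by move=> i'; exact: measurable_eball.
  apply: lee_sum => i' _; apply: le_measure; rewrite ?inE//.
    exact: measurable_eball.
  by move=> z; rewrite /eball /eclosed_ball /= => /ltW.
have : ((C^-1 * (t / 2) `^ delta)%:E <= \sum_(i' | P i') (C * (2 * h) `^ delta)%:E)%E.
  have t20 : 0 <= t / 2 by clear - d t0; lra.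
  have t21 : t / 2 <= 1 by clear - d t4; lra.
  have h20 : 0 <= 2 * h by clear - d h0; lra.
  have h21 : 2 * h <= 1 by clear - d h4 t4; lra.
  apply: (le_trans (balllow i _ t20 t21)).
  by apply: (le_trans sum2); apply: lee_sum => i' _; exact: ballup.
rewrite sumEFin lee_fin -mulr_sumr => low.
apply: (@le_trans _ _ ((C ^+ 2 * 4 `^ delta)^-1 * t `^ delta)).
  rewrite ler_wpM2r ?powR_ge0// lef_pV2 ?posrE// mulr_gt0 ?powR_gt0 ?exprn_gt0//.
have tE : t `^ delta = 2 `^ delta * (t / 2) `^ delta.
  by rewrite -powRM//; [congr (_ `^ _); rewrite mulrC divfK|lra].
have hE : (2 * h) `^ delta = 2 `^ delta * h `^ delta by rewrite powRM// ltW.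
have fE : 4 `^ delta = 2 `^ delta * 2 `^ delta :> R.
  by rewrite -powRM//; congr (_ `^ _); ring.
have p2 : 0 < 2 `^ delta :> R by exact: powR_gt0.
move: low; rewrite hE -mulr_sumr tE fE; set S := \sum_(_ | _) _ => low.
have -> : (C ^+ 2 * (2 `^ delta * 2 `^ delta))^-1 * (2 `^ delta * (t / 2) `^ delta)
   = C^-1 * (t / 2) `^ delta / (C * 2 `^ delta).
  by field; rewrite !gt_eqF.
by rewrite ler_pdivrMr ?mulr_gt0// [leRHS]mulrC -mulrA.
Qed.

(** Nonorthogonality is used at half the radii, giving cN rX rY / 4, and the four points are then
    moved to the nets by less than 2 h. As 128 h <= cN r for both radii, the errors 4 h rY and 8 h
    rX take away at most 3/32 of cN rX rY, leaving more than 1/8. *)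
Lemma nonorthogonal_net (X Y : set 'rV[R]_d) (cN : R) : 0 < cN -> cN <= 1 ->
  nonorthogonal (fun x y => - dot x y) X Y cN ->
  forall h (I J : finType) (x : I -> 'rV[R]_d) (y : J -> 'rV[R]_d), 0 < h ->
  is_net X h x -> is_net Y h y ->
  discrete_nonorthogonal x y (cN / 8) (128 / cN) h.
Proof.
move=> c0 c1 non h I J x y h0 [xX _ covX] [yY _ covY] i j rX rY.
rewrite invf_div => X1 X2 Y1 Y2.
have hX : 128 * h <= cN * rX.
  by move: X1; rewrite mulrAC ler_pdivrMr// [rX * _]mulrC.
have hY : 128 * h <= cN * rY.
  by move: Y1; rewrite mulrAC ler_pdivrMr// [rY * _]mulrC.
have rX0 : 0 < rX by rewrite -(pmulr_rgt0 _ c0); lra.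
have rY0 : 0 < rY by rewrite -(pmulr_rgt0 _ c0); lra.
have cX : cN * rX <= rX by rewrite ler_piMl// ltW.
have cY : cN * rY <= rY by rewrite ler_piMl// ltW.
have [] := non (x i) (y j) (rX / 2) (rY / 2) (xX i) (yY j).
- by apply/andP; split; lra.
- by apply/andP; split; lra.
move=> x1 [x2 [y1 [y2 [[Xx1 x1i] [Xx2 x2i] [Yy1 y1j] [Yy2 y2j]]]]].
rewrite /eball /= in x1i x2i y1j y2j.
have [i1 i1P] := covX _ Xx1; have [i2 i2P] := covX _ Xx2.
have [j1 j1P] := covY _ Yy1; have [j2 j2P] := covY _ Yy2.
have -> : - dot x1 y1 - - dot x2 y1 - - dot x1 y2 + - dot x2 y2 =
  - dot (x1 - x2) (y1 - y2) by rewrite dotBl !dotBr; ring.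
rewrite normrN => hD.
have near (u v w : 'rV[R]_d) (r : R) : 4 * h <= r -> enorm (u - v) < r / 2 ->
    enorm (u - w) < 2 * h -> enorm (w - v) <= r.
  by move=> hr uv uw; have := enorm_triangle u w v; rewrite (enormB w u); lra.
exists i1, i2, j1, j2; split.
- by apply: near i1P; [lra|exact: x1i].
- by apply: near i2P; [lra|exact: x2i].
- by apply: near j1P; [lra|exact: y1j].
- by apply: near j2P; [lra|exact: y2j].
set u := x1 - x2 in hD; set v := y1 - y2 in hD.
set u' := x i1 - x i2; set v' := y j1 - y j2.
have close (a b a' b' : 'rV[R]_d) : enorm (a - a') < 2 * h -> enorm (b - b') < 2 * h ->
    enorm ((a - b) - (a' - b')) <= 4 * h.
  move=> aa bb; have -> : (a - b) - (a' - b') = (a - a') - (b - b').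
    by rewrite !opprB addrACA [RHS]addrACA (addrC (- b)).
  by apply: (le_trans (ler_enormD _ _)); rewrite enormN; lra.
have uu : enorm (u - u') <= 4 * h by exact: close.
have vv : enorm (v - v') <= 4 * h by exact: close.
have vB : enorm v <= rY.
  have := enorm_triangle (y j) y1 y2; rewrite (enormB (y j) y2) /v; lra.
have uB : enorm u' <= 2 * rX.
  have := enorm_triangle u u' 0; rewrite !subr0 (enormB u' u).
  have := enorm_triangle (x i) x1 x2; rewrite (enormB (x i) x2) -/u; lra.
have E : dot u v = dot u' v' + (dot (u - u') v + dot u' (v - v')).
  by rewrite dotBl dotBr; ring.
have e1 : `|dot (u - u') v| <= 4 * h * rY.
  by apply: (le_trans (dot_le _ _)); apply: ler_pM => //; exact: enorm_ge0.
have e2 : `|dot u' (v - v')| <= 2 * rX * (4 * h).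
  by apply: (le_trans (dot_le _ _)); apply: ler_pM => //; exact: enorm_ge0.
have n1 := ler_normD (dot u' v') (dot (u - u') v + dot u' (v - v')).
have n2 := ler_normD (dot (u - u') v) (dot u' (v - v')).
move: hD; rewrite E => hD.
have hXY : 128 * h * rY <= cN * rX * rY by rewrite ler_pM2r.
have hYX : 128 * h * rX <= cN * rY * rX by rewrite ler_pM2r.
have p : 0 < cN * rX * rY by rewrite !mulr_gt0.
lra.
Qed.

End nets_of_regular_sets.

(** * Translation invariance of Lebesgue measure *)

Section translations.
Context (R : realType).

Lemma measurable_shift (w : R) : measurable_fun setT (fun a : R => a + w).
Proof. exact: measurable_funD. Qed.

Lemma lebesgue_measure_shift (w : R) (A : set R) : measurable A ->
  @lebesgue_measure R ((fun a => a + w) @^-1` A) = lebesgue_measure A.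
Proof.
move=> mA.
have mw : measurable_fun setT (fun a : measurableTypeR R => (a + w : measurableTypeR R)).
  exact: measurable_shift.
pose nu : {measure set (measurableTypeR R) -> \bar R} :=
  measure_function_pushforward__canonical__measure_function_Measure
    (@lebesgue_measure R) mw.
apply/esym; apply: (lebesgue_measure_unique (mu := nu)) => // _ [[a b] _ <-] /=.
rewrite /pushforward.
have -> : (fun x : R => x + w) @^-1` `]a, b] = `]a - w, b - w]%classic.
  by apply/seteqP; split => x /=; rewrite !in_itv /= ltrBlDr lerBrDr.
rewrite !lebesgue_measure_itv /= !lte_fin ltrD2r; case: ifP => // _.
by rewrite -!EFinB; congr (_%:E); ring.
Qed.

Lemma measurable_shift_rV n (w : 'rV[R]_n) : measurable_fun setT (fun v : 'rV[R]_n => v + w).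
Proof.
apply: measurable_fun_rV => j.
rewrite (_ : (fun _ => _) = fun v : 'rV[R]_n => v ord0 j + w ord0 j); last first.
  by apply/funext => v; rewrite mxE.
by apply: measurable_funD => //; exact: coord_measurable_rV.
Qed.

Lemma lebesgue_rV_shift n (w : 'rV[R]_n) (A : set 'rV[R]_n) : measurable A ->
  lebesgue_rV R n ((fun v => v + w) @^-1` A) = lebesgue_rV R n A.
Proof.
elim: n w A => [|n IH] w A mA.
  rewrite /= !diracE; congr ((_ : bool)%:R%:E).
  by apply/idP/idP; rewrite !inE /= (_ : 0 + w = 0) //; apply/rowP => -[].
have mcons : measurable (@cons_rV R n @^-1` A).
  by rewrite -[X in measurable X]setTI; exact: measurable_cons_rV.
rewrite /= /lebesgue_rV_step /pushforward /product_measure1.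
pose w' : 'rV[R]_n := \row_j w ord0 (lift ord0 j).
have consD a v : cons_rV (a, v) + w = cons_rV (a + w ord0 ord0, v + w').
  apply/rowP => j; rewrite !mxE /=; case: unliftP => [k ->|->] /=; by rewrite ?mxE.
pose g a := lebesgue_rV R n (xsection (@cons_rV R n @^-1` A) a).
have mg : measurable_fun setT g by exact: measurable_fun_xsection.
transitivity (\int[@lebesgue_measure R]_a g (a + w ord0 ord0)%R)%E.
  apply: eq_integral => a _ /=.
  rewrite /g -(IH w'); last exact: measurable_xsection.
  congr (lebesgue_rV R n _); apply/seteqP; split => v;
    by rewrite /xsection /= !inE /= consD.
rewrite -(@ge0_integral_pushforward _ _ (measurableTypeR R) (measurableTypeR R) R
   (fun a : R => a + w ord0 ord0)
   (measurable_shift _) (@lebesgue_measure R) setT g) //.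
apply: eq_measure_integral; first exact: measurable_shift.
by move=> ? B mB _; exact: lebesgue_measure_shift.
Qed.

Lemma integral_lebesgue_rV_shift n (w : 'rV[R]_n) (f : 'rV[R]_n -> \bar R) :
  measurable_fun setT f -> (forall v, 0 <= f v)%E ->
  (\int[lebesgue_rV R n]_v f (v + w)%R = \int[lebesgue_rV R n]_v f v)%E.
Proof.
move=> mf f0.
rewrite -(@ge0_integral_pushforward _ _ _ _ R (fun v : 'rV[R]_n => (v + w : 'rV[R]_n))
   (measurable_shift_rV w) (lebesgue_rV R n) setT f) //.
apply: eq_measure_integral; first exact: measurable_shift_rV.
by move=> ? B mB _; exact: lebesgue_rV_shift.
Qed.

Lemma lebesgue_rV_eball n r : 0 <= r ->
  (lebesgue_rV R n (eball 0 r) <= ((2 * r) ^+ n)%:E)%E.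
Proof.
move=> r0.
have -> : ((2 * r) ^+ n)%:E =
    lebesgue_rV R n [set v | forall j, `[- r, r]%classic (v ord0 j)].
  rewrite (@lebesgue_rV_box R n (fun=> `[- r, r]%classic))//.
  have -> : @lebesgue_measure R `[- r, r]%classic = (2 * r)%:E.
    rewrite lebesgue_measure_itv /= lte_fin; case: ifPn => [_|].
      by rewrite -EFinB; congr (_%:E); ring.
    by rewrite -leNgt => ?; congr (_%:E); lra.
  by rewrite prodEFin prodr_const card_ord.
have mBox : measurable [set v : 'rV[R]_n | forall j, `[- r, r]%classic (v ord0 j)].
  apply: measurable_closed_rV.
  have -> : [set v : 'rV[R]_n | forall j, `[- r, r]%classic (v ord0 j)] =
      \bigcap_(j in [set: 'I_n]) ((fun v : 'rV[R]_n => v ord0 j) @^-1` `[- r, r]).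
    by apply/seteqP; split => v /= h j; [move=> _|]; exact: h.
  apply: closed_bigI => j _; apply: preimage_closed; last exact: interval_closed.
  by move=> v _; exact: coord_continuous.
have mBall : measurable (eball (0 : 'rV[R]_n) r) by exact: measurable_eball.
apply: le_measure; [exact: mem_set|exact: mem_set|].
move=> v; rewrite /eball /= subr0 => vr j /=.
by rewrite in_itv /= -ler_norml (le_trans (coord_le_enorm _ _))// ltW.
Qed.

End translations.

Section thickened_nets.
Context (R : realType) (d : nat).
Local Notation lambda := (lebesgue_rV R d).

Lemma open_thicken (X : set 'rV[R]_d) h : open (thicken X h).
Proof.
rewrite (_ : thicken X h = \bigcup_(x in X) eball x h).
  by apply: bigcup_open => x _; exact: open_eball.
apply/seteqP; split => [z [x Xx [b]]|z [x Xx]].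
  by rewrite /eball /= subr0 => bh <-; exists x => //; rewrite /eball /= addrAC subrr add0r.
rewrite /eball /= => zx; exists x => //; exists (z - x); first by rewrite /eball /= subr0.
by rewrite addrC subrK.
Qed.

Lemma measurable_thicken (X : set 'rV[R]_d) h : measurable (thicken X h).
Proof. by apply: open_measurable_rV; exact: open_thicken. Qed.

(** The thickened set lies in the balls of radius 2 h + h about the net points. Moving each ball to
    the origin turns the integral into an average over [b] of sums over the translated net, so a
    bound on such sums, uniform in [b], is enough. *)
Lemma integral_thicken_le (X : set 'rV[R]_d) (h S : R) (I : finType)
    (x : I -> 'rV[R]_d) (f : 'rV[R]_d -> \bar R) :
  0 < h -> 0 <= S -> is_net X h x ->
  measurable_fun setT f -> (forall z, 0 <= f z)%E ->
  (forall b, \sum_i f (x i + b)%R <= S%:E)%E ->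
  (\int[lambda]_(z in thicken X h) f z <= (S * (6 * h) ^+ d)%:E)%E.
Proof.
move=> h0 S0 [_ _ cov] mf f0 fS.
pose B := eball (0 : 'rV[R]_d) (3 * h).
have mB : measurable B by exact: measurable_eball.
pose g i := (f \o (fun b => b + x i)) \_ B.
have mfs i : measurable_fun setT (f \o (fun b => b + x i)).
  by apply: measurableT_comp => //; exact: measurable_shift_rV.
have mg i : measurable_fun setT (g i).
  by apply/(measurable_restrictT _ mB); exact: measurable_funTS.
have g0 i z : (0 <= g i z)%E.
  by rewrite /g patchE; case: ifP => // _; exact: f0.
have mgs i : measurable_fun setT (fun z : 'rV[R]_d => g i (z - x i)).
  by apply: measurableT_comp => //; exact: measurable_shift_rV.
apply: (@le_trans _ _ (\int[lambda]_z \sum_i g i (z - x i)%R))%E.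
  rewrite integral_mkcond; apply: ge0_le_integral => //.
  - by move=> z _; rewrite patchE; case: ifP.
  - apply/(measurable_restrictT _ (measurable_thicken X h)).
    exact: measurable_funTS.
  - by apply: emeasurable_sum => i; exact: mgs.
  move=> z _; rewrite patchE; case: ifPn => [|_]; last exact: sume_ge0.
  rewrite inE => -[w Xw [b bh <-]].
  have [i wi] := cov w Xw.
  rewrite (bigD1 i)//= /g patchE /= subrK ifT.
    by rewrite leeDl//; apply: sume_ge0 => j _; exact: (g0 j).
  rewrite inE /B /eball /= subr0.
  have -> : w + b - x i = (w - x i) + b by rewrite addrAC.
  by apply: (le_lt_trans (ler_enormD _ _)); move: bh; rewrite /eball /= subr0; lra.
rewrite ge0_integral_sum//.
under eq_bigr do rewrite (integral_lebesgue_rV_shift (- x _) (mg _) (g0 _)).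
rewrite -ge0_integral_sum//.
apply: (@le_trans _ _ (\int[lambda]_(z in B) S%:E))%E.
  rewrite [leRHS]integral_mkcond; apply: ge0_le_integral => //.
  - by move=> z _; exact: sume_ge0.
  - by apply: emeasurable_sum.
  - by apply/(measurable_restrictT _ mB); exact: measurable_cst.
  move=> z _; rewrite patchE; case: ifPn => zB.
    apply: le_trans (fS z); apply: lee_sum => i _.
    by rewrite /g patchE zB /= addrC.
  by rewrite big1// => i _; rewrite /g patchE (negbTE zB).
rewrite integral_cst// EFinM; apply: lee_wpmul2l; first by rewrite lee_fin.
have h3 : 0 <= 3 * h by rewrite mulr_ge0// ltW.
have := lebesgue_rV_eball d h3.
by have -> : 2 * (3 * h) = 6 * h by ring.
Qed.

End thickened_nets.

(** * Schur's test *)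

Section trigonometric_schur.
Context (dp : measure_display) (T : measurableType dp) (R : realType).
Variable m : {sigma_finite_measure set T -> \bar R}.

Lemma Rintegral_sum (I : finType) (F : I -> T -> R) :
  (forall i, m.-integrable setT (EFin \o F i)) ->
  \int[m]_y (\sum_i F i y) = \sum_i \int[m]_y F i y.
Proof.
move=> iF; elim: (index_enum I) => [|i s IH].
  rewrite big_nil; under eq_Rintegral do rewrite big_nil.
  by rewrite /Rintegral integral0.
rewrite big_cons -IH -RintegralD//.
  by apply: eq_Rintegral => y _; rewrite big_cons.
rewrite (_ : EFin \o _ = fun y => (\sum_(i <- s) (F i y)%:E)%E).
  by apply: integrable_sum => // j _; exact: iF.
by apply/funext => y; rewrite /= sumEFin.
Qed.

Lemma integrable_bounded_mul (f A : T -> R) (M : R) :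
  measurable_fun setT f -> (forall y, `|f y| <= M) ->
  m.-integrable setT (EFin \o A) -> m.-integrable setT (EFin \o (fun y => f y * A y)).
Proof.
move=> mf fM iA.
have M0 : forall y : T, 0 <= M by move=> y; exact: le_trans (fM y).
apply: (@le_integrable _ _ _ m setT measurableT _ (fun y => M%:E * (A y)%:E)%E).
- apply/measurable_EFinP; apply: measurable_funM => //.
  by apply/measurable_EFinP; case/integrableP: iA.
- move=> y _ /=; rewrite lee_fin !normrM ler_wpM2r// (le_trans (fM y))//.
  exact: ler_norm.
- exact: integrableZl.
Qed.

Variables (I : finType) (th : I -> T -> R) (A : T -> R) (kap : T * T -> R).
Hypothesis mth : forall i, measurable_fun setT (th i).
Hypothesis iA : m.-integrable setT (EFin \o A).
Hypothesis mkap : measurable_fun setT kap.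
Hypothesis kap_bound : forall y y',
  `|\sum_i cos (th i y' - th i y)| <= kap (y, y').

Let ct i := \int[m]_y (cos (th i y) * A y).
Let st i := \int[m]_y (sin (th i y) * A y).

Let mcos i : measurable_fun setT (fun y => cos (th i y)).
Proof.
apply: measurableT_comp => //; apply: continuous_measurable_fun.
exact: continuous_cos.
Qed.

Let msin i : measurable_fun setT (fun y => sin (th i y)).
Proof.
apply: measurableT_comp => //; apply: continuous_measurable_fun.
exact: continuous_sin.
Qed.

Let icos i : m.-integrable setT (EFin \o (fun y => cos (th i y) * A y)).
Proof. exact: (integrable_bounded_mul (mcos i) (fun y => cos_max _)). Qed.

Let isin i : m.-integrable setT (EFin \o (fun y => sin (th i y) * A y)).
Proof. exact: (integrable_bounded_mul (msin i) (fun y => sin_max _)). Qed.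

Let kap0 z : 0 <= kap z.
Proof. by case: z => y y'; exact: le_trans (kap_bound y y'). Qed.

Let mA : measurable_fun setT A.
Proof. by apply/measurable_EFinP; case/integrableP: iA. Qed.

Lemma linear_combination_trig (a b : I -> R) :
  \sum_i (a i * ct i + b i * st i) =
  \int[m]_y ((\sum_i (a i * cos (th i y) + b i * sin (th i y))) * A y).
Proof.
transitivity (\sum_i \int[m]_y (a i * (cos (th i y) * A y) + b i * (sin (th i y) * A y))).
  apply: eq_bigr => i _; rewrite RintegralD//.
  - by rewrite !RintegralZl.
  - by apply: (integrableZl measurableT (a i) (icos i)).
  - by apply: (integrableZl measurableT (b i) (isin i)).
rewrite -Rintegral_sum; last first.
  move=> i; rewrite (_ : EFin \o _ = ((fun y => (a i)%:E * (cos (th i y) * A y)%:E) \+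
     (fun y => (b i)%:E * (sin (th i y) * A y)%:E))%E)//.
  apply: integrableD => //.
  - exact: (integrableZl measurableT (a i) (icos i)).
  - exact: (integrableZl measurableT (b i) (isin i)).
apply: eq_Rintegral => y _; rewrite mulr_suml; apply: eq_bigr => i _; ring.
Qed.

(** The T*T argument in real form: the sum of squares is the integral of H A, where H is the
    trigonometric sum with coefficients [ct], [st]; expanding these coefficients shows that H is A
    integrated against the kernel sum_i cos(th_i y' - th_i y). *)
Lemma sum_sqr_trig_le :
  ((\sum_i (ct i ^+ 2 + st i ^+ 2))%:E <=
   \int[m]_y \int[m]_y' (`|A y| * (`|A y'| * kap (y, y')))%:E)%E.
Proof.
pose H y := \sum_i (ct i * cos (th i y) + st i * sin (th i y)).
have mH : measurable_fun setT H.
  by apply: measurable_sum => i; apply: measurable_funD; apply: measurable_funM.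
have Hbound y : `|H y| <= \sum_i (`|ct i| + `|st i|).
  apply: (le_trans (ler_norm_sum _ _ _)); apply: ler_sum => i _.
  apply: (le_trans (ler_normD _ _)); rewrite !normrM.
  by apply: lerD; rewrite ler_piMr// ?cos_max ?sin_max.
have iHA := integrable_bounded_mul mH Hbound iA.
have -> : \sum_i (ct i ^+ 2 + st i ^+ 2) = \int[m]_y (H y * A y).
  by rewrite -linear_combination_trig; apply: eq_bigr => i _; rewrite !expr2.
have mAA : measurable_fun setT (fun z : T * T => `|A z.1| * (`|A z.2| * kap z)).
  apply: measurable_funM.
    by apply: measurableT_comp => //; apply: measurableT_comp => //; exact: measurable_fst.
  apply: measurable_funM => //.
  by apply: measurableT_comp => //; apply: measurableT_comp => //; exact: measurable_snd.
have mAAE : measurable_fun setT (fun z : T * T => (`|A z.1| * (`|A z.2| * kap z))%:E).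
  exact/measurable_EFinP.
have AA0 z : (0 <= (`|A z.1| * (`|A z.2| * kap z))%:E)%E.
  by rewrite lee_fin !mulr_ge0.
have mAk y : measurable_fun setT (fun y' => `|A y'| * kap (y, y')).
  apply: measurable_funM; first exact: measurableT_comp.
  apply: (measurableT_comp mkap); exact: measurable_pair1.
have HE y : (`|H y|%:E <= \int[m]_y' (`|A y'| * kap (y, y'))%:E)%E.
  have -> : H y = \int[m]_y' ((\sum_i (cos (th i y) * cos (th i y') + sin (th i y) * sin (th i y'))) * A y').
    rewrite -linear_combination_trig; apply: eq_bigr => i _.
    by rewrite (mulrC (ct i)) (mulrC (st i)).
  have mS : measurable_fun setT (fun y' => \sum_i (cos (th i y) * cos (th i y') + sin (th i y) * sin (th i y'))).
    by apply: measurable_sum => i; apply: measurable_funD; apply: measurable_funM.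
  have SE y' : \sum_i (cos (th i y) * cos (th i y') + sin (th i y) * sin (th i y')) =
      \sum_i cos (th i y' - th i y).
    by apply: eq_bigr => i _; rewrite cosB [in RHS]mulrC [X in _ = _ + X]mulrC.
  have iS : m.-integrable setT (EFin \o (fun y' => (\sum_i (cos (th i y) * cos (th i y') + sin (th i y) * sin (th i y'))) * A y')).
    apply: (integrable_bounded_mul (M := \sum_(i in I) 1)) => // y'.
    rewrite SE; apply: (le_trans (ler_norm_sum _ _ _)); apply: ler_sum => i _.
    exact: cos_max.
  rewrite EFin_normr_Rintegral//.
  apply: (le_trans (le_abse_integral _ _ _)) => //; first by case/integrableP: iS.
  apply: ge0_le_integral => //.
  - by apply: measurableT_comp => //; case/integrableP: iS.
  - exact/measurable_EFinP.
  - move=> y' _ /=; rewrite lee_fin normrM mulrC ler_wpM2l//.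
    by rewrite SE.
apply: (@le_trans _ _ (\int[m]_y `|H y * A y|%:E)%E).
  have /le_trans : ((\int[m]_y (H y * A y))%:E <= `|\int[m]_y (H y * A y)|%:E)%E.
    by rewrite lee_fin ler_norm.
  apply; rewrite EFin_normr_Rintegral//.
  by apply: (le_trans (le_abse_integral _ _ _)) => //; case/integrableP: iHA.
apply: ge0_le_integral => //.
- by apply/measurable_EFinP; apply: measurableT_comp => //; exact: measurable_funM.
- exact: (measurable_fun_fubini_tonelli_F _ mAAE AA0).
move=> y _; under eq_integral do rewrite EFinM.
rewrite ge0_integralZl//; first last.
- by move=> y' _; rewrite lee_fin mulr_ge0.
- exact/measurable_EFinP.
by rewrite normrM mulrC EFinM lee_wpmul2l// lee_fin.
Qed.

Lemma schur_le (D : set T) (S : R) : measurable D ->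
  0 <= S -> (forall y, ~ D y -> A y = 0) -> (forall y y', kap (y, y') = kap (y', y)) ->
  (forall y, \int[m]_(y' in D) (kap (y, y'))%:E <= S%:E)%E ->
  (\int[m]_y \int[m]_y' (`|A y| * (`|A y'| * kap (y, y')))%:E <=
   S%:E * \int[m]_y (A y ^+ 2)%:E)%E.
Proof.
move=> mD S0 A0 kapC kS.
(* AM-GM bounds |A y| |A y'| kap by the mean of [F] and its transpose [G], whose double integrals
   agree by Tonelli. The cutoff to [D] may be inserted because A vanishes off D. *)
pose F (z : T * T) := A z.1 ^+ 2 * (\1_D z.2 * kap z).
have mA2 : measurable_fun setT (fun y => A y ^+ 2) by exact: measurable_funX.
have m1D : measurable_fun setT (\1_D : T -> R) by exact: measurable_indic.
have mF : measurable_fun setT F.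
  apply: measurable_funM.
    by apply: (measurableT_comp mA2); exact: measurable_fst.
  apply: measurable_funM => //.
  by apply: (measurableT_comp m1D); exact: measurable_snd.
have ind0 y : 0 <= \1_D y :> R by rewrite indicE ler0n.
have F0 z : 0 <= F z by rewrite /F mulr_ge0 ?sqr_ge0// mulr_ge0.
pose G (z : T * T) := F (z.2, z.1).
have mG : measurable_fun setT G.
  by apply: (measurableT_comp mF); apply: measurable_fun_pair; [exact: measurable_snd|exact: measurable_fst].
have G0 z : 0 <= G z by exact: F0.
have mAA : measurable_fun setT (fun z : T * T => `|A z.1| * (`|A z.2| * kap z)).
  apply: measurable_funM.
    by apply: measurableT_comp => //; apply: measurableT_comp => //; exact: measurable_fst.
  apply: measurable_funM => //.
  by apply: measurableT_comp => //; apply: measurableT_comp => //; exact: measurable_snd.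
have mFE : measurable_fun setT (EFin \o F) by exact/measurable_EFinP.
have mGE : measurable_fun setT (EFin \o G) by exact/measurable_EFinP.
have F0E z : (0 <= (EFin \o F) z)%E by rewrite lee_fin.
have G0E z : (0 <= (EFin \o G) z)%E by rewrite lee_fin.
have mFG : measurable_fun setT (fun z => 2^-1 * (F z + G z)).
  by apply: measurable_funM => //; exact: measurable_funD.
have FG0 z : (0 <= (2^-1 * (F z + G z))%:E)%E by rewrite lee_fin mulr_ge0// addr_ge0.
have pt y y' : `|A y| * (`|A y'| * kap (y, y')) <= 2^-1 * (F (y, y') + G (y, y')).
  have [Dy|Dy] := pselect (D y); last first.
    by rewrite (A0 y Dy) normr0 mul0r mulr_ge0// addr_ge0.
  have [Dy'|Dy'] := pselect (D y'); last first.
    by rewrite (A0 y' Dy') normr0 mul0r mulr0 mulr_ge0// addr_ge0.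
  rewrite /G /F /= -(kapC y y').
  rewrite !indicE !mem_set// !mul1r.
  rewrite -(real_normK (num_real (A y))) -(real_normK (num_real (A y'))).
  have := kap0 (y, y'); have := sqr_ge0 (`|A y| - `|A y'|).
  rewrite sqrrB => h1 h2; have := mulr_ge0 h1 h2; lra.
have intF : (\int[m]_y \int[m]_y' (F (y, y'))%:E <= S%:E * \int[m]_y (A y ^+ 2)%:E)%E.
  have inner y : (\int[m]_y' (F (y, y'))%:E =
      (A y ^+ 2)%:E * \int[m]_(y' in D) (kap (y, y'))%:E)%E.
    rewrite /F /=; under eq_integral do rewrite EFinM.
    have mk : measurable_fun setT (fun y' => \1_D y' * kap (y, y')).
      apply: measurable_funM => //.
      by apply: (measurableT_comp mkap); exact: measurable_pair1.
    rewrite ge0_integralZl//; last 3 first.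
    - exact/measurable_EFinP.
    - by move=> y' _; rewrite lee_fin mulr_ge0.
    - by rewrite lee_fin sqr_ge0.
    congr (_ * _)%E; rewrite [RHS]integral_mkcond; apply: eq_integral => y' _.
    rewrite patchE indicE; case: ifPn => _; by rewrite ?mul1r ?mul0r.
  have mA2E : measurable_fun setT (fun y => (A y ^+ 2)%:E) by exact/measurable_EFinP.
  have A20 y : setT y -> (0 <= (A y ^+ 2)%:E)%E by rewrite lee_fin sqr_ge0.
  have S0E : (0 <= S%:E)%E by rewrite lee_fin.
  rewrite -(ge0_integralZl m measurableT mA2E A20 S0E).
  apply: ge0_le_integral => //.
  - by move=> y _; apply: integral_ge0 => y' _; rewrite lee_fin.
  - exact: (measurable_fun_fubini_tonelli_F _ mFE F0E).
  - by apply/measurable_EFinP; apply: measurable_funM.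
  move=> y _; rewrite inner muleC; apply: lee_wpmul2r; last exact: kS.
  by rewrite lee_fin sqr_ge0.
have intG : (\int[m]_y \int[m]_y' (G (y, y'))%:E = \int[m]_y \int[m]_y' (F (y, y'))%:E)%E.
  exact: (@fubini_tonelli _ _ _ _ _ m m (EFin \o G) mGE G0E).
apply: (@le_trans _ _ (\int[m]_y \int[m]_y' (2^-1 * (F (y, y') + G (y, y')))%:E)%E).
  apply: ge0_le_integral => //.
  - by move=> y _; apply: integral_ge0 => y' _; rewrite lee_fin !mulr_ge0.
  - apply: (measurable_fun_fubini_tonelli_F (m2 := m) (fun z => (`|A z.1| * (`|A z.2| * kap z))%:E)).
      exact/measurable_EFinP.
    by move=> z; rewrite lee_fin !mulr_ge0.
  - apply: (measurable_fun_fubini_tonelli_F (m2 := m) (fun z => (2^-1 * (F z + G z))%:E)) => //.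
    exact/measurable_EFinP.
  move=> y _; apply: ge0_le_integral => //.
  - by move=> y' _; rewrite lee_fin !mulr_ge0.
  - by apply/measurable_EFinP; exact: (measurableT_comp mAA (measurable_pair1 y)).
  - by apply/measurable_EFinP; exact: (measurableT_comp mFG (measurable_pair1 y)).
  by move=> y' _; rewrite lee_fin.
have -> : (\int[m]_y \int[m]_y' (2^-1 * (F (y, y') + G (y, y')))%:E =
    2^-1%:E * (\int[m]_y \int[m]_y' (F (y, y'))%:E + \int[m]_y \int[m]_y' (G (y, y'))%:E))%E.
  have mIF := measurable_fun_fubini_tonelli_F (m2 := m) _ mFE F0E.
  have mIG := measurable_fun_fubini_tonelli_F (m2 := m) _ mGE G0E.
  have IF0 y : setT y -> (0 <= fubini_F m (EFin \o F) y)%E.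
    by move=> _; apply: integral_ge0.
  have IG0 y : setT y -> (0 <= fubini_F m (EFin \o G) y)%E.
    by move=> _; apply: integral_ge0.
  rewrite -(ge0_integralD m measurableT IF0 mIF IG0 mIG).
  have h0 : (0 <= 2^-1%:E :> \bar R)%E by rewrite lee_fin.
  have IFG0 y : setT y -> (0 <= fubini_F m (EFin \o F) y + fubini_F m (EFin \o G) y)%E.
    by move=> _; apply: adde_ge0; [exact: IF0|exact: IG0].
  rewrite -(ge0_integralZl m measurableT (emeasurable_funD mIF mIG) IFG0 h0).
  apply: eq_integral => y _.
  have mFy : measurable_fun setT (fun y' => (F (y, y'))%:E).
    by apply/measurable_EFinP; apply: (measurableT_comp mF); exact: measurable_pair1.
  have mGy : measurable_fun setT (fun y' => (G (y, y'))%:E).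
    by apply/measurable_EFinP; apply: (measurableT_comp mG); exact: measurable_pair1.
  have F0y y' : setT y' -> (0 <= (F (y, y'))%:E)%E by rewrite lee_fin.
  have G0y y' : setT y' -> (0 <= (G (y, y'))%:E)%E by rewrite lee_fin.
  rewrite /fubini_F /= -(ge0_integralD m measurableT F0y mFy G0y mGy).
  have FG0y y' : setT y' -> (0 <= (F (y, y'))%:E + (G (y, y'))%:E)%E.
    by move=> _; rewrite adde_ge0 ?F0y ?G0y.
  by rewrite -(ge0_integralZl m measurableT (emeasurable_funD mFy mGy) FG0y h0).
rewrite intG.
apply: (@le_trans _ _ (2^-1%:E * (S%:E * \int[m]_y (A y ^+ 2)%:E + S%:E * \int[m]_y (A y ^+ 2)%:E))%E).
  by apply: lee_wpmul2l; [rewrite lee_fin|exact: leeD].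
rewrite -mule2n -mule_natl muleA -EFinM mulVf// mul1e//.
Qed.

End trigonometric_schur.

Section parametric_integral.
Context (d1 d2 : measure_display) (T1 : measurableType d1) (T2 : measurableType d2).
Context (R : realType) (m2 : {sigma_finite_measure set T2 -> \bar R}).

Lemma measurable_parametric_Rintegral (F : T1 * T2 -> R) :
  measurable_fun setT F -> measurable_fun setT (fun x => \int[m2]_y F (x, y)).
Proof.
move=> mF; apply: measurableT_comp => //.
have mFE : measurable_fun setT (EFin \o F) by exact/measurable_EFinP.
rewrite (_ : (fun x => _) = (fun x => \int[m2]_y ((EFin \o F)^\+ (x, y)) -
    \int[m2]_y ((EFin \o F)^\- (x, y))))%E; last first.
  apply/funext => x; rewrite [LHS]integralE.
  by congr (_ - _)%E; apply: eq_integral => y _; rewrite ?funeposE ?funenegE.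
apply: emeasurable_funB.
- apply: (measurable_fun_fubini_tonelli_F (m2 := m2) _ (measurable_funepos mFE)).
  exact: funepos_ge0.
- apply: (measurable_fun_fubini_tonelli_F (m2 := m2) _ (measurable_funeneg mFE)).
  exact: funeneg_ge0.
Qed.

End parametric_integral.

Section L2_norms.
Context (R : realType) (d : nat).
Implicit Types f : 'rV[R]_d -> R[i].
Local Notation lambda := (lebesgue_rV R d).

Lemma L2norm_poweR f : (L2norm f `^ 2 = \int[lambda]_x (normc (f x) ^+ 2)%:E)%E.
Proof.
rewrite /L2norm poweR_Lnorm//; apply: eq_integral => x _.
by rewrite /= ger0_norm ?normc_ge0// powR_mulrn// normc_ge0.
Qed.

Lemma integral_le1_of_L2norm f : (L2norm f <= 1)%E ->
  (\int[lambda]_x (normc (f x) ^+ 2)%:E <= 1)%E.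
Proof.
move=> f1; rewrite -L2norm_poweR -[leRHS](poweR1r 2).
by apply: gt0_ler_poweR => //; rewrite in_itv /= ?Lnorm_ge0 ?leey// lee01.
Qed.

Lemma L2norm_le f (B : R) : 0 <= B ->
  (\int[lambda]_x (normc (f x) ^+ 2)%:E <= B%:E)%E -> (L2norm f <= (B `^ 2^-1)%:E)%E.
Proof.
move=> B0 fB; have -> : L2norm f = ((L2norm f `^ 2) `^ 2^-1)%E.
  by rewrite -poweRrM mulfV// poweRe1// Lnorm_ge0.
rewrite L2norm_poweR -poweR_EFin.
apply: gt0_ler_poweR => //; rewrite in_itv /= leey andbT ?lee_fin//.
by apply: integral_ge0 => x _; rewrite lee_fin sqr_ge0.
Qed.

End L2_norms.

(** * The kernel of T*T on nets *)

Section amplitudes.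
Context (R : realType) (d : nat).
Local Notation lambda := (lebesgue_rV R d).

Lemma measurable_dot (dT : measure_display) (T' : measurableType dT)
    (f g : T' -> 'rV[R]_d) :
  measurable_fun setT f -> measurable_fun setT g ->
  measurable_fun setT (fun t => dot (f t) (g t)).
Proof.
move=> mf mg; apply: measurable_sum => i; apply: measurable_funM.
  exact: (measurableT_comp (coord_measurable_rV i) mf).
exact: (measurableT_comp (coord_measurable_rV i) mg).
Qed.

Lemma measurable_subr (dT : measure_display) (T : measurableType dT)
    (f g : T -> 'rV[R]_d) :
  measurable_fun setT f -> measurable_fun setT g ->
  measurable_fun setT (fun t => f t - g t).
Proof.
move=> mf mg; apply: measurable_fun_rV => j.
rewrite (_ : (fun _ => _) = fun t => f t ord0 j - g t ord0 j); last first.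
  by apply/funext => t; rewrite !mxE.
apply: measurable_funB.
  exact: (measurableT_comp (coord_measurable_rV j) mf).
exact: (measurableT_comp (coord_measurable_rV j) mg).
Qed.

Variables (h : R) (I : finType) (x : I -> 'rV[R]_d).
Hypothesis h0 : 0 < h.

Definition exp_sum (u : 'rV[R]_d) : R := normc (\sum_i expi (dot (x i) u / h)).

Lemma Re_sum (F : I -> R[i]) : complex.Re (\sum_i F i) = \sum_i complex.Re (F i).
Proof. by apply: (big_morph (@complex.Re R)) => // -[a b] [a' b']. Qed.

Lemma Im_sum (F : I -> R[i]) : complex.Im (\sum_i F i) = \sum_i complex.Im (F i).
Proof. by apply: (big_morph (@complex.Im R)) => // -[a b] [a' b']. Qed.

Lemma exp_sumE u : exp_sum u = Num.sqrt
  ((\sum_i cos (dot (x i) u / h)) ^+ 2 + (\sum_i sin (dot (x i) u / h)) ^+ 2).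
Proof.
rewrite /exp_sum -[LHS]ger0_norm ?normc_ge0// -sqrtr_sqr sqr_normcE Re_sum Im_sum.
by [].
Qed.

Lemma exp_sumN u : exp_sum (- u) = exp_sum u.
Proof.
rewrite !exp_sumE; congr (Num.sqrt (_ + _)).
  by congr (_ ^+ 2); apply: eq_bigr => i _; rewrite dotNr mulNr cosN.
rewrite -[RHS]sqrrN -sumrN; congr (_ ^+ 2).
by apply: eq_bigr => i _; rewrite dotNr mulNr sinN.
Qed.

Lemma measurable_exp_sum (dT : measure_display) (T : measurableType dT)
    (f : T -> 'rV[R]_d) :
  measurable_fun setT f -> measurable_fun setT (fun t => exp_sum (f t)).
Proof.
move=> mf; under eq_fun do rewrite exp_sumE.
have mphase i : measurable_fun setT (fun t => dot (x i) (f t) / h).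
  by apply: measurable_funM => //; apply: measurable_dot.
have msqrt : measurable_fun setT (@Num.sqrt R).
  by apply: continuous_measurable_fun; exact: sqrt_continuous.
apply: (measurableT_comp msqrt); apply: measurable_funD; apply: measurable_funX;
  apply: measurable_sum => i; apply: measurableT_comp (mphase i);
  apply: continuous_measurable_fun; [exact: continuous_cos|exact: continuous_sin].
Qed.

(** Translating the net by [b] only multiplies the exponential sum by a unimodular factor, so the
    bound is uniform in [b]. *)
Lemma sum_cos_le_exp_sum u b :
  `|\sum_i cos (dot u (x i + b) / h)| <= exp_sum u.
Proof.
pose z := \sum_i expi (dot u (x i + b) / h).
have -> : \sum_i cos (dot u (x i + b) / h) = complex.Re z by rewrite Re_sum.
have -> : exp_sum u = normc z.
  rewrite /exp_sum -(normc_expiM (dot u b / h)) mulr_sumr; congr normc.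
  apply: eq_bigr => i _; rewrite -expiD; congr expi.
  by rewrite dotDr (dotC u (x i)); ring.
rewrite -(@ler_pXn2r _ 2) ?nnegrE ?normc_ge0// sqr_normcE.
by rewrite real_normK ?num_real// lerDl sqr_ge0.
Qed.

Variables (X D : set 'rV[R]_d) (A : 'rV[R]_d -> R) (S : R).
Hypotheses (netX : is_net X h x) (mD : measurable D) (S0 : 0 <= S).
Hypotheses (iA : lambda.-integrable setT (EFin \o A)) (AD : forall y, ~ D y -> A y = 0).
Hypothesis A2 : (\int[lambda]_y (A y ^+ 2)%:E <= 1)%E.
Hypothesis expS : forall y, (\int[lambda]_(y' in D) (exp_sum (y' - y)%R)%:E <= S%:E)%E.

Lemma integral_amplitude_le :
  (\int[lambda]_(xi in thicken X h)
     ((\int[lambda]_y (cos (dot y xi / h) * A y)) ^+ 2 +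
      (\int[lambda]_y (sin (dot y xi / h) * A y)) ^+ 2)%:E
   <= (S * (6 * h) ^+ d)%:E)%E.
Proof.
have mA : measurable_fun setT A by apply/measurable_EFinP; case/integrableP: iA.
have mdot (f : R -> R) : continuous f -> measurable_fun setT
    (fun z : 'rV[R]_d * 'rV[R]_d => f (dot z.2 z.1 / h) * A z.2).
  move=> cf; apply: measurable_funM.
    apply: (measurableT_comp (continuous_measurable_fun cf)).
    apply: measurable_funM => //.
    by apply: measurable_dot; [exact: measurable_snd|exact: measurable_fst].
  by apply: (measurableT_comp mA); exact: measurable_snd.
have mC := measurable_parametric_Rintegral lambda (mdot _ (@continuous_cos R)).
have mS := measurable_parametric_Rintegral lambda (mdot _ (@continuous_sin R)).
apply: (integral_thicken_le h0 S0 netX).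
- apply/measurable_EFinP; apply: measurable_funD; apply: measurable_funX.
    exact: mC.
  exact: mS.
- by move=> xi; rewrite lee_fin addr_ge0 ?sqr_ge0.
move=> b; rewrite sumEFin.
pose th i y := dot y (x i + b) / h.
pose kap (z : 'rV[R]_d * 'rV[R]_d) := exp_sum (z.2 - z.1).
have mth i : measurable_fun setT (th i).
  by apply: measurable_funM => //; apply: measurable_dot.
have mkap : measurable_fun setT kap.
  apply: measurable_exp_sum.
  by apply: measurable_subr; [exact: measurable_snd|exact: measurable_fst].
have kb y y' : `|\sum_i cos (th i y' - th i y)| <= kap (y, y').
  rewrite /kap /=; apply: le_trans (sum_cos_le_exp_sum (y' - y) b).
  by under eq_bigr do rewrite /th -mulrBl -dotBl.
apply: (le_trans (sum_sqr_trig_le mth iA mkap kb)).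
apply: (le_trans (schur_le iA mkap kb mD S0 AD _ _)).
- by move=> y y'; rewrite /kap /= -exp_sumN opprB.
- by move=> y; exact: expS.
by rewrite -[leRHS]mule1; apply: lee_wpmul2l; rewrite ?lee_fin.
Qed.

End amplitudes.

(** * From nets to the operator norm *)

Section operator_bound.
Context (R : realType) (d : nat).
Local Notation lambda := (lebesgue_rV R d).

Lemma lebesgue_thicken_lty (Y : set 'rV[R]_d) h : compact Y -> 0 < h ->
  (lambda (thicken Y h) < +oo)%E.
Proof.
move=> cY h0; have [b b0 Yb] := bounded_of_compact cY.
have bh : 0 <= b + h by lra.
apply: le_lt_trans (ltry ((2 * (b + h)) ^+ d)).
apply: le_trans (lebesgue_rV_eball d bh).
have mY := measurable_thicken Y h.
have mB : measurable (eball (0 : 'rV[R]_d) (b + h)) by exact: measurable_eball.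
apply: le_measure; [exact: mem_set|exact: mem_set|].
move=> z [w Yw [u uh <-]]; rewrite /eball /= subr0.
apply: (le_lt_trans (ler_enormD _ _)); move: uh (Yb _ Yw).
by rewrite /eball /= subr0; lra.
Qed.

(** From mean squares to mean moduli: AM-GM with parameter t = h^(gamma/2) balances the square sum,
    at most C t^2, against the total mass, at most K. This leaves half of [gamma]. *)
Lemma sum_exp_sum_le (I J : finType) (x : I -> 'rV[R]_d) (y : J -> 'rV[R]_d)
    (h delta delta' K C gamma : R) : 0 < h ->
  \sum_(j : J) h `^ delta' <= K ->
  (forall c : I -> R[i], (forall i, normc (c i) <= h `^ delta) ->
    \sum_j h `^ delta' * normc (\sum_i wave x y c h i j) ^+ 2 <= C * h `^ gamma) ->
  forall u, \sum_j exp_sum h x (y j + u) <=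
    (C + K) / 2 * h `^ (gamma / 2 - delta - delta').
Proof.
move=> h0 nK bound u.
have hp a : 0 < h `^ a by exact: powR_gt0.
have hn (P : bool) : P ==> (h != 0) by rewrite (gt_eqF h0) implybT.
(* The translation by [u] of the points [y] is absorbed into the coefficients, whose modulus stays
   h^delta. *)
pose c i : R[i] := (h `^ delta)%:C%C * expi (dot (x i) u / h).
have cE i : normc (c i) = h `^ delta.
  rewrite /c ComplexField.Normc.normcM normc_expi mulr1 normc_real.
  by rewrite gtr0_norm.
have waveE j : normc (\sum_i wave x y c h i j) = h `^ delta * exp_sum h x (y j + u).
  rewrite /exp_sum -[h `^ delta in RHS]gtr0_norm// -normc_real -ComplexField.Normc.normcM.
  congr normc; rewrite mulr_sumr; apply: eq_bigr => i _.
  rewrite /wave /c -mulrA -expiD; congr (_ * expi _).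
  by rewrite dotDr; ring.
have := bound c (fun i => eq_ind_r (fun t => t <= h `^ delta) (lexx _) (cE i)).
under eq_bigr do rewrite waveE.
set t := h `^ (gamma / 2).
have t0 : 0 < t by exact: hp.
have tt : h `^ gamma = t * t.
  rewrite /t -powRD; last exact: hn.
  by congr (_ `^ _); lra.
rewrite tt => sqb.
have E : h `^ (gamma / 2 - delta - delta') = t / h `^ delta / h `^ delta'.
  by rewrite !powRB ?hn.
rewrite E.
have -> : (C + K) / 2 * (t / h `^ delta / h `^ delta') =
    ((C + K) / 2 * t) / (h `^ delta' * h `^ delta).
  by field; rewrite !gt_eqF.
rewrite ler_pdivlMr ?mulr_gt0// mulr_suml.
have amgm (v : R) : v <= 2^-1 * (v ^+ 2 / t + t).
  have : 0 <= (v - t) ^+ 2 / t by rewrite divr_ge0 ?sqr_ge0 ?ltW.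
  have -> : (v - t) ^+ 2 / t = v ^+ 2 / t + t - 2 * v by field; rewrite gt_eqF.
  lra.
apply: (@le_trans _ _ (\sum_j 2^-1 * ((h `^ delta' *
    (h `^ delta * exp_sum h x (y j + u)) ^+ 2) / t + h `^ delta' * t))).
  apply: ler_sum => j _.
  have -> : exp_sum h x (y j + u) * (h `^ delta' * h `^ delta) =
    h `^ delta' * (h `^ delta * exp_sum h x (y j + u)) by ring.
  apply: (le_trans (ler_wpM2l (ltW (hp delta')) (amgm _))).
  by rewrite le_eqVlt; apply/orP; left; apply/eqP; ring.
rewrite -mulr_sumr big_split /= -!mulr_suml.
have : (\sum_i h `^ delta' * (h `^ delta * exp_sum h x (y i + u)) ^+ 2) / t <= C * t.
  by rewrite ler_pdivrMr// -mulrA.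
have : (\sum_(j : J) h `^ delta') * t <= K * t by rewrite ler_pM2r.
lra.
Qed.

Variables (h S : R) (X Y : set 'rV[R]_d) (I : finType) (x : I -> 'rV[R]_d).
Hypotheses (h0 : 0 < h) (S0 : 0 <= S) (cY : compact Y) (netX : is_net X h x).
Hypothesis expS : forall y,
  (\int[lambda]_(y' in thicken Y h) (exp_sum h x (y' - y)%R)%:E <= S%:E)%E.

Let D := thicken Y h.
Let mD : measurable D. Proof. exact: measurable_thicken. Qed.

(** On the bounded set [D] square-integrability gives integrability, through |a| <= 1 + a^2. *)
Lemma amplitude_integrable (a : 'rV[R]_d -> R) : measurable_fun setT a ->
  (\int[lambda]_y (a y ^+ 2)%:E <= 1)%E ->
  lambda.-integrable setT (EFin \o (fun y => \1_D y * a y)) /\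
  (\int[lambda]_y ((\1_D y * a y) ^+ 2)%:E <= 1)%E.
Proof.
move=> ma a1.
have m1D : measurable_fun setT (\1_D : 'rV[R]_d -> R) by exact: measurable_indic.
have m1a : measurable_fun setT (fun y => \1_D y * a y) by exact: measurable_funM.
have ma2 : measurable_fun setT (fun y => (a y ^+ 2)%:E).
  by apply/measurable_EFinP; exact: measurable_funX.
have m1DE : measurable_fun setT (fun y : 'rV[R]_d => (\1_D y)%:E : \bar R).
  exact/measurable_EFinP.
split; last first.
  apply: le_trans a1; apply: ge0_le_integral => //.
  - by move=> y _; rewrite lee_fin sqr_ge0.
  - by apply/measurable_EFinP; exact: measurable_funX.
  move=> y _; rewrite lee_fin indicE; case: (_ \in _); first by rewrite mul1r.
  by rewrite mul0r expr0n sqr_ge0.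
apply/integrableP; split; first exact/measurable_EFinP.
have ind0 y : setT y -> (0 <= (\1_D y)%:E :> \bar R)%E by rewrite lee_fin indicE ler0n.
have a20 y : setT y -> (0 <= (a y ^+ 2)%:E)%E by rewrite lee_fin sqr_ge0.
apply: (@le_lt_trans _ _ (\int[lambda]_y ((\1_D y)%:E + (a y ^+ 2)%:E)))%E.
  apply: ge0_le_integral => //.
  - by apply: measurableT_comp => //; exact/measurable_EFinP.
  - exact: emeasurable_funD.
  move=> y _ /=; rewrite lee_fin normrM -(real_normK (num_real (a y))).
  rewrite indicE; case: (_ \in _) => /=; rewrite ?mulr1n ?mulr0n ?normr1 ?normr0 ?mul1r ?mul0r.
    have := sqr_ge0 (`|a y| - 1); have := sqr_ge0 `|a y|.
    by rewrite sqrrB expr1n; lra.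
  by rewrite add0r sqr_ge0.
rewrite (ge0_integralD lambda measurableT ind0 m1DE a20 ma2).
rewrite integral_indic// setIT; apply: lte_add_pinfty.
  exact: lebesgue_thicken_lty.
exact: (le_lt_trans a1 (ltry _)).
Qed.

Definition cos_int (A : 'rV[R]_d -> R) xi := \int[lambda]_y (cos (dot y xi / h) * A y).
Definition sin_int (A : 'rV[R]_d -> R) xi := \int[lambda]_y (sin (dot y xi / h) * A y).

Lemma cintegral_modulation_sqr (f : 'rV[R]_d -> R[i]) xi :
  lambda.-integrable setT (EFin \o (fun y => complex.Re (f y))) ->
  lambda.-integrable setT (EFin \o (fun y => complex.Im (f y))) ->
  normc (cintegral (fun y => expi (- (dot y xi / h)) * f y)) ^+ 2 =
  (cos_int (fun y => complex.Re (f y)) xi + sin_int (fun y => complex.Im (f y)) xi) ^+ 2 +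
  (cos_int (fun y => complex.Im (f y)) xi - sin_int (fun y => complex.Re (f y)) xi) ^+ 2.
Proof.
move=> ia ib; set a := fun y => _ in ia *; set b := fun y => _ in ib *.
have mph : measurable_fun setT (fun y : 'rV[R]_d => dot y xi / h).
  by apply: measurable_funM => //; apply: measurable_dot.
have mcos : measurable_fun setT (fun y : 'rV[R]_d => cos (dot y xi / h)).
  by apply: (measurableT_comp _ mph); apply: continuous_measurable_fun; exact: continuous_cos.
have msin : measurable_fun setT (fun y : 'rV[R]_d => sin (dot y xi / h)).
  by apply: (measurableT_comp _ mph); apply: continuous_measurable_fun; exact: continuous_sin.
have ic A := @integrable_bounded_mul _ _ _ lambda _ A _ mcos (fun y => cos_max _).
have isn A := @integrable_bounded_mul _ _ _ lambda _ A _ msin (fun y => sin_max _).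
rewrite sqr_normcE /cintegral /=; congr (_ ^+ 2 + _ ^+ 2).
  rewrite /cos_int /sin_int -RintegralD//; [|exact: ic|exact: isn].
  apply: eq_Rintegral => y _; rewrite /expi /a /b.
  by case: (f y) => p q /=; rewrite cosN sinN; ring.
rewrite /cos_int /sin_int -RintegralB//; [|exact: ic|exact: isn].
apply: eq_Rintegral => y _; rewrite /expi /a /b.
by case: (f y) => p q /=; rewrite cosN sinN; ring.
Qed.

Lemma operator_bound (f : 'rV[R]_d -> R[i]) : L2 f -> (L2norm f <= 1)%E ->
  (L2norm (mul_indic (thicken X h) (sc_fourier h (mul_indic (thicken Y h) f))) <=
   ((4 * ((2 * pi * h) `^ (- (d%:R / 2))) ^+ 2 * (S * (6 * h) ^+ d)) `^ 2^-1)%:E)%E.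
Proof.
move=> [mRe mIm _] f1.
have Sd0 : 0 <= S * (6 * h) ^+ d by rewrite mulr_ge0// exprn_ge0// mulr_ge0// ltW.
have := integral_le1_of_L2norm f1 => f2.
have mf2 : measurable_fun setT (fun y => (normc (f y) ^+ 2)%:E).
  apply/measurable_EFinP; under eq_fun do rewrite sqr_normcE.
  by apply: measurable_funD; exact: measurable_funX.
pose a y := complex.Re (f y); pose b y := complex.Im (f y).
have [ia a1] : lambda.-integrable setT (EFin \o (fun y => \1_D y * a y)) /\
    (\int[lambda]_y ((\1_D y * a y) ^+ 2)%:E <= 1)%E.
  apply: amplitude_integrable => //; apply: le_trans f2; apply: ge0_le_integral => //.
  - by move=> y _; rewrite lee_fin sqr_ge0.
  - by apply/measurable_EFinP; exact: measurable_funX.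
  by move=> y _; rewrite lee_fin sqr_normcE lerDl sqr_ge0.
have [ib b1] : lambda.-integrable setT (EFin \o (fun y => \1_D y * b y)) /\
    (\int[lambda]_y ((\1_D y * b y) ^+ 2)%:E <= 1)%E.
  apply: amplitude_integrable => //; apply: le_trans f2; apply: ge0_le_integral => //.
  - by move=> y _; rewrite lee_fin sqr_ge0.
  - by apply/measurable_EFinP; exact: measurable_funX.
  by move=> y _; rewrite lee_fin sqr_normcE lerDr sqr_ge0.
have off (g : 'rV[R]_d -> R) y : ~ D y -> \1_D y * g y = 0.
  by move=> nD; rewrite indicE memNset// mul0r.
have Ia := integral_amplitude_le h0 netX mD S0 ia (off a) a1 expS.
have Ib := integral_amplitude_le h0 netX mD S0 ib (off b) b1 expS.
rewrite -/(cos_int _ _) -/(sin_int _ _) in Ia Ib.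
set A := fun y => \1_D y * a y in ia a1 Ia; set B := fun y => \1_D y * b y in ib b1 Ib.
have ReE y : complex.Re (mul_indic D f y) = A y.
  by rewrite /mul_indic /A /a; case: (f y) => p q /=; rewrite mul0r subr0.
have ImE y : complex.Im (mul_indic D f y) = B y.
  by rewrite /mul_indic /B /b; case: (f y) => p q /=; rewrite mul0r addr0.
set c := (2 * pi * h) `^ _.
have mA : measurable_fun setT A by apply/measurable_EFinP; case/integrableP: ia.
have mB : measurable_fun setT B by apply/measurable_EFinP; case/integrableP: ib.
have mint (t : R -> R) (G : 'rV[R]_d -> R) : continuous t -> measurable_fun setT G ->
    measurable_fun setT (fun xi => \int[lambda]_y (t (dot y xi / h) * G y)).
  move=> ct mG; apply: (measurable_parametric_Rintegral lambda
    (F := fun z : 'rV[R]_d * 'rV[R]_d => t (dot z.2 z.1 / h) * G z.2)).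
  apply: measurable_funM.
    apply: (measurableT_comp (continuous_measurable_fun ct)).
    apply: measurable_funM => //.
    by apply: measurable_dot; [exact: measurable_snd|exact: measurable_fst].
  by apply: (measurableT_comp mG); exact: measurable_snd.
have mCA := mint _ _ (@continuous_cos R) mA; have mSA := mint _ _ (@continuous_sin R) mA.
have mCB := mint _ _ (@continuous_cos R) mB; have mSB := mint _ _ (@continuous_sin R) mB.
apply: L2norm_le; first by rewrite mulr_ge0// mulr_ge0// sqr_ge0.
have normE xi : normc (mul_indic (thicken X h) (sc_fourier h (mul_indic D f)) xi) ^+ 2 =
    \1_(thicken X h) xi * (c ^+ 2 * ((cos_int A xi + sin_int B xi) ^+ 2 +
      (cos_int B xi - sin_int A xi) ^+ 2)).
  rewrite /mul_indic -/(mul_indic D f) /sc_fourier !ComplexField.Normc.normcM !exprMn.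
  rewrite !normc_real !real_normK ?num_real// -/c.
  congr (_ * _); first by rewrite indicE; case: (_ \in _); rewrite ?expr1n ?expr0n.
  congr (_ * _); rewrite cintegral_modulation_sqr.
  - have -> : (fun y => complex.Re (mul_indic D f y)) = A by apply/funext => y; exact: ReE.
    by have -> : (fun y => complex.Im (mul_indic D f y)) = B by apply/funext => y; exact: ImE.
  - by have -> : (fun y => complex.Re (mul_indic D f y)) = A by apply/funext => y; exact: ReE.
  - by have -> : (fun y => complex.Im (mul_indic D f y)) = B by apply/funext => y; exact: ImE.
under eq_integral do rewrite normE.
pose PA xi := cos_int A xi ^+ 2 + sin_int A xi ^+ 2.
pose PB xi := cos_int B xi ^+ 2 + sin_int B xi ^+ 2.
have mPA : measurable_fun setT PA by apply: measurable_funD; exact: measurable_funX.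
have mPB : measurable_fun setT PB by apply: measurable_funD; exact: measurable_funX.
have PA0 xi : 0 <= PA xi by rewrite addr_ge0 ?sqr_ge0.
have PB0 xi : 0 <= PB xi by rewrite addr_ge0 ?sqr_ge0.
have mXh := measurable_thicken X h.
(* The inequality (u + v)^2 <= 2 u^2 + 2 v^2 decouples the real and imaginary parts of f, so that
   [Ia] and [Ib] apply separately. *)
apply: (@le_trans _ _ (\int[lambda]_(xi in thicken X h)
    ((2 * c ^+ 2)%:E * ((PA xi)%:E + (PB xi)%:E))))%E.
  rewrite [leRHS]integral_mkcond; apply: ge0_le_integral => //.
  - move=> xi _; rewrite lee_fin mulr_ge0 ?indicE ?ler0n// mulr_ge0 ?sqr_ge0//.
    by rewrite addr_ge0 ?sqr_ge0.
  - apply/measurable_EFinP; apply: measurable_funM; first exact: measurable_indic.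
    apply: measurable_funM => //; apply: measurable_funD; apply: measurable_funX.
      exact: measurable_funD.
    exact: measurable_funB.
  - apply/(measurable_restrictT _ mXh); apply: measurable_funTS.
    apply: measurable_funeM; apply: emeasurable_funD; exact/measurable_EFinP.
  move=> xi _; rewrite patchE indicE; case: ifPn => _; last by rewrite mul0r.
  rewrite -EFinD -EFinM lee_fin mul1r.
  have -> : 2 * c ^+ 2 * (PA xi + PB xi) = c ^+ 2 * (2 * (PA xi + PB xi)) by ring.
  rewrite ler_wpM2l ?sqr_ge0// /PA /PB.
  have := sqr_ge0 (cos_int A xi - sin_int B xi); have := sqr_ge0 (cos_int B xi + sin_int A xi).
  by lra.
have mPAE : measurable_fun (thicken X h) (fun xi => (PA xi)%:E).
  by apply: measurable_funTS; exact/measurable_EFinP.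
have mPBE : measurable_fun (thicken X h) (fun xi => (PB xi)%:E).
  by apply: measurable_funTS; exact/measurable_EFinP.
have PA0E xi : thicken X h xi -> (0 <= (PA xi)%:E)%E by rewrite lee_fin.
have PB0E xi : thicken X h xi -> (0 <= (PB xi)%:E)%E by rewrite lee_fin.
have c20 : (0 <= (2 * c ^+ 2)%:E)%E by rewrite lee_fin mulr_ge0 ?sqr_ge0.
rewrite (ge0_integralZl lambda mXh (emeasurable_funD mPAE mPBE))//; last first.
  by move=> xi Xxi; rewrite adde_ge0 ?PA0E ?PB0E.
rewrite (ge0_integralD lambda mXh PA0E mPAE PB0E mPBE).
apply: (@le_trans _ _ ((2 * c ^+ 2)%:E * ((S * (6 * h) ^+ d)%:E + (S * (6 * h) ^+ d)%:E)))%E.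
  by apply: lee_wpmul2l => //; apply: leeD.
by rewrite -EFinD -EFinM lee_fin; lra.
Qed.

End operator_bound.

Theorem corollary1p5 (R : realType) (d : nat) (delta delta' : R)
    (X Y : set 'rV[R]_d) :
  (1 <= d)%N ->
  0 < delta < d%:R ->
  0 < delta' < d%:R ->
  compact X ->
  compact Y ->
  AD_regular_set X delta 0 1 ->
  AD_regular_set Y delta' 0 1 ->
  (exists c_N : R, 0 < c_N <= 1 /\ nonorthogonal (fun x y => - dot x y) X Y c_N) ->
  exists eps0 C : R, 0 < eps0 /\ 0 < C /\
    forall h : R, 0 < h < 1 ->
      (L2opnorm (fun f => mul_indic (thicken X h)
                   (sc_fourier h (mul_indic (thicken Y h) f)))
       <= (C * h `^ ((d%:R - delta - delta') / 2 + eps0))%:E)%E.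
Proof.
move=> _ /andP[delta0 _] /andP[delta'0 _] cX cY [mu [CX [regX XE]]] [nu [CY [regY YE]]].
move=> [cN [/andP[cN0 cN1] non]].
have [KX KX1 netX] := regular_net delta0 regX.
have [KY KY1 netY] := regular_net delta'0 regY.
pose K := Num.max KX KY.
have [KXK KYK] : KX <= K /\ KY <= K by rewrite !le_max !lexx orbT.
have K1 : 1 <= K by exact: le_trans KXK.
clearbody K.
pose A0 := 128 / cN.
have A04 : 4 <= A0 by rewrite ler_pdivlMr//; lra.
have [||||gamma [C0 [gamma0 [C00 main]]]] :=
  @discrete_uncertainty R (cN / 8) delta delta' K A0; try by lra.
(* Product of the 4 of [operator_bound], the (C0 + K) / 2 of [sum_exp_sum_le], and 36^d / (2 pi)^d,
   where each of the two averages over translates contributes (6 h)^d. *)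
pose C1 := 2 * (18 / pi) ^+ d * (C0 + K).
have pi0 : 0 < pi :> R by exact: pi_gt0.
have C10 : 0 < C1.
  by rewrite mulr_gt0//; [rewrite mulr_gt0// exprn_gt0// divr_gt0|lra].
(* The squared norm is bounded by C1 h^(d - delta - delta' + gamma / 2); its square root leaves
   gamma / 4. *)
exists (gamma / 4), (C1 `^ 2^-1); split; first by rewrite divr_gt0.
split; first exact: powR_gt0.
move=> h /andP[h0 h1].
have [I [x [xX xsep xcov]]] := net_exists cX h0.
have [J [y [yY ysep ycov]]] := net_exists cY h0.
have nX : is_net X h x by split.
have nY : is_net Y h y by split.
have A00 : 0 < A0 by lra.
have rX : discrete_regular x (fun=> h `^ delta) delta K A0 h.
  apply: (discrete_regularW _ KXK) => //; first by lra.
  by apply: netX => //; rewrite -XE.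
have rY : discrete_regular y (fun=> h `^ delta') delta' K A0 h.
  apply: (discrete_regularW _ KYK) => //; first by lra.
  by apply: netY => //; rewrite -YE.
have nonXY := nonorthogonal_net cN0 cN1 non h0 nX nY.
have bound := main d I J x y _ (fun=> h `^ delta) (fun=> h `^ delta') h h0 rX rY nonXY.
have [_ sumY _] := rY.
have sumS := sum_exp_sum_le h0 sumY bound.
set S' := _ * h `^ _ in sumS.
have S'0 : 0 <= S'.
  by rewrite mulr_ge0 ?powR_ge0// divr_ge0//; lra.
have expS z : (\int[lebesgue_rV R d]_(y' in thicken Y h) (exp_sum h x (y' - z)%R)%:E
    <= (S' * (6 * h) ^+ d)%:E)%E.
  apply: (integral_thicken_le h0 S'0 nY).
  - apply/measurable_EFinP; apply: measurable_exp_sum.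
    by apply: measurable_subr.
  - by move=> ?; rewrite lee_fin normc_ge0.
  - move=> b; rewrite sumEFin lee_fin; apply: le_trans (sumS (b - z)).
    by under eq_bigr do rewrite -addrA.
have S0 : 0 <= S' * (6 * h) ^+ d by rewrite mulr_ge0// exprn_ge0// mulr_ge0// ltW.
apply: ge_ereal_sup => _ [f [Lf f1] <-].
apply: (le_trans (operator_bound h0 S0 cY nX expS Lf f1)).
rewrite lee_fin.
have ph0 : 0 < 2 * pi * h by rewrite !mulr_gt0.
have -> : ((2 * pi * h) `^ (- (d%:R / 2))) ^+ 2 = (2 * pi * h) ^- d.
  rewrite -powR_mulrn ?powR_ge0// -powRrM -powR_invn ?(ltW ph0)//.
  by congr (_ `^ _); field.
have -> : 4 * (2 * pi * h) ^- d * (S' * (6 * h) ^+ d * (6 * h) ^+ d) =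
    C1 * h `^ (gamma / 2 - delta - delta' + d%:R).
  rewrite powRD; last by rewrite (gt_eqF h0) implybT.
  rewrite powR_mulrn ?(ltW h0)// /C1 /S'.
  have sq (p : R) : 0 < p ->
      (6 * h) ^+ d * (6 * h) ^+ d = (2 * p * h) ^+ d * ((18 / p) ^+ d * h ^+ d).
    by move=> p0; rewrite -!exprMn; congr (_ ^+ d); field; rewrite gt_eqF.
  rewrite -(mulrA _ ((6 * h) ^+ d)) (sq _ pi0).
  have P0 : (2 * pi * h) ^+ d != 0 by rewrite gt_eqF// exprn_gt0.
  move: P0; set P := (2 * pi * h) ^+ d; set Q := (18 / pi) ^+ d => P0.
  by field.
have h2 : 0 <= h `^ (gamma / 2 - delta - delta' + d%:R) by exact: powR_ge0.
rewrite (powRM _ (ltW C10) h2) -powRrM.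
rewrite ler_wpM2l ?powR_ge0//.
by rewrite le_eqVlt; apply/orP; left; apply/eqP; congr (_ `^ _); field.
Qed.
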